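(* Let $m,n\in\mathbb{N}$ and let $\mathfrak{o}$ be a compact discrete valuation ring (of arbitrary characteristic). Then $$\left.\frac{\zeta^{\triangleleft}_{L_{m,n}(\mathfrak{o})}(s)}{\zeta_{\mathfrak{o}^{h(m,n)}}(s)}\right|_{s=0}=1,$$ where both zeta functions are understood as meromorphic functions on $\mathbb{C}$ (being rational functions in $q^{-s}$, with $q$ the residue field cardinality of $\mathfrak{o}$) and the value at $s=0$ is that of the meromorphic quotient.
   Context: $\mathbb{N}=\{1,2,\dots\}$, $\mathbb{N}_0=\mathbb{N}\cup\{0\}$. The Lie ring $L_{m,n}$: put $\mathbf{E}=\{\mathbf{e}\in\mathbb{N}_0^n \mid e_1+\dots+e_n=m-1\}$ and $\mathbf{F}=\{\mathbf{f}\in\mathbb{N}_0^n\mid f_1+\dots+f_n=m\}$. $L_{m,n}$ is the class-2-nilpotent Lie ring which is free as a $\mathbb{Z}$-module on the elements $x_{\mathbf{e}}$ ($\mathbf{e}\in\mathbf{E}$), $y_{\mathbf{f}}$ ($\mathbf{f}\in\mathbf{F}$), $z_1,\dots,z_n$, with $[x_{\mathbf{e}},y_{\mathbf{f}}]=-[y_{\mathbf f},x_{\mathbf e}]=z_i$ if $\mathbf{f}-\mathbf{e}$ is the $i$-th standard basis vector of $\mathbb{Z}^n$, $[x_{\mathbf{e}},y_{\mathbf{f}}]=0$ if $\mathbf{f}-\mathbf{e}$ is not a standard basis vector, and all other brackets of basis elements equal to $0$. $L_{m,n}(\mathfrak{o})=L_{m,n}\otimes_{\mathbb{Z}}\mathfrak{o}$.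 Numbers: $e(m,n)=\binom{n+m-2}{n-1}$, $f(m,n)=\binom{n+m-1}{n-1}$, $d(m,n)=e(m,n)+f(m,n)$, $h(m,n)=d(m,n)+n$. Zeta functions: $\zeta^{\triangleleft}_{L_{m,n}(\mathfrak{o})}(s)=\sum_{I}|L_{m,n}(\mathfrak{o}):I|^{-s}$, where $I$ ranges over the $\mathfrak{o}$-ideals of finite index in $L_{m,n}(\mathfrak{o})$; $\zeta_{\mathfrak{o}^d}(s)$ is the analogous series enumerating all $\mathfrak{o}$-submodules of finite index in $\mathfrak{o}^d$, and equals $\prod_{i=0}^{d-1}(1-q^{i-s})^{-1}$. *)

(* Defs.v *)
From HB Require Import structures.
From mathcomp Require Import all_boot all_order all_algebra finmap.
From mathcomp Require Import all_classical all_reals all_analysis.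
From mathcomp Require Import summability.
From mathcomp.real_closed Require Import complex.

Set Implicit Arguments.
Unset Strict Implicit.
Unset Printing Implicit Defensive.

Import Order.TTheory GRing.Theory Num.Theory numFieldNormedType.Exports.

Local Open Scope classical_set_scope.
Local Open Scope ring_scope.

(* The values of v at 0 are irrelevant: v stands for a map K^* -> Z. *)
Definition discrete_valuation (K : fieldType) (v : K -> int) : Prop :=
  [/\ forall x y, x != 0 -> y != 0 -> v (x * y) = v x + v y,
      forall x y, x != 0 -> y != 0 -> x + y != 0 ->
        Num.min (v x) (v y) <= v (x + y)
    & forall k : int, exists2 x, x != 0 & v x = k].

Definition valuation_ring_of (o : idomainType) (v : {fraction o} -> int) :
    Prop :=
  forall x : {fraction o},
    (exists a : o, x = tofrac a) <-> (x = 0 \/ 0 <= v x).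

(* A copy of o carrying the topology whose basic neighbourhoods of x are the
   balls {y | v (y - x) >= k}, with v 0 = +oo. *)
Definition val_top (o : idomainType) (v : {fraction o} -> int) : Type := o.

Section ValuationTopology.
Context (o : idomainType) (v : {fraction o} -> int).

HB.instance Definition _ := Choice.on (val_top v).

Definition val_ball (k : int) (x y : o) : Prop :=
  y = x \/ k <= v (tofrac (y - x)).

Definition val_open (U : set (val_top v)) : Prop :=
  forall x, U x -> exists k : int, val_ball k x `<=` U.

Let val_openT : val_open setT.
Proof. by move=> x _; exists 0. Qed.

Let val_openI : setI_closed val_open.
Proof.
move=> U V oU oV x [/oU[k kU] /oV[l lV]]; exists (Num.max k l) => y xy.
split.
- by apply: kU; case: xy => [->|]; [left|rewrite ge_max => /andP[]; right].
- by apply: lV; case: xy => [->|]; [left|rewrite ge_max => /andP[]; right].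
Qed.

Let val_open_bigU (I : Type) (f : I -> set (val_top v)) :
  (forall i, val_open (f i)) -> val_open (\bigcup_i f i).
Proof.
move=> oF x [i _ /oF[k kF]]; exists k => y /kF fiy.
by exists i.
Qed.

HB.instance Definition _ :=
  isOpenTopological.Build (val_top v) val_openT val_openI val_open_bigU.

End ValuationTopology.

Definition compact_dvr (o : idomainType) : Prop :=
  exists v : {fraction o} -> int,
    [/\ discrete_valuation v, valuation_ring_of v
      & compact [set: val_top v]].

Section Index.
Context (M : zmodType).
Implicit Types N : set M.

Definition cosets N : set (set M) := range (fun x => [set y | N (y - x)]).

Definition finite_index N : Prop := finite_set (cosets N).

(* 0 when the index is infinite *)
Definition coset_index N : nat := #|` fset_set (cosets N)|%fset.

End Index.

(* In a local ring the non-units form the maximal ideal. *)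
Definition residue_card (o : idomainType) : nat :=
  coset_index [set x : o | x \isn't a GRing.unit].

Definition is_submodule (o : pzRingType) (M : lmodType o) (N : set M) : Prop :=
  submod_closed [in N].

(* Multi-indices with coordinate sum m.-1, resp. m; the bounds on the
   coordinates are implied by the sum condition (when 0 < m) and only serve to
   make the types finite. *)
Definition multiE (m n : nat) : finType :=
  {e : {ffun 'I_n -> 'I_m} | (\sum_i e i == m.-1)%N}.
Definition multiF (m n : nat) : finType :=
  {f : {ffun 'I_n -> 'I_m.+1} | (\sum_i f i == m)%N}.

(* inl (inl e), inl (inr f) and inr i stand for x_e, y_f and z_i. *)
Definition lie_basis (m n : nat) : finType :=
  (multiE m n + multiF m n + 'I_n)%type.

(* f - e is the i-th standard basis vector *)
Definition unit_step (m n : nat) (e : multiE m n) (f : multiF m n) (i : 'I_n) :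
    bool :=
  [forall j, val f j == val e j + (j == i) :> nat]%N.

(* Coefficient of the basis element c in the bracket [a, b]. *)
Definition lie_coef (m n : nat) (a b c : lie_basis m n) : int :=
  match a, b, c with
  | inl (inl e), inl (inr f), inr i => (unit_step e f i)%:R
  | inl (inr f), inl (inl e), inr i => - (unit_step e f i)%:R
  | _, _, _ => 0
  end.

(* L_{m,n} tensored with o: the free o-module on the same basis, with the
   bracket given by the images in o of the integral structure constants. *)
Definition Lmn (m n : nat) (o : comNzRingType) : lmodType o :=
  {ffun lie_basis m n -> o^o}.

Definition lie_bracket (m n : nat) (o : comNzRingType) (u w : Lmn m n o) :
    Lmn m n o :=
  [ffun c => \sum_a \sum_b (lie_coef a b c)%:~R * (u a * w b)].

Definition lie_ideals (m n : nat) (o : comNzRingType) :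
    set (set (Lmn m n o)) :=
  [set N | [/\ is_submodule N, forall u w, N w -> N (lie_bracket u w)
             & finite_index N]].
Arguments lie_ideals : clear implicits.

Definition free_submodules (d : nat) (o : comNzRingType) :
    set (set 'rV[o]_d) :=
  [set N | is_submodule N /\ finite_index N].
Arguments free_submodules : clear implicits.

Definition emn (m n : nat) : nat := 'C(n + m - 2, n - 1).
Definition fmn (m n : nat) : nat := 'C(n + m - 1, n - 1).
Definition dmn (m n : nat) : nat := (emn m n + fmn m n)%N.
Definition hmn (m n : nat) : nat := (dmn m n + n)%N.

Section Zeta.
Context (R : realType).

(* Declared as a numClosedFieldType so that the topology of R[i] is found. *)
Definition Cplx : numClosedFieldType := R[i].

Definition Cexp (z : Cplx) : Cplx :=
  Complex (expR (complex.Re z) * cos (complex.Im z))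
          (expR (complex.Re z) * sin (complex.Im z)).

(* k ^ s for a positive natural number k *)
Definition natCpow (k : nat) (s : Cplx) : Cplx :=
  Cexp (s * (Complex (ln k%:R) 0 : Cplx)).

(* z is the sum over N in X of |M : N| ^ (-s), taken as the limit along the
   directed set of finite subfamilies. *)
Definition zeta_sum (M : zmodType) (X : set (set M)) (s z : Cplx) : Prop :=
  partial_sum ((fun N => natCpow (coset_index N) (- s)) \_ X) @ totally --> z.

(* Z is, away from a discrete set of possible poles, given by a rational
   function in q ^ (-s). *)
Definition rational_in_qs (q : nat) (Z : Cplx -> Cplx) : Prop :=
  exists P Q : {poly Cplx}, Q != 0 /\
    forall s, Q.[natCpow q (- s)] != 0 ->
      Z s = P.[natCpow q (- s)] / Q.[natCpow q (- s)].

(* Z is the meromorphic function on the complex plane defined by the zeta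
   series over X; its values at poles are irrelevant. *)
Definition is_zeta (q : nat) (M : zmodType) (X : set (set M))
    (Z : Cplx -> Cplx) : Prop :=
  rational_in_qs q Z /\
  exists sigma : R, forall s, sigma < complex.Re s -> zeta_sum X s (Z s).

End Zeta.

(* Main.v *)
Require Import Defs.
From HB Require Import structures.
From mathcomp Require Import all_boot all_order all_fingroup all_algebra finmap.
From mathcomp Require Import all_classical all_reals all_analysis.
From mathcomp Require Import summability.
From mathcomp.real_closed Require Import complex.
From mathcomp Require Import ring lra zify.

(** Let [L = L_{m,n}(o)] and [T = q ^ (- s)]. An ideal [I] of [L] meets the
    span [o ^ n] of the [z_i] in a submodule [M] of finite index and projects
    onto a submodule [N] of [o ^ d]; the ideal condition says that [N] lies in
    the centralizer [X M] of [M], the set of elements whose brackets are all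
    in [M]. For given [M] and [N] the ideals are the homomorphisms from the
    free module [N] of rank [d] to [o ^ n / M] ([esum_extensions]). As [X M]
    is free of rank [d], its submodules are enumerated by the zeta function of
    [o ^ d] shifted by the index of [X M] ([esum_constrained]). Hence the
    ideal zeta function is the zeta function of [o ^ d] times [W = \sum_M |o ^
    n : M| ^ d * T ^ (log_q |o ^ n : M| + log_q |o ^ d : X M|)]. For the zero
    bracket the same argument gives the zeta function of [o ^ (d + n)] as that
    of [o ^ d] times the sum [W_0] in which [log_q |o ^ d : X M|] is replaced
    by [0]. So the quotient is [W / W_0]. The exponents of [T] disappear at [T
    = 1], but there both series diverge and one has to compare the values of
    the rational functions.

    The index of [X M] only depends on the elementary divisors of [M].
    Identify elements spanned by the [x_e] with polynomials of degree [m - 1],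
    and elements spanned by the [y_f] with linear forms on polynomials of
    degree [m], that is, with symmetric tensors; an element lies in [X M] if
    and only if, for each column [phi] of the matrix which brings [M] into
    diagonal form, its product with [phi], respectively its contraction with
    [phi], is divisible by a certain power of [p]. Divisibility of the product
    is Gauss' lemma ([contractE_cond]); for the contraction one lets the
    matrix act on tensors ([contractF_cond]). The result is that [log_q |o ^ d
    : X M|] is the sum over [k] of [C] evaluated at the number of elementary
    divisors divisible by [p ^ (k + 1)], for some function [C] with [C 0 = 0]
    ([vol_centralizer]). Write [W_C] for the sum [W] with this exponent, so
    that [W_0] is the case [C = 0].

    For any [C] with [C 0 = 0] write [M = p ^ k M'] with [M'] not contained in
    [p o ^ n], and sort the [M'] by their reduction [U] modulo [p]. The [M']
    over a given [U] are parametrized by lattices of the smaller rank [n - dim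
    U] and extension classes ([esum_flag_fiber]). This expresses [W_C] as [1 /
    (1 - q ^ (n d) T ^ (n + C n))] times a finite sum of functions of the same
    kind of smaller rank, multiplied by constants and powers of [T]. By
    induction [W_C] is a rational function of [T], regular at [T = 1], and its
    value there does not depend on [C] ([zetaw_ratf1]). The value is not [0],
    since for [C = 0] the function is [1 / \prod_(i < n) (1 - q ^ (d + i) T)]
    ([zetaw_value_neq0]).

    These identities are proved between sums with values in [0, +oo] for real
    [T > 0]. For small [T] the sums are rational functions of [T], which
    determines the coefficients of the power series in [T], hence also the
    sums for complex [T] ([esum_partial_sum_cvg]); and a meromorphic
    continuation which is rational in [q ^ (- s)] is determined by its values
    on a half-plane ([is_zeta_unique]). *)

Set Implicit Arguments.
Unset Strict Implicit.
Unset Printing Implicit Defensive.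

Import Order.TTheory GRing.Theory Num.Theory numFieldNormedType.Exports.

Local Open Scope classical_set_scope.
Local Open Scope ring_scope.

(** * Index of subgroups via systems of representatives *)

(** Representatives are numbered by [i < k] inside a total function on [nat], so
    that no type depends on [k]. *)
Definition has_index (V : zmodType) (N : set V) (k : nat) : Prop :=
  exists r : nat -> V,
    (forall x, exists2 i, (i < k)%N & N (x - r i)) /\
    (forall i j, (i < k)%N -> (j < k)%N -> N (r i - r j) -> i = j).

Definition is_subgroup (V : zmodType) (N : set V) : Prop :=
  N 0 /\ forall x y, N x -> N y -> N (x - y).

Section HasIndex.
Context (V : zmodType).
Implicit Types N : set V.

Lemma has_index_fin (J : finType) (r : J -> V) N :
  (forall x, exists j, N (x - r j)) -> (forall i j, N (r i - r j) -> i = j) ->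
  has_index N #|J|.
Proof.
move=> rS rI; have [j0 _] := rS 0.
pose r' (i : nat) := r (nth j0 (enum J) i).
have szE : size (enum J) = #|J| by rewrite cardE.
exists r'; split=> [x|i j ltiJ ltjJ /rI/eqP].
  have [j Nj] := rS x; exists (index j (enum J)).
    by rewrite -szE index_mem mem_enum.
  by rewrite /r' nth_index ?mem_enum.
by rewrite nth_uniq ?szE ?enum_uniq// => /eqP.
Qed.

Lemma coset_eq N x y : is_subgroup N ->
  [set z | N (z - x)] = [set z | N (z - y)] <-> N (x - y).
Proof.
move=> [N0 NB]; split=> [/seteqP[+ _]|Nxy]; first by apply; rewrite /= subrr.
have NN u : N u -> N (- u) by rewrite -(sub0r u); exact: NB.
apply/seteqP; split=> z /= Nz.
  by have := NB _ _ Nz (NN _ Nxy); rewrite opprK addrA subrK.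
by have := NB _ _ Nz Nxy; rewrite opprB addrA subrK.
Qed.

Lemma cosets_image N r k : is_subgroup N ->
  (forall x, exists2 i, (i < k)%N & N (x - r i)) ->
  cosets N = [set [set y | N (y - r i)] | i in `I_k].
Proof.
move=> sN rS; apply/seteqP; split=> [_ [x _ <-]|_ [i _ <-]]; last first.
  by exists (r i).
by have [i ltik Ni] := rS x; exists i => //; apply/esym/(coset_eq _ _ sN).
Qed.

Lemma has_index_coset N k : is_subgroup N -> has_index N k ->
  finite_index N /\ coset_index N = k.
Proof.
move=> sN [r [rS rI]]; rewrite /finite_index /coset_index (cosets_image sN rS).
split; first exact/finite_image/finite_II.
apply: card_fset_set; apply: inj_card_eq => i j; rewrite !inE/= => ltik ltjk.
by move=> /(coset_eq _ _ sN); exact: rI.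
Qed.

Lemma finite_index_has_index N : is_subgroup N -> finite_index N ->
  has_index N (coset_index N).
Proof.
move=> sN fN; set F := fset_set (cosets N).
have Fx (A : F) : exists x, val A = [set y | N (y - x)].
  have : val A \in F by exact: valP.
  by rewrite in_fset_set// inE => -[x _ <-]; exists x.
pose r A := sval (cid (Fx A)).
have rE A : val A = [set y | N (y - r A)] := svalP (cid (Fx A)).
have -> : coset_index N = #|{: F}| by rewrite -cardfE.
apply: (@has_index_fin _ r) => [x|A B NAB]; last first.
  by apply: val_inj; rewrite !rE; apply/(coset_eq _ _ sN).
have xF : [set y | N (y - x)] \in F by rewrite in_fset_set// inE; exists x.
by exists [` xF]%fset; apply/(coset_eq _ _ sN); rewrite -rE.
Qed.

End HasIndex.

Lemma has_index_preim (U V : zmodType) (f : U -> V) (g : V -> U) (N : set U) k :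
  zmod_morphism g -> cancel g f -> cancel f g ->
  has_index N k -> has_index [set y | N (g y)] k.
Proof.
move=> gB gK fK [r [rS rI]]; exists (f \o r); split=> [x|i j ik jk] /=.
  by have [i ik Ni] := rS (g x); exists i; rewrite //= gB fK.
by rewrite gB !fK; exact: rI.
Qed.

(** The representatives of [f @` N] are the sums of one for [range f] and the
    image of one for [N]. *)
Lemma has_index_tower (V : zmodType) (f : V -> V) (N : set V) a b :
  zmod_morphism f -> injective f ->
  has_index (range f) a -> has_index N b -> has_index (f @` N) (a * b).
Proof.
move=> fB fI [r [rS rI]] [s [sS sI]].
have -> : (a * b)%N = #|{: 'I_a * 'I_b}| by rewrite card_prod !card_ord.
apply: (@has_index_fin _ _ (fun ij : 'I_a * 'I_b => r ij.1 + f (s ij.2))).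
  move=> x; have [i ia [u _ fu]] := rS x; have [j jb Nj] := sS u.
  exists (Ordinal ia, Ordinal jb) => /=; exists (u - s j) => //.
  by rewrite fB fu opprD addrA.
move=> [i j] [i' j'] /= [u Nu fu].
have f0 : f 0 = 0 by have := fB 0 0; rewrite !subrr.
have fN x : f (- x) = - f x by rewrite -[in LHS]sub0r fB f0 sub0r.
have fD x y : f (x + y) = f x + f y by rewrite -{1}(opprK y) fB fN opprK.
have ii' : i = i'.
  apply: val_inj; apply: (rI _ _ (ltn_ord _) (ltn_ord _));
    exists (u + s j' - s j) => //.
  by rewrite !(fB, fD) fu opprD addrA subrK addrAC addrK.
suff -> : j = j' by rewrite ii'.
apply: val_inj; apply: (sI _ _ (ltn_ord _) (ltn_ord _)).
suff <- : u = s j - s j' by [].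
by apply: fI; rewrite fB fu ii' opprD addrACA subrr add0r.
Qed.

(** * Discrete valuation rings with finite residue field *)

(** The arithmetic of a discrete valuation ring [o] with uniformizer [p] and
    residue field of cardinality [q], free of the valuation. *)
Record finite_dvr (o : idomainType) (p : o) (q : nat) : Prop := {
  dvr_p0 : p != 0;
  dvr_pN : p \isn't a GRing.unit;
  dvr_dec : forall a : o, a != 0 ->
    exists k u, u \is a GRing.unit /\ a = u * p ^+ k;
  dvr_res : has_index [set x : o | x \isn't a GRing.unit] q }.

(* Compactness in terms of open covers is available for pointed spaces. *)
HB.instance Definition _ (o : idomainType) (v : {fraction o} -> int) :=
  isPointed.Build (val_top v) (0 : o).

(** The cosets of the maximal ideal are open, so compactness makes the residue
    field finite. *)
Lemma compact_dvrP (o : idomainType) : compact_dvr o ->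
  exists p : o, finite_dvr p (residue_card o).
Proof.
move=> [v [[vM vD vS] vO vC]].
have tf0 (a : o) : (tofrac a == 0) = (a == 0) by rewrite tofrac_eq0.
have vM' (a b : o) : a != 0 -> b != 0 ->
    v (tofrac (a * b)) = v (tofrac a) + v (tofrac b).
  by move=> a0 b0; rewrite rmorphM/= vM// tf0.
have v1 : v 1 = 0.
  have := vM 1 1 (oner_neq0 _) (oner_neq0 _); rewrite mulr1.
  move: (v 1) => w; lia.
have v_ge0 (a : o) : a != 0 -> 0 <= v (tofrac a).
  move=> a0; have /vO[/eqP|//] : exists b : o, tofrac a = tofrac b by exists a.
  by rewrite tf0 (negPf a0).
have unitP (a : o) : a != 0 -> (a \is a GRing.unit) = (v (tofrac a) == 0).
  move=> a0; apply/idP/eqP => [ua|va].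
    have := vM' a a^-1 a0; rewrite invr_eq0 => /(_ a0).
    rewrite divrr// rmorph1 v1.
    have := v_ge0 _ a0; have := v_ge0 a^-1; rewrite invr_eq0 => /(_ a0).
    by move: (v _) (v _); lia.
  have : v (tofrac a)^-1 = 0.
    have := vM (tofrac a) (tofrac a)^-1; rewrite tf0 invr_eq0 tf0 a0.
    move=> /(_ isT isT); rewrite divrr ?unitfE ?tf0// v1 va; lia.
  move=> vV; have /vO[b ab] : (tofrac a)^-1 = 0 \/ 0 <= v (tofrac a)^-1.
    by right; rewrite vV.
  have : tofrac (a * b) = 1 by rewrite rmorphM/= -ab divrr// unitfE tf0.
  move=> /eqP; rewrite -(rmorph1 (@tofrac o)) tofrac_eq => /eqP ab1.
  by apply/unitrPr; exists b.
have [x x0 vx] := vS 1.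
have /vO[p xp] : x = 0 \/ 0 <= v x by right; rewrite vx.
have p0 : p != 0 by rewrite -tf0 -xp.
have vp : v (tofrac p) = 1 by rewrite -xp.
have nuP (a : o) : (a \isn't a GRing.unit) <-> (a = 0 \/ 1 <= v (tofrac a)).
  have [->|a0] := eqVneq a 0; first by rewrite unitr0; split => //; left.
  rewrite unitP//; have := v_ge0 _ a0; move: (v _) => w w0.
  by split=> [w1|[/eqP|w1]]; [right; lia|rewrite (negPf a0)|lia].
have vN (a : o) : a != 0 -> v (tofrac (- a)) = v (tofrac a).
  move=> a0; have N0 : (-1 : o) != 0 by rewrite oppr_eq0 oner_eq0.
  have := vM' _ _ N0 N0; rewrite mulrNN mulr1 rmorph1 v1 => vN1.
  rewrite -mulN1r vM'//; lia.
have subN : is_subgroup [set x : o | x \isn't a GRing.unit].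
  split=> [|a b]; rewrite /=; first by rewrite unitr0.
  have [->|b0] := eqVneq b 0; first by rewrite subr0.
  have [->|a0] := eqVneq a 0; first by rewrite sub0r unitrN.
  move=> /nuP[/eqP|ha]; first by rewrite (negPf a0).
  move=> /nuP[/eqP|hb]; first by rewrite (negPf b0).
  apply/nuP; have [->|ab0] := eqVneq (a - b) 0; [by left|right].
  have := vD (tofrac a) (tofrac (- b)).
  rewrite -raddfD/= !tf0 oppr_eq0 => /(_ a0 b0 ab0); apply: le_trans.
  by rewrite vN// le_min ha.
exists p; split => //.
- by apply/nuP; right; rewrite vp.
- move=> a a0; have := v_ge0 _ a0; case va: (v (tofrac a)) => [k|//] _.
  have vpk : v (tofrac (p ^+ k)) = k.
    elim: k {va} => [|k IHk]; first by rewrite expr0 rmorph1.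
    rewrite exprS vM' ?expf_neq0// vp IHk; lia.
  have pk0 : tofrac (p ^+ k) != 0 by rewrite tf0 expf_neq0.
  have vx' : v (tofrac a / tofrac (p ^+ k)) = 0.
    have apk0 : tofrac a / tofrac (p ^+ k) != 0.
      by rewrite mulf_neq0 ?invr_eq0// tf0.
    have := vM _ _ apk0 pk0.
    rewrite divfK// va vpk; lia.
  have /vO[u uE] : tofrac a / tofrac (p ^+ k) = 0 \/
      0 <= v (tofrac a / tofrac (p ^+ k)) by right; rewrite vx'.
  have aE : a = u * p ^+ k.
    by apply/eqP; rewrite -tofrac_eq rmorphM/= -uE divfK.
  exists k, u; split=> //; rewrite unitP -?uE ?vx'//.
  by apply: contra_neq a0 => u0; rewrite aE u0 mul0r.
- apply: finite_index_has_index => //.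
  pose f (x : o) : set (val_top v) := [set y : o | y - x \isn't a GRing.unit].
  have /= := vC; rewrite compact_cover => /(_ o setT f)[||D' _ D'T].
  + move=> w _; suff : val_open (v := v) (f w) by [].
    move=> y /= fxy; exists 1 => z [->//|vz].
    have : z - y \isn't a GRing.unit by apply/nuP; right.
    move=> zy; rewrite /f/=.
    have := subN.2 (y - w) (y - z) fxy; rewrite -(opprB z y) opprK /= unitrN.
    by move=> /(_ zy); rewrite addrC addrA subrK.
  + by move=> z _; exists z => //; rewrite /f/= subrr unitr0.
  + rewrite /finite_index.
    have -> : cosets [set x : o | x \isn't a GRing.unit] =
        (fun x => [set y : o | y - x \isn't a GRing.unit]) @` [set` D'].
      apply/seteqP; split=> [_ [z _ <-]|_ [i _ <-]]; last by exists i.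
      have [i iD' fi] := D'T z I; exists i => //.
      by apply/esym/(coset_eq _ _ subN).
    exact/finite_image/finite_fset.
Qed.

(** * Submodules of finite index in free modules *)

Lemma submoduleP (o : pzRingType) (M : lmodType o) (N : set M) :
  is_submodule N <->
  N 0 /\ forall (a : o) x y, N x -> N y -> N (a *: x + y).
Proof.
rewrite /is_submodule; split=> -[].
  rewrite inE => N0 Nl; split=> // a x y Nx Ny.
  by have := Nl a x y; rewrite !inE; apply.
by move=> N0 Nl; split; rewrite ?inE// => a x y; rewrite !inE; exact: Nl.
Qed.

Section SubmoduleTheory.
Context (o : pzRingType) (M : lmodType o) (N : set M).
Hypothesis sN : is_submodule N.

Lemma submod0 : N 0. Proof. by case/submoduleP: sN. Qed.

Lemma submodZ a x : N x -> N (a *: x).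
Proof.
case/submoduleP: sN => N0 Nl Nx.
by rewrite -[_ *: _]addr0; exact: Nl.
Qed.

Lemma submodD x y : N x -> N y -> N (x + y).
Proof. by case/submoduleP: sN => N0 Nl Nx Ny; rewrite -[x]scale1r;
  exact: Nl. Qed.

Lemma submodN x : N x -> N (- x).
Proof. by move=> Nx; rewrite -scaleN1r; exact: submodZ. Qed.

Lemma submodB x y : N x -> N y -> N (x - y).
Proof. by move=> Nx Ny; apply: submodD => //; exact: submodN. Qed.

Lemma submod_subgroup : is_subgroup N.
Proof. by split; [exact: submod0|exact: submodB]. Qed.

Lemma submod_sum (I : Type) (r : seq I) (P : pred I) (F : I -> M) :
  (forall i, P i -> N (F i)) -> N (\sum_(i <- r | P i) F i).
Proof.
by move=> NF; elim/big_ind: _ => //; [exact: submod0|exact: submodD].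
Qed.

Lemma submodBl x y : N x -> N (x - y) -> N y.
Proof. by move=> Nx /(submodB Nx); rewrite opprB addrC subrK. Qed.

End SubmoduleTheory.

Section Divisibility.
Context (o : idomainType) (p : o) (q : nat) (Hp : finite_dvr p q).
Implicit Types (a b : o) (k : nat).

Definition pdvd k a : Prop := exists b, a = p ^+ k * b.

Lemma expp_neq0 k : p ^+ k != 0.
Proof. by rewrite expf_neq0// (dvr_p0 Hp). Qed.

Lemma pdvd0 k : pdvd k 0. Proof. by exists 0; rewrite mulr0. Qed.

Lemma pdvd_0 a : pdvd 0 a. Proof. by exists a; rewrite mul1r. Qed.

Lemma pdvdD k a b : pdvd k a -> pdvd k b -> pdvd k (a + b).
Proof. by move=> [a' ->] [b' ->]; exists (a' + b'); rewrite mulrDr. Qed.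

Lemma pdvdMl k a b : pdvd k b -> pdvd k (a * b).
Proof. by move=> [b' ->]; exists (a * b'); rewrite mulrCA. Qed.

Lemma pdvdMr k a b : pdvd k a -> pdvd k (a * b).
Proof. by rewrite mulrC; exact: pdvdMl. Qed.

Lemma pdvdN k a : pdvd k (- a) <-> pdvd k a.
Proof.
have N b : pdvd k b -> pdvd k (- b) by rewrite -mulN1r; exact: pdvdMl.
by split=> /N; rewrite ?opprK.
Qed.

Lemma pdvdB k a b : pdvd k a -> pdvd k b -> pdvd k (a - b).
Proof. by move=> ? /pdvdN; exact: pdvdD. Qed.

Lemma pdvd_sum k (I : Type) (r : seq I) (P : pred I) (F : I -> o) :
  (forall i, P i -> pdvd k (F i)) -> pdvd k (\sum_(i <- r | P i) F i).
Proof.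
by move=> NF; elim/big_ind: _ => //; [exact: pdvd0|exact: pdvdD].
Qed.

Lemma pdvd_leq k l a : (k <= l)%N -> pdvd l a -> pdvd k a.
Proof. by move=> /subnKC <- [b ->]; rewrite exprD -mulrA; eexists. Qed.

Lemma pdvd_pM k a : pdvd k (p ^+ k * a). Proof. by exists a. Qed.

Lemma pdvd_addl k l a : pdvd (k + l) (p ^+ k * a) <-> pdvd l a.
Proof.
split=> -[b]; last by move=> ->; rewrite mulrA -exprD; exact: pdvd_pM.
by rewrite exprD -mulrA => /(mulfI (expp_neq0 k)) ->; exact: pdvd_pM.
Qed.

Lemma pdvd_unitl k u a : u \is a GRing.unit -> pdvd k (u * a) -> pdvd k a.
Proof. by move=> uU /(pdvdMl u^-1); rewrite mulKr. Qed.

Lemma nonunitP a : (a \isn't a GRing.unit) <-> pdvd 1 a.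
Proof.
split=> [aN|[b ->]]; last first.
  by rewrite expr1 unitrM negb_and (dvr_pN Hp).
have [->|a0] := eqVneq a 0; first exact: pdvd0.
have [[|k] [u [uU aE]]] := dvr_dec Hp a0.
  by move: aN; rewrite aE mulr1 uU.
by rewrite aE; apply: pdvdMl; rewrite exprS; exists (p ^+ k); rewrite expr1.
Qed.

Lemma pdvd_unitF k u : u \is a GRing.unit -> pdvd k u -> k = 0%N.
Proof.
move=> uU; case: k => // k /(@pdvd_leq 1 k.+1 _ isT)/nonunitP.
by rewrite uU.
Qed.

Lemma pdvd_expp k l : pdvd k (p ^+ l) -> (k <= l)%N.
Proof.
rewrite leqNgt => kl; apply/negP => lk.
have := @pdvd_leq (l + 1) k (p ^+ l); rewrite addn1 => /(_ lk kl).
rewrite -addn1 -[p ^+ l]mulr1 => /pdvd_addl/nonunitP; by rewrite unitr1.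
Qed.

Definition pdvdv k d (x : 'rV[o]_d) : Prop := forall j, pdvd k (x 0 j).

Lemma pdvdvP k d (x : 'rV[o]_d) : pdvdv k x <-> exists y, x = p ^+ k *: y.
Proof.
split=> [dx|[y ->] j]; last by rewrite mxE; exact: pdvd_pM.
exists (\row_j sval (cid (dx j))); apply/rowP => j.
by rewrite !mxE; case: cid.
Qed.

Lemma pdvdv_mul k d e (x : 'rV[o]_d) (g : 'M[o]_(d, e)) :
  pdvdv k x -> pdvdv k (x *m g).
Proof. by move=> dx j; rewrite mxE; apply: pdvd_sum => i _; exact: pdvdMr. Qed.

(** Digit expansions: [p ^ (k + 1)] generates the image of [p ^ k o] under
    multiplication by [p]. *)
Lemma has_index_pdvd k : has_index [set a | pdvd k a] (q ^ k).
Proof.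
elim: k => [|k IHk].
  exists (fun=> 0); split=> [x|]; last by case=> [|i] // [|].
  by exists 0%N => //; exact: pdvd_0.
have -> : [set a | pdvd k.+1 a] = ( *%R p) @` [set a | pdvd k a].
  apply/seteqP; split=> [_ [b ->]|_ [_ [b ->] <-]] /=.
    by exists (p ^+ k * b); [exists b|rewrite mulrA -exprS].
  by exists b; rewrite mulrA exprS.
rewrite expnS; apply: has_index_tower => //.
- by move=> a b; rewrite mulrBr.
- exact/mulfI/(dvr_p0 Hp).
- have -> : range ( *%R p) = [set x | x \isn't a GRing.unit].
    apply/seteqP; split=> [_ [a _ <-]|a /nonunitP [b ->]] /=;
      last by exists b; rewrite ?expr1.
    by apply/nonunitP; exists a; rewrite expr1.
  exact: dvr_res Hp.
Qed.

Lemma residue_gt1 : (1 < q)%N.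
Proof.
have [r [rS rI]] := dvr_res Hp.
have [i iq /= Ni] := rS 0; have [j jq /= Nj] := rS 1.
rewrite ltnNge; apply/negP => q1.
have ij : i = j by lia.
move: Ni Nj; rewrite ij => /nonunitP h0 /nonunitP h1.
have := pdvdB h1 h0; rewrite sub0r opprK subrK => /nonunitP.
by rewrite unitr1.
Qed.

(** These are the submodules of finite index; see [finite_index_lattice] and
    [lattice_finite_index]. *)
Definition lattice d (N : set 'rV[o]_d) : Prop :=
  is_submodule N /\ exists K, forall x, N (p ^+ K *: x).

(** The rows of [invmx g], the [j]-th one scaled by [p ^ l j], form a basis. *)
Definition diag_lattice d (l : 'I_d -> nat) (g : 'M[o]_d) : set 'rV[o]_d :=
  [set x | forall j, pdvd (l j) ((x *m g) 0 j)].

Lemma diag_lattice_lattice d l (g : 'M[o]_d) : lattice (diag_lattice l g).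
Proof.
split.
  apply/submoduleP; split=> [j|a x y /= dx dy j].
    by rewrite mul0mx mxE; exact: pdvd0.
  rewrite mulmxDl -scalemxAl mxE [X in X + _]mxE.
  by apply: pdvdD (dy j); exact: pdvdMl (dx j).
exists (\max_j l j) => x j; rewrite -scalemxAl mxE.
exact/(pdvd_leq (leq_bigmax j))/pdvd_pM.
Qed.

(** Gaussian elimination: a vector with a unit coordinate is the first vector of
    a basis. *)
Lemma primitive_basis d (v : 'rV[o]_d.+1) (j : 'I_d.+1) :
  v 0 j \is a GRing.unit ->
  exists2 g : 'M[o]_(1 + d), g \in unitmx & v *m g = row_mx 1%:M 0.
Proof.
move=> vj; pose t := tperm_mx (R := o) 0 j : 'M[o]_(1 + d).
have tU : t \in unitmx by exact: unitmx_perm.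
pose w : 'rV[o]_(1 + d) := v *m t.
have w0 : lsubmx w 0 0 = v 0 j.
  rewrite mxE /w /t -xcolE mxE; congr (v 0 _).
  have -> : lshift d (0 : 'I_1) = 0 :> 'I_(1 + d) by apply: val_inj.
  by rewrite tpermL.
pose g : 'M[o]_(1 + d) := block_mx (v 0 j)^-1%:M (- (v 0 j)^-1 *: rsubmx w) 0
  1%:M.
exists (t *m g).
  rewrite unitmx_mul tU/= unitmxE /g det_ublock det1 mulr1 det_scalar expr1.
  by rewrite unitrV.
rewrite mulmxA -/w -(hsubmxK w) mul_row_block !mulmx0 addr0 mulmx1.
have -> : lsubmx w = (v 0 j)%:M by rewrite [lsubmx w]mx11_scalar w0.
by rewrite -scalar_mxM divrr// mul_scalar_mx scalerA mulrN divrr// scaleN1r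
  addNr.
Qed.

(** The elementary divisor theorem. Let [p ^ k] be the largest power of [p]
    dividing all elements of [N]; then [p ^ -k N] contains a vector with a unit
    coordinate, hence a direct summand of rank one, and the complement is treated
    by induction. The exponents come out in increasing order because those of the
    complement are at least [k]. *)
Lemma smith d (N : set 'rV[o]_d) : lattice N ->
  exists (l : 'I_d -> nat) g, [/\ g \in unitmx, N = diag_lattice l g
    & forall i j : 'I_d, (i <= j)%N -> (l i <= l j)%N].
Proof.
elim: d N => [|d IHd] N [sN [K NK]].
  exists (fun=> 0%N), 1%:M; split=> //; first exact: unitmx1.
  apply/seteqP; split=> x _; first by case.
  have -> : x = 0 by apply/rowP => -[].
  exact: submod0 sN.
(* [k] is the largest exponent such that [p ^ k] divides all of [N]. *)
pose P k := `[< exists x, N x /\ ~ pdvdv k.+1 x >].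
have exP : exists k, P k.
  exists K; apply/asboolP; exists (p ^+ K *: const_mx 1); split=> //.
  by move=> /(_ ord0); rewrite !mxE mulr1 => /pdvd_expp; rewrite ltnn.
have [k /asboolP[x [Nx xk]] kmin] := ex_minnP exP.
have Nk y : N y -> pdvdv k y.
  case: k kmin {xk} => [|k] kmin Ny; first by move=> j; exact: pdvd_0.
  apply: contrapT => yk; have /kmin : P k by apply/asboolP; exists y.
  by rewrite ltnn.
have /pdvdvP[v vE] := Nk _ Nx.
have [j vj] : exists j, v 0 j \is a GRing.unit.
  apply: contrapT => vN; apply: xk => j; rewrite vE mxE -addn1.
  apply/pdvd_addl/nonunitP/negP => vU; apply: vN; by exists j.
have [g gU vg] := primitive_basis vj.
have Ne : N (p ^+ k *: (row_mx 1%:M 0 *m invmx g)) by rewrite -vg mulmxK -?vE.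
pose N' : set 'rV[o]_d := [set y | N (p ^+ k *: (row_mx 0 y *m invmx g))].
have r0Z a (y : 'rV[o]_d) : row_mx (0 : 'rV_1) (a *: y) = a *: row_mx 0 y.
  by rewrite scale_row_mx scaler0.
have r0D (y z : 'rV[o]_d) : row_mx (0 : 'rV_1) (y + z) = row_mx 0 y + row_mx 0
  z.
  by rewrite add_row_mx addr0.
have [l [g' [g'U N'E lM]]] : exists (l : 'I_d -> nat) g',
    [/\ g' \in unitmx, N' = diag_lattice l g'
      & forall i j : 'I_d, (i <= j)%N -> (l i <= l j)%N].
  apply: IHd; split; last first.
    exists K => y; rewrite /N'/= r0Z -scalemxAl scalerA mulrC -scalerA.
    exact: NK.
  apply/submoduleP; split=> [|a y z] /=; rewrite /N'/=.
    by rewrite row_mx0 mul0mx scaler0; exact: submod0.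
  move=> Ny Nz; rewrite r0D r0Z mulmxDl scalerDr -scalemxAl scalerA mulrC.
  by rewrite -scalerA; apply: submodD => //; exact: submodZ.
pose b : 'M[o]_(1 + d) := block_mx 1%:M 0 0 g'.
have bU : b \in unitmx by rewrite unitmxE /b det_ublock det1 mul1r -unitmxE.
exists (fun i : 'I_(1 + d) => (k + if fintype.split i is inr i' then l i' else
  0)%N).
exists (g *m b); split; first by rewrite unitmx_mul gU.
  2: move=> i1 i2; rewrite leq_add2l; case: splitP => [i'|i' ->];
    case: splitP => [j' ->|j' ->] //=; rewrite ?add1n ?ltnS; [|exact: lM].
  2: by case: j' => -[].
have NE y : N y <-> exists a (z : 'rV[o]_d),
    y *m g = p ^+ k *: row_mx a%:M z /\ N' z.
  split=> [Ny|[a [z [yE N'z]]]].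
    have /pdvdvP[w wE] := pdvdv_mul g (Nk _ Ny).
    exists (w 0 0), (rsubmx (w : 'rV_(1 + d))).
    have wE' : w = row_mx (w 0 0)%:M (rsubmx (w : 'rV_(1 + d))).
      rewrite -[LHS](@hsubmxK _ 1 1 d); congr row_mx.
      rewrite [LHS]mx11_scalar mxE; congr (w 0 _)%:M; exact: val_inj.
    rewrite -wE'; split=> //; rewrite /N'/=.
    have -> : row_mx 0 (rsubmx (w : 'rV_(1 + d))) = w - w 0 0 *: row_mx 1%:M 0.
      rewrite {2}wE' scale_row_mx scaler0 opp_row_mx add_row_mx oppr0 addr0.
      by rewrite scalemx1 subrr.
    rewrite mulmxBl scalerBr [X in X - _]scalemxAl -wE mulmxK//.
    apply: submodB => //; rewrite -scalemxAl scalerA mulrC -scalerA.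
    exact: submodZ.
  rewrite -(mulmxK gU y) yE.
  have -> : row_mx a%:M z = a *: row_mx 1%:M 0 + row_mx 0 z.
    by rewrite scale_row_mx add_row_mx scaler0 addr0 add0r scalemx1.
  rewrite -scalemxAl mulmxDl scalerDr; apply: submodD => //.
  by rewrite -scalemxAl scalerA mulrC -scalerA; exact: submodZ.
have blkE (w : 'rV[o]_(1 + d)) :
    w *m b = row_mx (lsubmx w) (rsubmx w *m g').
  by rewrite -{1}(hsubmxK w) mul_row_block !mulmx0 mulmx1 addr0 add0r.
apply/seteqP; split=> y.
  move=> /NE[a [z [yE N'z]]] i; rewrite mulmxA yE -scalemxAl blkE row_mxKl
    row_mxKr mxE.
  move: (splitK (i : 'I_(1 + d))); case: (fintype.split _) => i' /= <-.
    rewrite addn0; exact: pdvd_pM.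
  rewrite [X in _ * X]row_mxEr; apply/pdvd_addl.
  by move: N'z; rewrite N'E; exact.
move=> dy; apply/NE.
have yk : pdvdv k (y *m g).
  have : pdvdv k (y *m g *m b).
    by move=> i; apply: pdvd_leq (leq_addr _ _) _; rewrite -mulmxA; exact: dy.
  by move=> /(pdvdv_mul (invmx b)); rewrite mulmxK.
have /pdvdvP[w wE] := yk.
exists (w 0 0), (rsubmx (w : 'rV_(1 + d))); split.
  rewrite wE; congr (_ *: _).
  rewrite -[LHS](@hsubmxK _ 1 1 d); congr row_mx.
  rewrite [LHS]mx11_scalar mxE; congr (w 0 _)%:M; exact: val_inj.
rewrite N'E => i; have := dy (rshift 1 i).
rewrite mulmxA wE -scalemxAl mxE blkE [X in _ * X]row_mxEr (unsplitK (inr i)).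
by move=> /pdvd_addl.
Qed.

End Divisibility.

Section Volume.
Context (o : idomainType) (p : o) (q : nat) (Hp : finite_dvr p q).
Local Notation pdvd := (pdvd p).
Local Notation diag_lattice := (diag_lattice p).
Local Notation lattice := (lattice p).

Lemma has_index_diag d (l : 'I_d -> nat) (g : 'M[o]_d) : g \in unitmx ->
  has_index (diag_lattice l g) (q ^ \sum_j l j).
Proof.
move=> gU; pose N := [set x : 'rV[o]_d | forall j, pdvd (l j) (x 0 j)].
apply: (@has_index_preim _ _ (mulmx^~ (invmx g)) (mulmx^~ g) N).
- by move=> x y; rewrite mulmxBl.
- exact: mulmxK.
- exact: mulmxKV.
have -> : (q ^ \sum_j l j)%N = #|{dffun forall j : 'I_d, 'I_(q ^ l j)}|.
  rewrite card_dep_ffun expn_sum foldrE big_map big_enum /=.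
  by apply: eq_bigr => j _; rewrite card_ord.
pose r k := sval (cid (has_index_pdvd Hp k)).
have rP k : (forall x, exists2 i, (i < q ^ k)%N & pdvd k (x - r k i)) /\
    (forall i j, (i < q ^ k)%N -> (j < q ^ k)%N -> pdvd k (r k i - r k j) -> i
      = j).
  exact: svalP (cid (has_index_pdvd Hp k)).
pose s (f : {dffun forall j : 'I_d, 'I_(q ^ l j)}) : 'rV[o]_d :=
  \row_j r (l j) (f j).
apply: (@has_index_fin _ _ s) => [x|f f' /= Nff']; last first.
  apply/ffunP => j; apply: val_inj; apply: ((rP (l j)).2 _ _ (ltn_ord _)
    (ltn_ord _)).
  by have := Nff' j; rewrite !mxE.
have ex j : exists i : 'I_(q ^ l j), pdvd (l j) (x 0 j - r (l j) i).
  by have [i iq di] := (rP (l j)).1 (x 0 j); exists (Ordinal iq).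
exists [ffun j => sval (cid (ex j))] => j.
by rewrite !mxE ffunE; case: cid.
Qed.

(** The logarithm to base [q] of the index. *)
Definition vol d (N : set 'rV[o]_d) : nat := trunc_log q (coset_index N).

Lemma lattice_sub d (N : set 'rV[o]_d) : lattice N -> is_submodule N.
Proof. by case. Qed.

Lemma has_index_vol d (N : set 'rV[o]_d) : lattice N -> has_index N (q ^ vol N).
Proof.
move=> LN; have [l [g [gU NE _]]] := smith Hp LN.
have := has_index_diag l gU; rewrite -NE => Ni.
have [_ E] := has_index_coset (submod_subgroup (lattice_sub LN)) Ni.
by rewrite /vol E trunc_expnK// (residue_gt1 Hp).
Qed.

Lemma coset_index_vol d (N : set 'rV[o]_d) : lattice N ->
  coset_index N = (q ^ vol N)%N.
Proof.
move=> LN; have sN := submod_subgroup (lattice_sub LN).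
by have [] := has_index_coset sN (has_index_vol LN).
Qed.

Lemma vol_has_index d (N : set 'rV[o]_d) k : is_submodule N ->
  has_index N (q ^ k) -> vol N = k.
Proof.
move=> sN Ni; have [_ E] := has_index_coset (submod_subgroup sN) Ni.
by rewrite /vol E trunc_expnK// (residue_gt1 Hp).
Qed.

Lemma vol_diag d (l : 'I_d -> nat) (g : 'M[o]_d) : g \in unitmx ->
  vol (diag_lattice l g) = (\sum_j l j)%N.
Proof.
move=> gU; apply: vol_has_index (has_index_diag l gU).
exact/lattice_sub/diag_lattice_lattice.
Qed.

Lemma lattice_finite_index d (N : set 'rV[o]_d) : lattice N -> finite_index N.
Proof.
move=> LN; have sN := submod_subgroup (lattice_sub LN).
by have [] := has_index_coset sN (has_index_vol LN).
Qed.

(** By the pigeonhole principle two powers of [p] agree modulo the submodule on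
    each basis vector, and their difference is a power of [p] times a unit. *)
Lemma finite_index_lattice d (N : set 'rV[o]_d) :
  is_submodule N -> finite_index N -> lattice N.
Proof.
move=> sN fN; split=> //.
have [r [rS _]] := finite_index_has_index (submod_subgroup sN) fN.
set k := coset_index N in rS.
have exK (j : 'I_d) : exists K, N (p ^+ K *: delta_mx 0 j).
  have ex (i : nat) : exists c : 'I_k, N (p ^+ i *: delta_mx 0 j - r c).
    by have [c ck Nc] := rS (p ^+ i *: delta_mx 0 j); exists (Ordinal ck).
  pose c (i : 'I_k.+1) := sval (cid (ex i)).
  have cP (i : 'I_k.+1) : N (p ^+ i *: delta_mx 0 j - r (c i)).
    exact: svalP (cid (ex i)).
  have /injectivePn[i1 [i2 + c12]] : ~~ injectiveb c.
    apply/injectiveP => cI; have := leq_card _ cI; rewrite !card_ord.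
    by rewrite ltnn.
  wlog i12 : i1 i2 c12 / (i1 < i2)%N => [H ne|ne].
    have := ne; rewrite -val_eqE neq_ltn => /orP[|] lt;
      first exact: H c12 lt ne.
    by apply: (H i2 i1 (esym c12) lt); rewrite eq_sym.
  have : N (p ^+ i1 *: delta_mx 0 j - p ^+ i2 *: delta_mx 0 j).
    by have := submodB sN (cP i1) (cP i2); rewrite c12 opprB addrA subrK.
  rewrite -scalerBl -(subnKC (ltnW i12)) exprD -{1}[p ^+ i1]mulr1 -mulrBr.
  set u := 1 - _; have uU : u \is a GRing.unit.
    apply/negPn/negP => /nonunitP => /(_ _ _ Hp).
    have : pdvd 1 (p ^+ (i2 - i1)).
      by rewrite -(subnK (_ : 1 <= i2 - i1)%N) ?subn_gt0// exprD; apply: pdvdMl;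
        exists 1; rewrite mulr1.
    move=> h1 h2; have := pdvdD h1 h2; rewrite addrC subrK => /nonunitP.
    by move=> /(_ _ Hp); rewrite unitr1.
  move=> /(submodZ sN u^-1); rewrite scalerA mulrCA mulVr// mulr1.
  by exists i1.
exists (\max_j sval (cid (exK j))) => x.
rewrite (row_sum_delta x) scaler_sumr; apply: submod_sum => // j _.
rewrite scalerA mulrC -scalerA; apply: submodZ => //.
have /subnK <- := leq_bigmax (F := fun j => sval (cid (exK j))) j.
by rewrite exprD -scalerA; apply: submodZ => //; case: cid.
Qed.

(** * Weights of lattices *)

(** The sum of [N] and [p ^ k o ^ d]. *)
Definition padd d k (N : set 'rV[o]_d) : set 'rV[o]_d :=
  [set x | exists y, N (x - p ^+ k *: y)].

Lemma rowBZ d (x y : 'rV[o]_d) a j : (x - a *: y) 0 j = x 0 j - a * y 0 j.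
Proof. by rewrite !mxE. Qed.

Lemma padd_diag d k (l : 'I_d -> nat) (g : 'M[o]_d) : g \in unitmx ->
  padd k (diag_lattice l g) = diag_lattice (fun j => minn (l j) k) g.
Proof.
move=> gU; apply/seteqP; split=> [x [y Ny] j|x dx].
  have := Ny j; rewrite mulmxBl -scalemxAl rowBZ => h.
  rewrite -[X in pdvd _ X](subrK (p ^+ k * (y *m g) 0 j)); apply: pdvdD.
    by apply: pdvd_leq h; exact: geq_minl.
  by apply: pdvd_leq (pdvd_pM _ _ _); exact: geq_minr.
have ex j : exists y, pdvd (l j) ((x *m g) 0 j - p ^+ k * y).
  have := dx j; rewrite /minn; case: ifP => _ [y yE].
    by exists 0; rewrite mulr0 subr0; exists y.
  by exists y; rewrite yE subrr; exact: pdvd0.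
exists ((\row_j sval (cid (ex j))) *m invmx g) => j.
by rewrite mulmxBl -scalemxAl mulmxKV// rowBZ [X in _ * X]mxE;
  case: (cid (ex j)).
Qed.

Lemma padd_lattice d k (N : set 'rV[o]_d) : lattice N -> lattice (padd k N).
Proof.
move=> LN; have [l [g [gU -> _]]] := smith Hp LN.
by rewrite padd_diag//; exact: diag_lattice_lattice.
Qed.

(** For [N] with elementary divisors [p ^ l j] this is the number of [j] such
    that [k < l j]; the definition by indices makes it an invariant of [N]. *)
Definition layer d (N : set 'rV[o]_d) k : nat :=
  (vol (padd k.+1 N) - vol (padd k N))%N.

Lemma layer_diag d k (l : 'I_d -> nat) (g : 'M[o]_d) : g \in unitmx ->
  layer (diag_lattice l g) k = #|[pred j | (k < l j)%N]|.
Proof.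
move=> gU; rewrite /layer !padd_diag// !vol_diag//.
have -> : (\sum_j minn (l j) k.+1 =
    #|[pred j | (k < l j)%N]| + \sum_j minn (l j) k)%N.
  rewrite -sum1_card [X in (_ = X + _)%N]big_mkcond -big_split/=;
    apply: eq_bigr => j _.
  by rewrite inE; case: ltnP; lia.
by rewrite addnK.
Qed.

(** If [C k = c_1 + ... + c_k] and [l_1 >= ... >= l_n] are the exponents of the
    elementary divisors of [N], this is [c_1 l_1 + ... + c_n l_n]. *)
Definition weight (C : nat -> nat) d (N : set 'rV[o]_d) : nat :=
  \sum_(k < vol N) C (layer N k).

Lemma weight_vol0 C d (N : set 'rV[o]_d) : vol N = 0%N -> weight C N = 0%N.
Proof. by rewrite /weight => ->; rewrite big_ord0. Qed.

Lemma weight_diag C d K (l : 'I_d -> nat) (g : 'M[o]_d) : C 0%N = 0%N ->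
  g \in unitmx -> (forall j, l j <= K)%N ->
  weight C (diag_lattice l g) = (\sum_(k < K) C #|[pred j | (k < l j)%N]|)%N.
Proof.
move=> C0 gU lK.
have aux K1 K2 : (forall j, l j <= K1)%N -> (K1 <= K2)%N ->
    (\sum_(k < K2) C #|[pred j | (k < l j)%N]| =
     \sum_(k < K1) C #|[pred j | (k < l j)%N]|)%N.
  move=> lK1 K12; rewrite -(subnKC K12) big_split_ord/= [X in (_ + X)%N]big1.
    by rewrite addn0.
  move=> i _; rewrite eq_card0 ?C0// => j; apply/negbTE.
  rewrite inE/= -leqNgt.
  by rewrite (leq_trans (lK1 j))// leq_addr.
rewrite /weight vol_diag//.
transitivity (\sum_(k < \sum_j l j) C #|[pred j | (k < l j)%N]|)%N.
  by apply: eq_bigr => k _; rewrite layer_diag.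
have lS j : (l j <= \sum_j l j)%N by rewrite (bigD1 j)//= leq_addr.
by case/orP: (leq_total (\sum_j l j) K) => h; [rewrite (aux _ _ lS h)|rewrite
  (aux _ _ lK h)].
Qed.

End Volume.

(** * Sums over families of lattices *)

Section Esum.
Context (R : realType).
Local Open Scope ereal_scope.

Lemma esumZ (T : choiceType) (S : set T) (c : R) (a : T -> \bar R) :
  (0 <= c)%R -> (forall i, 0 <= a i) ->
  \esum_(i in S) (c%:E * a i) = c%:E * \esum_(i in S) a i.
Proof.
move=> c0 a0.
have le (d : R) (b : T -> \bar R) : (0 <= d)%R -> (forall i, 0 <= b i) ->
    \esum_(i in S) (d%:E * b i) <= d%:E * \esum_(i in S) b i.
  move=> d0 b0; apply: ge_ereal_sup => _ [X [finX XS] <-].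
  rewrite -ge0_mule_fsumr//.
  by apply: lee_wpmul2l => //; apply: ereal_sup_ubound; exists X.
apply/eqP; rewrite eq_le le//=.
have [->|cn0] := eqVneq c 0%R; first by rewrite mul0e esum_ge0// => i _;
  rewrite mul0e.
have := le c^-1%R (fun i => c%:E * a i); rewrite invr_ge0 => /(_ c0).
have E : \esum_(i in S) (c^-1%:E * (c%:E * a i)) = \esum_(i in S) a i.
  by apply: eq_esum => i _; rewrite muleA -EFinM mulVf// mul1e.
rewrite E => H; rewrite -[leRHS]mul1e -(mulfV cn0) EFinM -muleA.
by apply: lee_wpmul2l => //; apply: H => i; rewrite mule_ge0.
Qed.

Lemma esum_finType (J : finType) (a : J -> \bar R) : (forall j, 0 <= a j) ->
  \esum_(j in [set: J]) a j = \sum_j a j.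
Proof.
move=> a0; rewrite esum_fset//; last exact: finite_finset.
have [r rU rT] : exists2 r : {fset J}, forall j, j \in r & perm_eq r
  (index_enum J).
  exists [fset j in J]%fset => [j|]; first by rewrite !inE.
  by apply: uniq_perm => [||j]; rewrite ?fset_uniq ?index_enum_uniq
    ?mem_index_enum// !inE.
rewrite (@fsbigTE _ _ _ _ r) => [|i]; last by rewrite rU.
exact: perm_big.
Qed.

Lemma esum_fin (J : finType) (T : choiceType) (S : set T) (e : J -> T) (x :
  \bar R) :
  0 <= x -> set_bij setT S e -> \esum_(i in S) x = (#|J|%:R)%:E * x.
Proof.
move=> x0 eb; rewrite (@reindex_esum _ _ _ _ _ e _ eb) esum_finType//.
by rewrite sumr_const mule_natl.
Qed.

End Esum.

Section Extensions.
Context (o : idomainType) (p : o) (q : nat) (Hp : finite_dvr p q).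
Local Notation pdvd := (pdvd p).
Local Notation diag_lattice := (diag_lattice p).
Local Notation lattice := (lattice p).
Local Notation vol := (vol q).

Lemma lattice_basis d (N : set 'rV[o]_d) : lattice N ->
  exists B : 'M[o]_d, N = range (mulmx^~ B : 'rV_d -> 'rV_d) /\
    injective (mulmx^~ B : 'rV_d -> 'rV_d).
Proof.
move=> LN; have [l [g [gU -> _]]] := smith Hp LN.
pose D := diag_mx (\row_j p ^+ l j).
have DE (u : 'rV[o]_d) j : (u *m D) 0 j = p ^+ l j * u 0 j.
  by rewrite mul_mx_diag !mxE mulrC.
exists (D *m invmx g); split=> [|u w]; last first.
  rewrite !mulmxA => /(can_inj (mulmxKV gU)) uw; apply/rowP => j.
  by have /rowP/(_ j) := uw; rewrite !DE => /(mulfI (expp_neq0 Hp _)).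
apply/seteqP; split=> [x dx|_ [u _ <-] j]; last first.
  by rewrite !mulmxA mulmxKV// DE; exact: pdvd_pM.
exists (\row_j sval (cid (dx j))) => //.
rewrite mulmxA -[RHS](mulmxK gU); congr (_ *m _); apply/rowP => j.
by rewrite DE [X in _ * X]mxE; case: cid.
Qed.

(** A chosen matrix whose rows form a basis of the lattice [N]. *)
Definition basis d (N : set 'rV[o]_d) : 'M[o]_d :=
  xget 0 [set B : 'M[o]_d | N = range (mulmx^~ B : 'rV_d -> 'rV_d) /\
    injective (mulmx^~ B : 'rV_d -> 'rV_d)].

Lemma basisP d (N : set 'rV[o]_d) : lattice N ->
  (forall x, N x <-> exists u, x = u *m basis N) /\
  injective (mulmx^~ (basis N) : 'rV_d -> 'rV_d).
Proof.
move=> /lattice_basis ex; rewrite /basis.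
case: xgetP => [B _ [BE BI]|no]; last by case: ex => B /(no B).
split=> // x; rewrite {1}BE.
by split=> [[u _ <-]|[u ->]]; exists u.
Qed.

Definition coset_rep d (N : set 'rV[o]_d) : nat -> 'rV[o]_d :=
  xget (fun=> 0) [set r : nat -> 'rV[o]_d |
    (forall x, exists2 i, (i < q ^ vol N)%N & N (x - r i)) /\
    (forall i j, (i < q ^ vol N)%N -> (j < q ^ vol N)%N -> N (r i - r j) -> i =
      j)].

Lemma coset_repP d (N : set 'rV[o]_d) : lattice N ->
  (forall x, exists2 i, (i < q ^ vol N)%N & N (x - coset_rep N i)) /\
  (forall i j, (i < q ^ vol N)%N -> (j < q ^ vol N)%N ->
     N (coset_rep N i - coset_rep N j) -> i = j).
Proof.
move=> /(has_index_vol Hp)[r rP]; rewrite /coset_rep.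
by case: xgetP => [r' _ //|/(_ r)/(_ rP)].
Qed.

Section Ext.
Context (d n : nat).
Implicit Types (I : set 'rV[o]_(d + n)) (A : set 'rV[o]_d) (M : set 'rV[o]_n).

Definition projL I : set 'rV[o]_d := [set x | exists y, I (row_mx x y)].
Definition capR I : set 'rV[o]_n := [set y | I (row_mx 0 y)].

Lemma row_mx0Z a (y : 'rV[o]_n) : row_mx (0 : 'rV_d) (a *: y) = a *: row_mx 0 y.
Proof. by rewrite scale_row_mx scaler0. Qed.

Lemma row_mx0D (y z : 'rV[o]_n) : row_mx (0 : 'rV_d) (y + z) = row_mx 0 y +
  row_mx 0 z.
Proof. by rewrite add_row_mx addr0. Qed.

Lemma projL_lattice I : lattice I -> lattice (projL I).
Proof.
move=> [sI [K IK]]; split; last first.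
  by exists K => x; exists 0; rewrite -(scaler0 _ (p ^+ K)) -scale_row_mx.
apply/submoduleP; split=> [|a x y [x' Ix] [y' Iy]].
  by exists 0; rewrite row_mx0; exact: submod0.
exists (a *: x' + y'); rewrite -add_row_mx -scale_row_mx.
by apply: submodD => //; exact: submodZ.
Qed.

Lemma capR_lattice I : lattice I -> lattice (capR I).
Proof.
move=> [sI [K IK]]; split; last by exists K => x; rewrite /capR/= row_mx0Z.
apply/submoduleP; split=> [|a x y Ix Iy]; rewrite /capR/=.
  by rewrite row_mx0; exact: submod0.
by rewrite row_mx0D row_mx0Z; apply: submodD => //; exact: submodZ.
Qed.

Lemma vol_ext I : lattice I -> vol I = (vol (projL I) + vol (capR I))%N.
Proof.
move=> LI; have sI := lattice_sub LI.
have [rS rI] := coset_repP (projL_lattice LI).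
have [sS sI'] := coset_repP (capR_lattice LI).
set r := coset_rep _ in rS rI; set s := coset_rep _ in sS sI'.
apply: (vol_has_index Hp) => //; rewrite expnD.
set a := (q ^ _)%N in rS rI *; set b := (q ^ _)%N in sS sI' *.
have -> : (a * b)%N = #|{: 'I_a * 'I_b}| by rewrite card_prod !card_ord.
apply: (@has_index_fin _ _ (fun ij : 'I_a * 'I_b => row_mx (r ij.1) (s ij.2))).
  move=> z; have [i ia [y Iy]] := rS (lsubmx z).
  have [j jb Ij] := sS (rsubmx z - y).
  exists (Ordinal ia, Ordinal jb) => /=.
  have := submodD sI Iy Ij; rewrite add_row_mx addr0 addrA [y + _]addrC subrK.
  by rewrite -[in X in _ -> X](hsubmxK z) opp_row_mx add_row_mx.
move=> [i j] [i' j'] /=; rewrite opp_row_mx add_row_mx => H.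
have ii' : i = i' by apply/val_inj/(rI _ _ (ltn_ord _) (ltn_ord _)); eexists;
  exact: H.
rewrite ii' subrr in H *; suff -> : j = j' by [].
exact/val_inj/(sI' _ _ (ltn_ord _) (ltn_ord _)).
Qed.

(** The lattice with projection [A], intersection [M] and extension class [F];
    [F] gives lifts of the basis of [A]. *)
Definition extension A M (F : 'M[o]_(d, n)) : set 'rV[o]_(d + n) :=
  [set z | exists u, lsubmx z = u *m basis A /\ M (rsubmx z - u *m F)].

Lemma extension_lattice A M F : lattice A -> lattice M -> lattice (extension A
  M F).
Proof.
move=> LA LM; have [AE _] := basisP LA.
have sM := lattice_sub LM; split.
  apply/submoduleP; split=> [|a x y [u [ux Mx]] [w [wy My]]].
    by exists 0; rewrite !linear0 !mul0mx subr0; split=> //; exact: submod0.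
  exists (a *: u + w); rewrite !linearP/= !mulmxDl -!scalemxAl ux wy;
    split=> //.
  rewrite opprD addrACA -scalerBr.
  by apply: submodD => //; exact: submodZ.
have [_ [K AK]] := LA; have [_ [L ML]] := LM; exists (L + K)%N => x.
have [u uE] := (AE _).1 (AK (lsubmx x)).
exists (p ^+ L *: u); rewrite -!scalemxAl -uE linearZ/= scalerA exprD;
  split=> //.
by rewrite linearZ/= -scalerA -scalerBr; exact: ML.
Qed.

Lemma projL_extension A M F : lattice A -> lattice M -> projL (extension A M F)
  = A.
Proof.
move=> LA LM; have [AE _] := basisP LA.
apply/seteqP; split=> [x [y [u [+ _]]]|x /AE[u ->]].
  by rewrite row_mxKl => ->; apply/AE; exists u.
exists (u *m F); exists u; rewrite row_mxKl row_mxKr subrr; split=> //.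
exact: submod0 (lattice_sub LM).
Qed.

Lemma capR_extension A M F : lattice A -> lattice M -> capR (extension A M F) =
  M.
Proof.
move=> LA LM; have [_ BI] := basisP LA.
apply/seteqP; split=> [y [u []]|y My].
  rewrite row_mxKl row_mxKr -[LHS](mul0mx _ (basis A)) => /BI <-.
  by rewrite mul0mx subr0.
by exists 0; rewrite row_mxKl row_mxKr !mul0mx subr0.
Qed.

Lemma extension_class_eq A M F F' : lattice A -> lattice M ->
  extension A M F = extension A M F' -> forall i, M (row i F - row i F').
Proof.
move=> LA LM E i; have [_ BI] := basisP LA.
have : extension A M F (row_mx (delta_mx 0 i *m basis A) (row i F)).
  exists (delta_mx 0 i); rewrite row_mxKl row_mxKr rowE subrr; split=> //.
  exact: submod0 (lattice_sub LM).
rewrite E => -[u []]; rewrite row_mxKl row_mxKr => /BI <-.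
by rewrite (rowE i F').
Qed.

Lemma extension_class_congr A M F F' : lattice A -> lattice M ->
  (forall i, M (row i F - row i F')) -> extension A M F = extension A M F'.
Proof.
move=> LA LM H.
have sub G G' : (forall i, M (row i G - row i G')) ->
    extension A M G `<=` extension A M G'.
  move=> HG z [u [zu Mz]]; exists u; split=> //.
  rewrite -[rsubmx z](subrK (u *m G)) -addrA.
  apply: (submodD (lattice_sub LM)) => //.
  rewrite -mulmxBr mulmx_sum_row; apply: (submod_sum (lattice_sub LM)) => i _.
  by apply: (submodZ (lattice_sub LM)); rewrite linearB; exact: HG.
apply/seteqP; split; apply: sub => // i; rewrite -opprB.
exact: (submodN (lattice_sub LM)) (H i).
Qed.

Lemma extension_surj I : lattice I ->
  exists F, I = extension (projL I) (capR I) F.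
Proof.
move=> LI; have sI := lattice_sub LI.
have [AE _] := basisP (projL_lattice LI); set B := basis _ in AE *.
have ex i : exists y, I (row_mx (row i B) y).
  have /AE : exists u, row i B = u *m B by exists (delta_mx 0 i); rewrite rowE.
  by [].
pose F := \matrix_i sval (cid (ex i)); exists F.
have IF u : I (row_mx (u *m B) (u *m F)).
  rewrite -mul_mx_row mulmx_sum_row; apply: submod_sum => // i _.
  apply: submodZ => //; rewrite (_ : row i _ = row_mx (row i B) (row i F)).
    by rewrite rowK; case: cid.
  exact: row_row_mx.
apply/seteqP; split=> [z Iz|z [u [zu]]].
  have [|u uE] := (AE (lsubmx z)).1; first by exists (rsubmx z);
    rewrite hsubmxK.
  exists u; split=> //; rewrite /capR/=.
  have := submodB sI Iz (IF u).
  by rewrite -{1}(hsubmxK z) uE opp_row_mx add_row_mx subrr.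
rewrite /capR/= => /(submodD sI (IF u)).
by rewrite add_row_mx addr0 addrC subrK -zu hsubmxK.
Qed.

(** Given the projection [A] and the intersection [M], the lattices of
    [o ^ (d + n)] correspond to the homomorphisms [A -> o ^ n / M]; as [A] is free
    of rank [d], there are [q ^ (vol M * d)] of them. *)
Lemma esum_extensions (R : realType)
    (F : set 'rV[o]_d -> set 'rV[o]_n -> \bar R) :
  (forall A M, 0 <= F A M)%E ->
  (\esum_(I in [set I | lattice I]) F (projL I) (capR I) =
   \esum_(M in [set M | lattice M]) \esum_(A in [set A | lattice A])
     ((q ^ (vol M * d))%:R)%:E * F A M)%E.
Proof.
move=> F0.
(* A homomorphism is given by the numbers of the representatives of the images of
   the basis vectors. *)
pose cls M := [set f : {ffun 'I_d -> nat} | forall i, (f i < q ^ vol M)%N].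
transitivity (\esum_(M in [set M | lattice M]) \esum_(A in [set A | lattice A])
    \esum_(f in cls M) F A M)%E; last first.
  apply: eq_esum => M LM; apply: eq_esum => A LA.
  pose e (f : {ffun 'I_d -> 'I_(q ^ vol M)}) := [ffun i => f i : nat].
  rewrite (@esum_fin _ _ _ _ e)//.
    by rewrite card_ffun !card_ord expnM.
  split=> [f _ i|f f' _ _ ff'|f fM]; first by rewrite ffunE.
    apply/ffunP => i; apply: val_inj.
    by have /ffunP/(_ i) := ff'; rewrite !ffunE.
  exists [ffun i => Ordinal (fM i)] => //; apply/ffunP => i.
  by rewrite !ffunE.
transitivity (\esum_(M in [set M | lattice M])
    \esum_(k in [set A | lattice A] `*`` (fun=> cls M)) F k.1 M)%E; last first.
  by apply: eq_esum => M LM; rewrite esum_esum.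
rewrite esum_esum//=.
pose ext (k : set 'rV[o]_n * (set 'rV[o]_d * {ffun 'I_d -> nat})) :=
  extension k.2.1 k.1 (\matrix_i coset_rep k.1 (k.2.2 i)).
rewrite (@reindex_esum _ _ _ ([set M | lattice M] `*``
    (fun M => [set A | lattice A] `*`` (fun=> cls M))) _ ext); last first.
  split=> [[M [A f]] /= [LM [LA _]]|[M [A f]] [M' [A' f']]|I LI].
  - exact: extension_lattice.
  - rewrite !inE/= /ext/= => -[LM [LA fM]] [LM' [LA' fM']] E.
    have AA' : A = A' by have := congr1 projL E; rewrite !projL_extension.
    have MM' : M = M' by have := congr1 capR E; rewrite !capR_extension.
    rewrite -{}AA' -{}MM' in LA' LM' fM' E *; congr (_, (_, _)).
    apply/ffunP => i; have := extension_class_eq LA LM E i; rewrite !rowK.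
    exact: (coset_repP LM).2.
  - have [F0' FE] := extension_surj LI.
    have LA := projL_lattice LI; have LM := capR_lattice LI.
    have ex i := (coset_repP LM).1 (row i F0').
    have exs i : exists j, (j < q ^ vol (capR I))%N /\
        capR I (row i F0' - coset_rep (capR I) j).
      by have [j jq Mj] := ex i; exists j.
    exists (capR I, (projL I, [ffun i => sval (cid (exs i))])) => /=.
      by do ?split => //; move=> i; rewrite ffunE; case: cid => j [].
    rewrite /ext/= [RHS]FE; apply: extension_class_congr => // i.
    rewrite rowK ffunE; case: cid => j jP /=; have [_ Mj] := jP.
    rewrite -opprB; apply: (submodN (lattice_sub LM)); exact: Mj.
apply: eq_esum => -[M [A f]] /= [LM [LA _]].
by rewrite projL_extension ?capR_extension.
Qed.

End Ext.

End Extensions.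

(** * Weighted zeta functions of free modules *)

Section Zetas.
Context (o : idomainType) (p : o) (q : nat) (Hp : finite_dvr p q) (R :
  realType).
Local Notation pdvd := (pdvd p).
Local Notation diag_lattice := (diag_lattice p).
Local Notation lattice := (lattice p).
Local Notation vol := (vol q).
Local Notation weight := (weight p q).

Definition zeta_term (D : nat) (C : nat -> nat) (T : R) d (M : set 'rV[o]_d) :
  R :=
  (q ^ (vol M * D))%:R * T ^+ (vol M + weight C M).

(** With [C = 0] this is the zeta function of [o ^ d] at [q ^ D * T], where [T]
    stands for [q ^ (- s)]. *)
Definition zetaw d (D : nat) (C : nat -> nat) (T : R) : \bar R :=
  (\esum_(M in [set M : set 'rV[o]_d | lattice M]) (zeta_term D C T M)%:E)%E.

Definition zeta0 d (T : R) : \bar R := zetaw d 0 (fun=> 0%N) T.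

Lemma zeta_term_ge0 D C T d (M : set 'rV[o]_d) : 0 <= T -> 0 <= zeta_term D C T
  M.
Proof. by move=> T0; rewrite mulr_ge0 ?ler0n ?exprn_ge0. Qed.

Lemma zetaw_ge0 d D C T : 0 <= T -> (0 <= zetaw d D C T)%E.
Proof. by move=> T0; apply: esum_ge0 => M _; rewrite lee_fin zeta_term_ge0. Qed.

Lemma zeta0_ge0 d T : 0 <= T -> (0 <= zeta0 d T)%E.
Proof. exact: zetaw_ge0. Qed.

Lemma weight0 d (M : set 'rV[o]_d) : weight (fun=> 0%N) M = 0%N.
Proof. by rewrite /weight big1. Qed.

Lemma zeta0E d T :
  zeta0 d T = (\esum_(M in [set M : set 'rV[o]_d | lattice M]) (T ^+ vol
    M)%:E)%E.
Proof.
by apply: eq_esum => M _; rewrite /zeta_term muln0 mul1r weight0 addn0.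
Qed.

Lemma in_asbool (T : Type) (S : set T) x : (x \in S) = `[< S x >].
Proof. by apply/idP/asboolP; rewrite inE. Qed.

Section ImageLattices.
Context (d : nat) (E : 'M[o]_d).
Local Notation f := (mulmx^~ E : 'rV[o]_d -> 'rV[o]_d).
Hypotheses (fI : injective f) (fL : lattice (range f)).

Lemma image_lattice (N : set 'rV[o]_d) : lattice N -> lattice (f @` N).
Proof.
move=> [sN [K NK]]; split.
  apply/submoduleP; split=> [|a _ _ [x Nx <-] [y Ny <-]].
    by exists 0; rewrite ?mul0mx//; exact: submod0.
  exists (a *: x + y); last by rewrite mulmxDl scalemxAl.
  by apply: submodD => //; exact: submodZ.
have [_ [L fLx]] := fL; exists (K + L)%N => x.
have [y _ yE] := fLx x; exists (p ^+ K *: y); first exact: NK.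
by rewrite /= -scalemxAl yE scalerA exprD.
Qed.

Lemma preimage_lattice (N : set 'rV[o]_d) : lattice N -> lattice (f @^-1` N).
Proof.
move=> [sN [K NK]]; split; last by exists K => x; rewrite /= -scalemxAl;
  exact: NK.
apply/submoduleP; split=> [|a x y Nx Ny]; rewrite /= ?mul0mx;
  first exact: submod0.
by rewrite mulmxDl -scalemxAl; apply: submodD => //; exact: submodZ.
Qed.

Lemma vol_image (N : set 'rV[o]_d) : lattice N ->
  vol (f @` N) = (vol (range f) + vol N)%N.
Proof.
move=> LN; apply: (vol_has_index Hp).
  exact: lattice_sub (image_lattice LN).
rewrite expnD; apply: has_index_tower => //.
- by move=> x y; rewrite mulmxBl.
- exact: has_index_vol fL.
- exact: has_index_vol LN.
Qed.

Lemma esum_sublattices (T : R) : 0 <= T ->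
  (\esum_(N in [set N : set 'rV[o]_d | lattice N] `&` [set N | N `<=` range f])
      (T ^+ vol N)%:E = (T ^+ vol (range f))%:E * zeta0 d T)%E.
Proof.
move=> T0; rewrite zeta0E -esumZ ?exprn_ge0//; last first.
  by move=> N; rewrite lee_fin exprn_ge0.
rewrite (@reindex_esum _ _ _ [set N | lattice N] _ (fun N => f @` N)).
  by apply: eq_esum => N LN; rewrite vol_image// exprD EFinM.
split=> [N LN|N N' _ _ E'|N [LN Nf]].
- by split=> [|_ [x _ <-]]; [exact: image_lattice|exists x].
- have sub (A B : set 'rV[o]_d) : f @` A = f @` B -> A `<=` B.
    move=> AB x Ax; have : (f @` B) (f x) by rewrite -AB; exists x.
    by move=> [y By /fI <-].
  by apply/seteqP; split; apply: sub.
- exists (f @^-1` N); first exact: preimage_lattice.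
  apply/seteqP; split=> [_ [x Nx <-]//|x Nx].
  by have [y _ yx] := Nf _ Nx; exists y; rewrite //= yx.
Qed.

End ImageLattices.

(** If the projection of the lattice has to lie in a free submodule [X M] of index
    [q ^ weight C M] depending on the intersection [M], then multiplication by a
    basis of [X M] identifies the possible projections with all the lattices of
    [o ^ d], at the cost of a factor [T ^ weight C M]. *)
Lemma esum_constrained d n (X : set 'rV[o]_n -> set 'rV[o]_d) (C : nat -> nat)
  (T : R) :
  0 <= T -> zeta0 d T \is a fin_num ->
  (forall M, lattice M -> exists E : 'M[o]_d,
     [/\ injective (mulmx^~ E : 'rV[o]_d -> 'rV[o]_d),
         X M = range (mulmx^~ E : 'rV[o]_d -> 'rV[o]_d),
         lattice (X M) & vol (X M) = weight C M]) ->
  (\esum_(I in [set I : set 'rV[o]_(d + n) | lattice I] `&`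
                [set I | projL I `<=` X (capR I)]) (T ^+ vol I)%:E =
   zeta0 d T * zetaw n d C T)%E.
Proof.
move=> T0 zF HX.
pose F (A : set 'rV[o]_d) (M : set 'rV[o]_n) : \bar R :=
  if `[< A `<=` X M >] then (T ^+ (vol A + vol M))%:E else 0%E.
have F0 A M : (0 <= F A M)%E by rewrite /F; case: ifP => // _;
  rewrite lee_fin exprn_ge0.
rewrite [LHS]esum_mkcondr.
transitivity (\esum_(I in [set I | lattice I]) F (projL I) (capR I))%E.
  apply: eq_esum => I LI; by rewrite (vol_ext Hp LI) /F in_asbool.
rewrite (esum_extensions Hp)//.
transitivity (\esum_(M in [set M : set 'rV[o]_n | lattice M])
    zeta0 d T * (zeta_term d C T M)%:E)%E; last first.
  rewrite /zetaw -(fineK zF) esumZ ?fine_ge0 ?zeta0_ge0// => M.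
  by rewrite lee_fin zeta_term_ge0.
apply: eq_esum => M LM.
rewrite esumZ//.
have [E [EI XE XL XV]] := HX M LM.
transitivity (((q ^ (vol M * d))%:R)%:E * ((T ^+ vol M)%:E * (\esum_(N in [set
  N : set 'rV[o]_d | lattice N]
   `&` [set N | N `<=` X M]) (T ^+ vol N)%:E)))%E.
  congr (_ * _)%E; rewrite -esumZ ?exprn_ge0//; last by move=> N;
    rewrite lee_fin exprn_ge0.
  rewrite [RHS]esum_mkcondr; apply: eq_esum => A LA; rewrite /F in_asbool.
  by case: ifP => // _; rewrite exprD EFinM muleC.
rewrite {1}XE esum_sublattices -?XE// XV /zeta_term !EFinM exprD EFinM.
by rewrite !muleA muleC !muleA.
Qed.

Lemma zeta0_add d n (T : R) : 0 <= T -> zeta0 d T \is a fin_num ->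
  (zeta0 (d + n) T = zeta0 d T * zetaw n d (fun=> 0%N) T)%E.
Proof.
move=> T0 zF; rewrite -(@esum_constrained _ _ (fun=> setT))//; last first.
  move=> M LM; exists 1%:M.
  have E : setT = range (mulmx^~ 1%:M : 'rV[o]_d -> 'rV[o]_d).
    by apply/seteqP; split=> // x _; exists x => //; rewrite mulmx1.
  split=> //; first by move=> x y; rewrite !mulmx1.
    split; first by apply/submoduleP.
    by exists 0%N.
  rewrite weight0; apply: (vol_has_index Hp); first by apply/submoduleP.
  exists (fun=> 0); split=> [x|[|i] [|j]]//.
  by exists 0%N.
rewrite zeta0E.
congr (esum _ _); apply/seteqP; split=> I; [by split|by case].
Qed.

End Zetas.

(** * Lattices with a given reduction modulo [p] *)

Section Flag.
Context (o : idomainType) (p : o) (q : nat) (Hp : finite_dvr p q) (R :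
  realType).
Local Notation pdvd := (pdvd p).
Local Notation pdvdv := (pdvdv p).
Local Notation diag_lattice := (diag_lattice p).
Local Notation lattice := (lattice p).
Local Notation vol := (vol q).
Local Notation weight := (weight p q).
Local Notation zetaw := (zetaw p q).
Local Notation zeta_term := (zeta_term p q).

Lemma card_pred_sum (J : finType) (P : pred J) :
  #|[pred i | P i]| = (\sum_i (P i : nat))%N.
Proof. by rewrite -sum1_card big_mkcond; apply: eq_bigr => i _; rewrite inE;
  case: (P i). Qed.

Lemma diag_lattice_full d l (g : 'M[o]_d) : g \in unitmx ->
  diag_lattice l g = setT -> forall j, l j = 0%N.
Proof.
move=> gU E j; have : diag_lattice l g (delta_mx 0 j *m invmx g) by rewrite E.
move=> /(_ j); rewrite mulmxKV// mxE !eqxx; exact: (pdvd_unitF Hp (unitr1 _)).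
Qed.

(** Nakayama's lemma: every elementary divisor is a unit modulo [p]. *)
Lemma lattice_nakayama d (A : set 'rV[o]_d) : lattice A ->
  padd p 1 A = setT -> A = setT.
Proof.
move=> LA; have [l [g [gU -> _]]] := smith Hp LA.
rewrite padd_diag// => /(diag_lattice_full gU) l0.
apply/seteqP; split=> // x _ j; have := l0 j; rewrite /minn; case: ltnP => // h.
by move=> ->; exact: pdvd_0.
Qed.

(** A lattice projecting onto [o ^ d] is the graph of a homomorphism modulo its
    intersection with [o ^ n]. *)
Lemma full_projL d n (I : set 'rV[o]_(d + n)) : lattice I -> projL I = setT ->
  exists F : 'M[o]_(d, n), forall z, I z <-> capR I (rsubmx z - lsubmx z *m F).
Proof.
move=> LI fI; have sI := lattice_sub LI.
have ex (i : 'I_d) : exists y, I (row_mx (delta_mx 0 i) y).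
  by have : projL I (delta_mx 0 i) by rewrite fI.
pose F := \matrix_i sval (cid (ex i)); exists F => z.
have IF (u : 'rV[o]_d) : I (row_mx u (u *m F)).
  rewrite -{1}(mulmx1 u) -mul_mx_row mulmx_sum_row; apply: submod_sum => // i _.
  apply: submodZ => //; rewrite row_row_mx rowK rowE mulmx1.
  by case: cid.
rewrite /capR/=; have -> : row_mx 0 (rsubmx z - lsubmx z *m F) =
    z - row_mx (lsubmx z) (lsubmx z *m F).
  by rewrite -{3}(hsubmxK z) opp_row_mx add_row_mx subrr.
split=> [Iz|]; first exact: submodB.
by move=> /(submodD sI (IF (lsubmx z))); rewrite addrC subrK.
Qed.

Section Fiber.
Context (r s : nat) (g : 'M[o]_(r + s)) (gU : g \in unitmx).

(** In the coordinates given by [g]: the last [s] coordinates are divisible by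
    [p]. *)
Definition flag_lattice : set 'rV[o]_(r + s) :=
  diag_lattice (fun i => (r <= i)%N : nat) g.

(* Multiplication by [E] maps [o ^ (r + s)] onto [flag_lattice]. *)
Let E : 'M[o]_(r + s) := block_mx 1%:M 0 0 p%:M *m invmx g.
Local Notation f := (mulmx^~ E : 'rV[o]_(r + s) -> 'rV[o]_(r + s)).

Let fE (z : 'rV[o]_(r + s)) : z *m E *m g = row_mx (lsubmx z) (p *: rsubmx z).
Proof.
rewrite /= /E mulmxA mulmxKV// -{1}(hsubmxK z) mul_row_block !mulmx0 mulmx1
  addr0 add0r.
by rewrite mul_mx_scalar.
Qed.

Let f_inj : injective f.
Proof.
move=> x y /(congr1 (mulmx^~ g)); rewrite !fE => /eq_row_mx[xl xr].
rewrite -(hsubmxK x) -(hsubmxK y) xl; congr row_mx.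
apply/rowP => j; have /rowP/(_ j) := xr; rewrite !mxE.
exact/mulfI/(dvr_p0 Hp).
Qed.

Let flagE x : flag_lattice x <-> exists z, x *m g = row_mx (lsubmx z) (p *:
  rsubmx z).
Proof.
split=> [xU|[z zE] i].
  have /pdvdvP[w wE] : pdvdv 1 (rsubmx (x *m g)).
    by move=> j; rewrite mxE; have := xU (rshift r j); rewrite /= leq_addr.
  exists (row_mx (lsubmx (x *m g)) w).
  by rewrite row_mxKl row_mxKr -[p]expr1 -wE hsubmxK.
rewrite zE; case: (splitP i) => j ij.
  have -> : i = lshift s j by exact: val_inj.
  by rewrite /= leqNgt ltn_ord; exact: pdvd_0.
have -> : i = rshift r j by exact: val_inj.
rewrite /= leq_addr row_mxEr mxE; exists (rsubmx z 0 j).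
by rewrite expr1.
Qed.

Let f_range : range f = flag_lattice.
Proof.
apply/seteqP; split=> [_ [z _ <-]|x /flagE[z zE]].
  by apply/flagE; exists z; exact: fE.
by exists z => //; rewrite -[LHS](mulmxK gU) fE -zE mulmxK.
Qed.

Lemma vol_flag_lattice : vol flag_lattice = s.
Proof.
rewrite (vol_diag Hp)// big_split_ord/= big1 ?add0n => [|i _].
  rewrite (eq_bigr (fun=> 1%N)) => [|i _]; last by rewrite leq_addr.
  by rewrite sum1_card card_ord.
by rewrite leqNgt ltn_ord.
Qed.

Let flag_range_lattice : lattice (range f).
Proof. by rewrite f_range; exact: diag_lattice_lattice. Qed.

(* By Nakayama, [f @` I] fills [flag_lattice] modulo [p] if and only if [I]
   projects onto [o ^ r]. *)
Let fiber_bij : set_bij [set I | lattice I /\ projL I = setT]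
  [set M | lattice M /\ padd p 1 M = flag_lattice] (fun I => f @` I).
Proof.
split=> [I [LI fI]|I I' _ _ EI|M [LM MU]].
- split; first exact: image_lattice.
  have sU := lattice_sub flag_range_lattice.
  rewrite -f_range; apply/seteqP; split=> [x [y [z Iz fz]]|_ [z _ <-]].
    rewrite -(subrK (p ^+ 1 *: y) x) -fz; apply: submodD => //.
    rewrite f_range; apply/flagE.
    exists (row_mx (p *: lsubmx (y *m g)) (rsubmx (y *m g))).
    rewrite row_mxKl row_mxKr -scale_row_mx hsubmxK expr1 scalemxAl//.
  have [w Iw] : projL I (lsubmx z) by rewrite fI.
  exists (row_mx 0 (rsubmx z - w) *m invmx g);
    exists (row_mx (lsubmx z) w) => //.
  apply: (can_inj (mulmxK gU)); rewrite /= mulmxBl !fE -scalemxAl mulmxKV//.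
  rewrite row_mxKl row_mxKr expr1 scale_row_mx opp_row_mx add_row_mx scaler0.
  by rewrite subr0 -scalerBr opprB addrCA subrr addr0.
- have sub (A B : set 'rV[o]_(r + s)) : f @` A = f @` B -> A `<=` B.
    move=> AB x Ax; have : (f @` B) (f x) by rewrite -AB; exists x.
    by move=> [y By /f_inj <-].
  by apply/seteqP; split; apply: sub.
- have sM := lattice_sub LM.
  have ME : M = f @` (f @^-1` M).
    apply/seteqP; split=> [x Mx|_ [x Mx <-]//].
    have : flag_lattice x.
      by rewrite -MU; exists 0; rewrite scaler0 subr0.
    by rewrite -f_range => -[z _ zx]; exists z; rewrite //= zx.
  exists (f @^-1` M) => //; split; first exact: preimage_lattice.
  apply: lattice_nakayama.
    exact/projL_lattice/preimage_lattice.
  apply/seteqP; split=> // u _.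
  have : flag_lattice (f (row_mx u 0)) by rewrite -f_range; exists (row_mx u 0).
  rewrite -MU => -[y My].
  exists (lsubmx (y *m g)), (- rsubmx (y *m g)) => /=.
  suff <- : f (row_mx u 0) - p ^+ 1 *: y =
     f (row_mx (u - p ^+ 1 *: lsubmx (y *m g)) (- rsubmx (y *m g))) by [].
  apply: (can_inj (mulmxK gU)); rewrite /= mulmxBl !fE -scalemxAl.
  rewrite -{1}(hsubmxK (y *m g)) !row_mxKl !row_mxKr scaler0 scale_row_mx.
  by rewrite opp_row_mx add_row_mx expr1 add0r scalerN.
Qed.

(* The exponents of the elementary divisors of [f @` I], where [l] are those of
   [capR I]. *)
Let lift_exp (l : 'I_s -> nat) (i : 'I_(r + s)) : nat :=
  if fintype.split i is inr j then (l j).+1 else 0%N.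

Let lift_expl l (i : 'I_r) : lift_exp l (lshift s i) = 0%N.
Proof. by rewrite /lift_exp (unsplitK (inl i)). Qed.

Let lift_expr l (i : 'I_s) : lift_exp l (rshift r i) = (l i).+1.
Proof. by rewrite /lift_exp (unsplitK (inr i)). Qed.

Let fiber_diag I : lattice I -> projL I = setT ->
  exists l g2 G, [/\ g2 \in unitmx, capR I = diag_lattice l g2,
    G \in unitmx & f @` I = diag_lattice (lift_exp l) G].
Proof.
move=> LI fI; have [l [g2 [g2U ME _]]] := smith Hp (capR_lattice LI).
have [F IF] := full_projL LI fI.
pose b : 'M[o]_(r + s) := block_mx 1%:M (- (p *: (F *m g2))) 0 g2.
have bU : b \in unitmx by rewrite unitmxE /b det_ublock det1 mul1r -unitmxE.
exists l, g2, (g *m b); split=> //; first by rewrite unitmx_mul gU.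
have rowE' (u : 'rV[o]_r) (w : 'rV[o]_s) :
    row_mx u w *m b = row_mx u ((w - p *: (u *m F)) *m g2).
  rewrite mul_row_block mulmx1 mulmx0 addr0 mulmxN mulmxBl addrC.
  by rewrite -scalemxAr -scalemxAl mulmxA.
apply/seteqP; split=> [_ [z /IF Iz <-] i|x dx].
  rewrite mulmxA fE rowE' -scalerBr -scalemxAl; case: (splitP i) => j ij.
    have -> : i = lshift s j by exact: val_inj.
    by rewrite lift_expl; exact: pdvd_0.
  have -> : i = rshift r j by exact: val_inj.
  rewrite lift_expr row_mxEr mxE -add1n -[X in X * _]expr1.
  by apply/(pdvd_addl Hp); move: Iz; rewrite ME; exact.
set y := x *m g.
have {}dx j : pdvd (lift_exp l j) ((y *m b) 0 j).
  by have := dx j; rewrite mulmxA.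
have d2 j : pdvd (l j).+1 (((rsubmx y - p *: (lsubmx y *m F)) *m g2) 0 j).
  have := dx (rshift r j); rewrite lift_expr.
  by rewrite -{1}(hsubmxK y) rowE' row_mxEr.
have /pdvdvP[w wE] : pdvdv 1 (rsubmx y).
  rewrite -[rsubmx y](subrK (p *: (lsubmx y *m F))) => j; rewrite mxE.
  apply: pdvdD; last by rewrite mxE; exists ((lsubmx y *m F) 0 j);
    rewrite expr1.
  suff : pdvdv 1 (rsubmx y - p *: (lsubmx y *m F)) by exact.
  rewrite -[X in pdvdv _ X](mulmxK g2U); apply: pdvdv_mul => k.
  exact: pdvd_leq (d2 k).
rewrite expr1 in wE.
exists (row_mx (lsubmx y) w).
  apply/IF; rewrite ME row_mxKl row_mxKr => j.
  have := d2 j; rewrite wE -scalerBr -scalemxAl mxE -add1n -[X in X * _]expr1.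
  by move=> /(pdvd_addl Hp).
by apply: (can_inj (mulmxK gU)); rewrite /= fE row_mxKl row_mxKr -wE hsubmxK.
Qed.

Let vol_fiber I : lattice I -> projL I = setT ->
  vol (f @` I) = (s + vol (capR I))%N.
Proof.
move=> LI /(fiber_diag LI)[l [g2 [G [g2U -> GU ->]]]].
rewrite !(vol_diag Hp)// big_split_ord/= big1 => [|i _]; last exact: lift_expl.
rewrite add0n (eq_bigr (fun j => 1 + l j)%N) => [|i _]; last exact: lift_expr.
by rewrite big_split/= sum1_card card_ord.
Qed.

Let weight_fiber C I : C 0%N = 0%N -> lattice I -> projL I = setT ->
  weight C (f @` I) = (C s + weight C (capR I))%N.
Proof.
move=> C0 LI /(fiber_diag LI)[l [g2 [G [g2U -> GU ->]]]].
pose K := (\max_j l j)%N.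
have lK j : (l j <= K)%N by exact: leq_bigmax.
have LK i : (lift_exp l i <= K.+1)%N by rewrite /lift_exp;
  case: fintype.split => [//|j]; exact: lK.
rewrite (weight_diag Hp C0 GU LK) (weight_diag Hp C0 g2U lK) big_ord_recl.
have cardL k : #|[pred i | (k < lift_exp l i)%N]| =
    #|[pred j : 'I_s | (k < (l j).+1)%N]|.
  rewrite !card_pred_sum big_split_ord/= big1 => [|i _];
    last by rewrite lift_expl.
  by rewrite add0n; apply: eq_bigr => j _; rewrite lift_expr.
congr (_ + _)%N.
  rewrite cardL (@eq_card _ _ predT) ?card_ord// => j; exact: ltn0Sn.
by apply: eq_bigr => k _; rewrite cardL.
Qed.

(** The lattices with reduction [flag_lattice] correspond to the [I] projecting
    onto [o ^ r]; these are classified by the arbitrary lattice [capR I] of rank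
    [s] and by one of [q ^ (vol (capR I) * r)] extension classes, whence the shift
    of [D] by [r]. *)
Lemma esum_flag_fiber (D : nat) (C : nat -> nat) (T : R) :
  0 <= T -> C 0%N = 0%N ->
  (\esum_(M in [set M | lattice M /\ padd p 1 M = flag_lattice])
     (zeta_term D C T M)%:E =
   ((q ^ (s * D))%:R * T ^+ (s + C s))%:E * zetaw s (D + r) C T)%E.
Proof.
move=> T0 C0.
rewrite (@reindex_esum _ _ _ _ _ _ _ fiber_bij) -esumZ; last 2 first.
- by rewrite mulr_ge0 ?ler0n ?exprn_ge0.
- by move=> M; rewrite lee_fin zeta_term_ge0.
pose c := (q ^ (s * D))%:R * T ^+ (s + C s).
pose G (M : set 'rV[o]_s) := c * zeta_term D C T M.
have c0 : 0 <= c by rewrite mulr_ge0 ?ler0n ?exprn_ge0.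
have G0 M : 0 <= G M by rewrite mulr_ge0// zeta_term_ge0.
pose F (A : set 'rV[o]_r) (M : set 'rV[o]_s) : \bar R :=
  if A \in [set setT] then (G M)%:E else 0%E.
have F0 A M : (0 <= F A M)%E by rewrite /F; case: ifP; rewrite ?lee_fin.
transitivity (\esum_(I in [set I : set 'rV[o]_(r + s) | lattice I]) F (projL I)
  (capR I))%E.
  transitivity (\esum_(I in [set I : set 'rV[o]_(r + s) | lattice I] `&`
      [set I | projL I = setT])
      (G (capR I))%:E)%E.
    apply: eq_esum => I [LI fI].
    rewrite /G /c /zeta_term vol_fiber// weight_fiber// mulnDl expnD natrM
      addnACA.
    by rewrite [T ^+ (_ + _ + _)]exprD mulrACA.
  rewrite [LHS]esum_mkcondr; apply: eq_esum => I LI; rewrite /F !in_asbool.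
  by [].
rewrite (esum_extensions Hp)//; apply: eq_esum => M LM.
transitivity (\esum_(A in [set A : set 'rV[o]_r | lattice A] `&` [set setT])
    (((q ^ (vol M * r))%:R)%:E * (G M)%:E))%E.
  rewrite [RHS]esum_mkcondr; apply: eq_esum => A LA; rewrite /F.
  by case: ifP => //; rewrite mule0.
rewrite (_ : _ `&` _ = [set setT]); last first.
  apply/seteqP; split=> [A []//|A ->]; split=> //; split.
    by apply/submoduleP.
  by exists 0%N.
rewrite esum_set1 ?mule_ge0 ?lee_fin ?ler0n// -!EFinM /G -/c mulrCA;
  congr (_ * _)%:E.
by rewrite /zeta_term mulrA -natrM -expnD -mulnDr addnC.
Qed.

End Fiber.
End Flag.

(** * Rational functions *)

Section RationalFunctions.
Context (R : realType).
Implicit Types (f g : R -> \bar R) (P Q : {poly R}).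

(** For small [T > 0] the function [f] is finite and equal to [P / Q], and [Q] is
    invertible at [0], so that [P / Q] has a power series expansion there. *)
Definition ratf f P Q : Prop := Q.[0] != 0 /\
  exists2 e : R, 0 < e & forall T, 0 < T < e ->
    Q.[T] != 0 /\ f T = (P.[T] / Q.[T])%:E.

Lemma ratf_ext f g P Q (e : R) : 0 < e ->
  (forall T, 0 < T < e -> f T = g T) -> ratf f P Q -> ratf g P Q.
Proof.
move=> e0 fg [Q0 [e' e'0 fE]]; split=> //.
exists (Num.min e e'); first by rewrite lt_min e0.
move=> T /andP[T0]; rewrite lt_min => /andP[Te Te'].
by rewrite -fg ?T0//; apply: fE; rewrite T0.
Qed.

Lemma ratf_poly P : ratf (fun T => P.[T]%:E) P 1.
Proof.
split; first by rewrite hornerE oner_neq0.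
by exists 1 => // T _; rewrite hornerE oner_neq0 divr1.
Qed.

Lemma ratf_mul f g P Q P' Q' : ratf f P Q -> ratf g P' Q' ->
  ratf (fun T => f T * g T)%E (P * P') (Q * Q').
Proof.
move=> [Q0 [e e0 fE]] [Q'0 [e' e'0 gE]]; split;
  first by rewrite hornerM mulf_neq0.
exists (Num.min e e'); first by rewrite lt_min e0.
move=> T /andP[T0]; rewrite lt_min => /andP[Te Te'].
have [|QT ->] := fE T; first by rewrite T0.
have [|Q'T ->] := gE T; first by rewrite T0.
by rewrite !hornerM mulf_neq0// -EFinM mulf_div.
Qed.

Lemma ratf_add f g P Q P' Q' : ratf f P Q -> ratf g P' Q' ->
  ratf (fun T => f T + g T)%E (P * Q' + P' * Q) (Q * Q').
Proof.
move=> [Q0 [e e0 fE]] [Q'0 [e' e'0 gE]]; split;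
  first by rewrite hornerM mulf_neq0.
exists (Num.min e e'); first by rewrite lt_min e0.
move=> T /andP[T0]; rewrite lt_min => /andP[Te Te'].
have [|QT ->] := fE T; first by rewrite T0.
have [|Q'T ->] := gE T; first by rewrite T0.
by rewrite hornerD !hornerM mulf_neq0// -EFinD addf_div.
Qed.

Lemma ratf_scale f P Q (c : R) : 0 < c -> ratf f P Q ->
  ratf (fun T => f (c * T)) (P \Po (c *: 'X)) (Q \Po (c *: 'X)).
Proof.
move=> c0 [Q0 [e e0 fE]]; split; first by rewrite horner_comp !hornerE ?mulr0.
exists (e / c) => [|T /andP[T0 Te]]; first by rewrite divr_gt0.
rewrite !horner_comp !hornerE; apply: fE.
by rewrite mulr_gt0//= mulrC -ltr_pdivlMr.
Qed.

Lemma esum_geometric (x : R) : 0 <= x < 1 ->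
  (\esum_(k in [set: nat]) (x ^+ k)%:E = ((1 - x)^-1)%:E)%E.
Proof.
move=> /andP[x0 x1]; rewrite -nneseries_esumT; last first.
  by move=> k; rewrite lee_fin exprn_ge0.
apply/cvg_lim => //.
have -> : (fun n => \sum_(0 <= i < n) (x ^+ i)%:E)%E =
    EFin \o series (geometric 1 x).
  apply/funext => n /=; rewrite /series/= sumEFin; congr _%:E.
  by apply: eq_bigr => i _; rewrite mul1r.
apply: cvg_EFin; first exact: nearW.
rewrite -[X in _ --> X]mul1r; apply: cvg_geometric_series.
by rewrite ger0_norm.
Qed.

Lemma ratf_geometric (c : R) (k : nat) : 0 <= c -> (0 < k)%N ->
  ratf (fun T => \esum_(j in [set: nat]) ((c * T ^+ k) ^+ j)%:E)%E 1 (1 - c *: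
    'X^k).
Proof.
move=> c0 k0; split; first by rewrite !hornerE expr0n gtn_eqF// mulr0 subr0
  oner_neq0.
exists (c + 1)^-1 => [|T /andP[T0 Tc]]; first by rewrite invr_gt0 ltr_wpDl.
have T1 : T <= 1.
  by rewrite (le_trans (ltW Tc))// invf_le1 ?lerDr// ltr_wpDl.
have cT : c * T ^+ k < 1.
  have : T ^+ k <= T by case: k k0 => // k _; rewrite exprS ler_piMr
    ?exprn_ile1// ltW.
  have : T * (c + 1) < 1 by rewrite -ltr_pdivlMr ?ltr_wpDl// mul1r.
  move: (T ^+ k) => y; nra.
rewrite !hornerE subr_eq0 eq_sym lt_eqF//; split=> //.
rewrite esum_geometric ?div1r ?mul1r// cT mulr_ge0// exprn_ge0// ltW//.
Qed.

Lemma poly_eq0_small (K : fieldType) (phi : {rmorphism R -> K}) (P : {poly K})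
  (e : R) :
  0 < e -> (forall T, 0 < T < e -> P.[phi T] = 0) -> P = 0.
Proof.
move=> e0 P0.
pose s := [seq phi (e / (k.+2)%:R) | k <- iota 0 (size P)].
apply: (@roots_geq_poly_eq0 _ P s).
- apply/allP => _ /mapP[k _ ->]; apply/rootP/P0.
  by rewrite divr_gt0//= ltr_pdivrMr// ltr_pMr// ltr1n.
- rewrite map_inj_uniq ?iota_uniq// => i j.
  move=> /fmorph_inj/(mulfI (lt0r_neq0 e0))/invr_inj/eqP.
  by rewrite eqr_nat => /eqP[].
- by rewrite size_map size_iota.
Qed.

Lemma ratf_uniq f P Q P' Q' : ratf f P Q -> ratf f P' Q' -> P * Q' = P' * Q.
Proof.
move=> [Q0 [e e0 fE]] [Q'0 [e' e'0 gE]]; apply/eqP; rewrite -subr_eq0;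
  apply/eqP.
apply: (@poly_eq0_small R idfun _ (Num.min e e')); first by rewrite lt_min e0.
move=> T /andP[T0]; rewrite lt_min => /andP[Te Te'].
have [|QT] := fE T; first by rewrite T0.
have [|Q'T ->] := gE T; first by rewrite T0.
move=> [] /eqP; rewrite eqr_div// => /eqP H.
by rewrite hornerD hornerN !hornerM H subrr.
Qed.

(** A rational function which is regular at [1] with value [v]. *)
Definition ratf1 f (v : R) : Prop :=
  exists P Q, [/\ ratf f P Q, Q.[1] != 0 & P.[1] / Q.[1] = v].

Lemma ratf1_ext f g v (e : R) : 0 < e ->
  (forall T, 0 < T < e -> f T = g T) -> ratf1 f v -> ratf1 g v.
Proof.
by move=> e0 fg [P [Q [fPQ Q1 v1]]]; exists P, Q; split=> //;
  exact: (ratf_ext e0 fg fPQ).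
Qed.

Lemma ratf1_poly P : ratf1 (fun T => P.[T]%:E) P.[1].
Proof.
exists P, 1; split; first exact: ratf_poly.
  by rewrite hornerE oner_neq0.
by rewrite [X in _ / X]hornerE divr1.
Qed.

Lemma ratf1_mul f g v w : ratf1 f v -> ratf1 g w -> ratf1 (fun T =>
  f T * g T)%E (v * w).
Proof.
move=> [P [Q [fPQ Q1 <-]]] [P' [Q' [gPQ Q'1 <-]]].
exists (P * P'), (Q * Q'); split; first exact: ratf_mul.
  by rewrite hornerM mulf_neq0.
by rewrite !hornerM mulf_div.
Qed.

Lemma ratf1_add f g v w : ratf1 f v -> ratf1 g w -> ratf1 (fun T =>
  f T + g T)%E (v + w).
Proof.
move=> [P [Q [fPQ Q1 <-]]] [P' [Q' [gPQ Q'1 <-]]].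
exists (P * Q' + P' * Q), (Q * Q'); split; first exact: ratf_add.
  by rewrite hornerM mulf_neq0.
by rewrite hornerD !hornerM addf_div.
Qed.

Lemma ratf1_esum (I : choiceType) (S : set I) (f : I -> R -> \bar R) (v : I ->
  R) :
  finite_set S -> (forall i T, 0 < T -> (0 <= f i T)%E) ->
  (forall i, S i -> ratf1 (f i) (v i)) ->
  ratf1 (fun T => \esum_(i in S) f i T)%E (\sum_(i <- fset_set S) v i).
Proof.
move=> finS f0 fv.
apply: (@ratf1_ext (fun T => \sum_(i <- fset_set S) f i T)%E _ _ 1) => //.
  by move=> T /andP[T0 _]; rewrite esum_fset ?fsbig_finite// => i _; exact: f0.
have {fv} : forall i, i \in enum_fset (fset_set S) -> ratf1 (f i) (v i).
  by move=> i; rewrite in_fset_set// inE => /fv.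
elim: (enum_fset _) => [_|i s IH fv].
  apply: (@ratf1_ext (fun T => (0 : {poly R}).[T]%:E) _ _ 1) => //.
    by move=> T _; rewrite big_nil horner0.
  by rewrite big_nil -(horner0 (1 : R)); exact: ratf1_poly.
rewrite big_cons.
apply: (@ratf1_ext (fun T => f i T + \sum_(i <- s) f i T)%E _ _ 1) => //.
  by move=> T _; rewrite big_cons.
apply: ratf1_add; first by apply: fv; rewrite mem_head.
by apply: IH => j js; apply: fv; rewrite inE js orbT.
Qed.

End RationalFunctions.

(** * Rationality and the value at [T = 1] *)

Section Recursion.
Context (o : idomainType) (p : o) (q : nat) (Hp : finite_dvr p q) (R :
  realType).
Local Notation pdvd := (pdvd p).
Local Notation pdvdv := (pdvdv p).
Local Notation diag_lattice := (diag_lattice p).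
Local Notation lattice := (lattice p).
Local Notation vol := (vol q).
Local Notation weight := (weight p q).
Local Notation zetaw := (@zetaw o p q R).
Local Notation zeta0 := (@zeta0 o p q R).
Local Notation zeta_term := (zeta_term p q).

Section Scaling.
Context (n : nat).

Definition scale_lattice k (M : set 'rV[o]_n) : set 'rV[o]_n :=
  (fun x => p ^+ k *: x) @` M.

Lemma scale_diag k (l : 'I_n -> nat) (g : 'M[o]_n) : g \in unitmx ->
  scale_lattice k (diag_lattice l g) = diag_lattice (fun j => (k + l j)%N) g.
Proof.
move=> gU; apply/seteqP; split=> [_ [x dx <-] j|x dx].
  by rewrite -scalemxAl mxE; apply/(pdvd_addl Hp); exact: dx.
have /pdvdvP[y yE] : pdvdv k (x *m g).
  by move=> j; apply: pdvd_leq (dx j); exact: leq_addr.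
exists (y *m invmx g) => [j|]; last by rewrite scalemxAl -yE mulmxK.
by rewrite mulmxKV//; apply/(pdvd_addl Hp k); have := dx j; rewrite yE mxE.
Qed.

Lemma scale_lattice_lattice k M : lattice M -> lattice (scale_lattice k M).
Proof.
move=> /(smith Hp)[l [g [gU -> _]]]; rewrite scale_diag//.
exact: diag_lattice_lattice.
Qed.

Lemma vol_scale k M : lattice M -> vol (scale_lattice k M) = (k * n + vol M)%N.
Proof.
move=> /(smith Hp)[l [g [gU -> _]]]; rewrite scale_diag// !(vol_diag Hp)//.
by rewrite big_split/= sum_nat_const card_ord mulnC.
Qed.

Lemma weight_scale C k M : C 0%N = 0%N -> lattice M ->
  weight C (scale_lattice k M) = (k * C n + weight C M)%N.
Proof.
move=> C0 /(smith Hp)[l [g [gU -> _]]]; rewrite scale_diag//.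
pose K := (\max_j l j)%N.
have lK j : (l j <= K)%N by exact: leq_bigmax.
rewrite (weight_diag Hp C0 gU lK) (@weight_diag _ _ _ Hp _ _ (k + K)%N)//;
  last first.
  by move=> j; rewrite leq_add2l.
rewrite big_split_ord/=; congr (_ + _)%N.
  rewrite (eq_bigr (fun=> C n)) ?sum_nat_const ?card_ord// => i _.
  rewrite (@eq_card _ _ predT) ?card_ord// => j.
  by rewrite inE (leq_trans (ltn_ord i))// leq_addr.
apply: eq_bigr => i _; congr C; apply: eq_card => j.
by rewrite !inE ltn_add2l.
Qed.

(** The lattices not contained in [p o ^ n]; every lattice is uniquely
    [p ^ k M] with [M] primitive. *)
Definition primitive (M : set 'rV[o]_n) : Prop :=
  lattice M /\ exists2 x, M x & ~ pdvdv 1 x.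

Lemma scale_primitive_uniq k k' M M' : primitive M -> primitive M' ->
  scale_lattice k M = scale_lattice k' M' -> (k = k' /\ M = M').
Proof.
have le (l l' : nat) N N' : primitive N ->
    scale_lattice l N = scale_lattice l' N' -> (l' <= l)%N.
  move=> [_ [x Nx xN]] E; rewrite leqNgt; apply/negP => ll'; apply: xN.
  have : scale_lattice l' N' (p ^+ l *: x) by rewrite -E; exists x.
  move=> [y _]; rewrite -(subnKC (ltnW ll')) exprD -scalerA => yx j.
  have /rowP/(_ j) := yx; rewrite !mxE => /(mulfI (expp_neq0 Hp _)) <-.
  rewrite -(subnK (_ : 1 <= l' - l)%N) ?subn_gt0// addnC exprD.
  by rewrite -mulrA; exact: pdvd_pM.
move=> pM pM' E; have kk' : k = k'.
  by apply/eqP; rewrite eqn_leq (le _ _ _ _ pM' (esym E)) (le _ _ _ _ pM E).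
split=> //; move: E; rewrite -{}kk'.
have sub N N' : scale_lattice k N = scale_lattice k N' -> N `<=` N'.
  move=> E x Nx; have : scale_lattice k N' (p ^+ k *: x) by rewrite -E;
    exists x.
  move=> [y N'y yx]; suff <- : y = x by [].
  apply/rowP => j; have /rowP/(_ j) := yx; rewrite !mxE.
  exact/mulfI/(expp_neq0 Hp).
by move=> E; apply/seteqP; split; apply: sub.
Qed.

End Scaling.

Lemma scale_primitive_ex n (M : set 'rV[o]_n.+1) : lattice M ->
  exists k M', primitive M' /\ M = scale_lattice k M'.
Proof.
move=> /(smith Hp)[l [g [gU -> lM]]].
exists (l ord0), (diag_lattice (fun j => l j - l ord0)%N g); split; last first.
  rewrite scale_diag//; congr (diag_lattice _ _); apply/funext => j.
  by rewrite subnKC// lM.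
split; first exact: diag_lattice_lattice.
exists (delta_mx 0 ord0 *m invmx g) => [j|/(pdvdv_mul g)].
  rewrite mulmxKV// mxE/=; case: eqVneq => [->|_]; first by rewrite subnn;
    exact: pdvd_0.
  exact: pdvd0.
rewrite mulmxKV// => /(_ ord0); rewrite mxE !eqxx =>
  /(pdvd_unitF Hp (unitr1 _)).
by [].
Qed.

Lemma esum_primitive n (f : set 'rV[o]_n.+1 -> \bar R) : (forall M, 0 <= f M)%E
  ->
  (\esum_(M in [set M | lattice M]) f M =
   \esum_(k in [set: nat]) \esum_(M in [set M | primitive M]) f (scale_lattice
     k M))%E.
Proof.
move=> f0; rewrite esum_esum//.
rewrite (@reindex_esum _ _ _ ([set: nat] `*`` (fun=> [set M | primitive M])) _
  (fun k => scale_lattice k.1 k.2))//.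
split=> [[k M] /= [_ [LM _]]|[k M] [k' M']|M LM].
- exact: scale_lattice_lattice.
- rewrite !inE/= => -[_ pM] [_ pM'] /(scale_primitive_uniq pM pM')[-> ->] //.
- have [k [M' [pM' ->]]] := scale_primitive_ex LM.
  by exists (k, M').
Qed.

(** The possible images modulo [p] of the primitive lattices. *)
Definition flags n : set (set 'rV[o]_n) := padd p 1 @` [set M | primitive M].

Lemma padd_sub n (N : set 'rV[o]_n) : N `<=` padd p 1 N.
Proof. by move=> x Nx; exists 0; rewrite scaler0 subr0. Qed.

(** A lattice containing [p o ^ n] is a union of cosets of [p o ^ n]. *)
Lemma flags_finite n : finite_set (@flags n).
Proof.
pose N : set 'rV[o]_n := diag_lattice (fun=> 1%N) 1%:M.
have LN : lattice N by exact: diag_lattice_lattice.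
have NE x : N x <-> pdvdv 1 x by split=> h j; have := h j; rewrite mulmx1.
have [r [rS _]] := has_index_vol Hp LN; set k := (q ^ _)%N in rS.
pose e (b : {ffun 'I_k -> bool}) := [set x | exists i : 'I_k, b i /\ N (x - r
  i)].
apply: (@sub_finite_set _ _ (e @` [set: {ffun 'I_k -> bool}])); last first.
  exact/finite_image/finite_finset.
move=> _ [M [LM _] <-]; have LU := padd_lattice Hp 1 LM.
have sU := lattice_sub LU; have sM := lattice_sub LM.
have pU x : N x -> padd p 1 M x.
  by move=> /NE/pdvdvP[y ->]; exists y; rewrite subrr; exact: submod0.
exists [ffun i : 'I_k => `[< padd p 1 M (r i) >]] => //.
apply/seteqP; split=> [x [i [+ Ni]]|x Ux].
  rewrite ffunE => /asboolP Ui; rewrite -(subrK (r i) x).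
  by apply: submodD => //; exact: pU.
have [i ik Ni] := rS x; exists (Ordinal ik); split=> //.
rewrite ffunE; apply/asboolP; exact: submodBl Ux (pU _ Ni).
Qed.

(** In coordinates adapted to [M] the image of [M] modulo [p] is spanned by the
    basis vectors whose elementary divisor is a unit; these come first because the
    exponents increase. *)
Lemma flags_shape n (U : set 'rV[o]_n) : flags U ->
  exists r (g : 'M[o]_n), [/\ (0 < r <= n)%N, g \in unitmx &
    U = diag_lattice (fun i => (r <= i)%N : nat) g].
Proof.
case: n U => [|n] U [M [LM [x Mx xN]] <-]; first by case: xN => -[].
have [l [g [gU ME lM]]] := smith Hp LM.
have exr : exists r, (r <= n.+1)%N && [forall i : 'I_n.+1, (r <= i)%N ==>
  (0 < l i)%N].
  exists n.+1; rewrite leqnn/=; apply/forallP => i.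
  by rewrite leqNgt ltn_ord.
case: (ex_minnP exr) => r /andP[rn /forallP lr] rmin.
have l0 (i : 'I_n.+1) : (0 < l i)%N = (r <= i)%N.
  apply/idP/idP => [li|ri]; last by have := lr i; rewrite ri.
  apply: rmin; rewrite ltnW//=; apply/forallP => j; apply/implyP => ij.
  exact: leq_trans li (lM _ _ ij).
exists r, g; split=> //.
  rewrite rn andbT lt0n; apply/eqP => r0; apply: xN.
  suff : pdvdv 1 (x *m g) by move=> /(pdvdv_mul (invmx g)); rewrite mulmxK.
  move: Mx; rewrite ME => dx j; apply: pdvd_leq (dx j).
  by rewrite l0 r0.
rewrite ME padd_diag//; congr (diag_lattice _ _); apply/funext => i.
by rewrite -l0; case: (l i) => // k; rewrite minnC /minn ltnS.
Qed.

Lemma vol_flag n (U : set 'rV[o]_n) : flags U -> (vol U < n)%N.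
Proof.
move=> /flags_shape[r [g [/andP[r0 rn] gU {U}->]]].
move: n rn g gU => n rn; rewrite -(subnKC rn) => g gU.
rewrite [X in (X < _)%N](vol_flag_lattice Hp gU).
by rewrite -[X in (X < _)%N]add0n ltn_add2r.
Qed.

(** The primitive lattices are sorted by their reduction [U] modulo [p]; those
    over [U] are parametrized by lattices of the smaller rank [vol U]. *)
Lemma esum_flags D C T n : 0 <= T -> C 0%N = 0%N ->
  (\esum_(M in [set M : set 'rV[o]_n | primitive M]) (zeta_term D C T M)%:E =
   \esum_(U in @flags n) (((q ^ (vol U * D))%:R * T ^+ (vol U + C (vol U)))%:E *
      zetaw (vol U) (D + (n - vol U)) C T))%E.
Proof.
move=> T0 C0.
transitivity (\esum_(U in @flags n) \esum_(M in [set M | lattice M /\ padd p 1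
  M = U])
    (zeta_term D C T M)%:E)%E.
  rewrite esum_esum => [|U M _ _]; last by rewrite lee_fin zeta_term_ge0.
  rewrite [RHS](@reindex_esum _ _ _ [set M : set 'rV[o]_n | primitive M] _
    (fun M => (padd p 1 M, M)))//.
  split=> [M pM|M M' _ _ []//|[U M] /= [[M0 [LM0 [x M0x xN]] EU] [LM MU]]].
  - by split=> /=; [exists M|split=> //; case: pM].
  - exists M; last by rewrite MU.
    split=> //; apply: contrapT => H; apply: xN.
    have : padd p 1 M x by rewrite MU -EU; exact: padd_sub.
    move=> [y My]; have dM z : M z -> pdvdv 1 z.
      by move=> Mz; apply: contrapT => zN; apply: H; exists z.
    move=> j; have := dM _ My j; rewrite rowBZ => h.
    rewrite -[X in pdvd _ X](subrK (p ^+ 1 * y 0 j)).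
    by apply: pdvdD h _; exact: pdvd_pM.
apply: eq_esum => U /flags_shape[r [g [/andP[r0 rn] gU {U}->]]].
move: n rn g gU => n rn; rewrite -(subnKC rn) => g gU.
have vU := vol_flag_lattice Hp gU.
rewrite /flag_lattice in vU; rewrite !vU addnK.
exact: (esum_flag_fiber Hp gU).
Qed.

Lemma zetaw0 D C T : (zetaw 0 D C T = 1)%E.
Proof.
have L0 : lattice [set: 'rV[o]_0].
  by split; [apply/submoduleP|exists 0%N].
have vol0 : vol [set: 'rV[o]_0] = 0%N.
  apply: (vol_has_index Hp); first by case: L0.
  by exists (fun=> 0); split=> [x|[|i] [|j]]//; exists 0%N.
rewrite /zetaw (_ : [set M | _] = [set setT]).
  by rewrite esum_set1 /zeta_term vol0 weight_vol0// !mulr1.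
apply/seteqP; split=> [M LM|_ ->//].
apply/seteqP; split=> // x _; rewrite (_ : x = 0); last by apply/rowP => -[].
exact: submod0 (lattice_sub LM).
Qed.

(** Passing from [M] to [p ^ k M] multiplies the summand by the [k]-th power of a
    monomial in [T]. *)
Lemma zetaw_primitive n D C T : 0 <= T -> C 0%N = 0%N ->
  (\esum_(M in [set M : set 'rV[o]_n.+1 | primitive M]) (zeta_term D C T
    M)%:E)%E \is a fin_num ->
  (zetaw n.+1 D C T =
   (\esum_(k in [set: nat]) (((q ^ (n.+1 * D))%:R * T ^+ (n.+1 + C n.+1)) ^+
     k)%:E) *
   \esum_(M in [set M : set 'rV[o]_n.+1 | primitive M]) (zeta_term D C T
     M)%:E)%E.
Proof.
move=> T0 C0 SF; rewrite /zetaw esum_primitive => [|M]; last first.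
  by rewrite lee_fin zeta_term_ge0.
set c := _%:R * _.
have c0 : 0 <= c by rewrite mulr_ge0 ?ler0n ?exprn_ge0.
rewrite [RHS]muleC -(fineK SF) -esumZ ?fine_ge0 ?esum_ge0//; last 2 first.
- by move=> M _; rewrite lee_fin zeta_term_ge0.
- by move=> k; rewrite lee_fin exprn_ge0.
apply: eq_esum => k _; rewrite fineK// muleC -esumZ ?exprn_ge0//; last first.
  by move=> M; rewrite lee_fin zeta_term_ge0.
apply: eq_esum => M [LM _]; rewrite -EFinM; congr _%:E.
rewrite /zeta_term vol_scale// weight_scale// addnACA exprD mulnDl expnD natrM.
rewrite -mulnDr mulrACA; congr (_ * _).
rewrite /c exprMn -exprM -natrX -expnM; congr (_%:R * _ ^+ _).
  by congr (_ ^ _)%N; rewrite -mulnA mulnC.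
by rewrite mulnC.
Qed.

(** The recursion expresses [zetaw n D C] by the factor
    [1 / (1 - q ^ (n * D) * T ^ (n + C n))] and by the functions of smaller rank,
    with coefficients that are monomials in [T] times numbers not involving [C].
    As [q ^ (n * D) <> 1], the factor is regular at [T = 1], where [C] disappears
    from all terms; so by induction the value at [1] does not depend on [C]. *)
Lemma zetaw_ratf1 n D : (0 < D)%N ->
  exists v, forall C, C 0%N = 0%N -> ratf1 (zetaw n D C) v.
Proof.
elim/ltn_ind: n D => -[|n] IH D D0.
  exists 1 => C _; apply: (@ratf1_ext _ (fun T =>
    (1 : {poly R}).[T]%:E) _ _ 1) => //.
    by move=> T _; rewrite hornerC zetaw0.
  by have := ratf1_poly (1 : {poly R}); rewrite [X in ratf1 _ X]hornerC.
have [V VP] : exists V : set 'rV[o]_n.+1 -> R, forall U, flags U ->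
    forall C, C 0%N = 0%N -> ratf1 (zetaw (vol U) (D + (n.+1 - vol U)) C) (V U).
  have /choice[V VP] : forall U : set 'rV[o]_n.+1, exists v, flags U ->
      forall C, C 0%N = 0%N -> ratf1 (zetaw (vol U) (D + (n.+1 - vol U)) C) v.
    move=> U; have [FU|] := pselect (flags U); last by exists 0.
    have [v vP] := IH _ (vol_flag FU) (D + (n.+1 - vol U))%N (ltn_addr _ D0).
    by exists v => _.
  by exists V.
exists ((1 - (q ^ (n.+1 * D))%:R)^-1 *
  \sum_(U <- fset_set (@flags n.+1)) ((q ^ (vol U * D))%:R * V U)) => C C0.
have S1 : ratf1 (fun T => \esum_(M in [set M : set 'rV[o]_n.+1 | primitive M])
    (zeta_term D C T M)%:E)%E
    (\sum_(U <- fset_set (@flags n.+1)) ((q ^ (vol U * D))%:R * V U)).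
  apply: (@ratf1_ext _ (fun T => \esum_(U in @flags n.+1)
    (((q ^ (vol U * D))%:R * T ^+ (vol U + C (vol U)))%:E *
      zetaw (vol U) (D + (n.+1 - vol U)) C T))%E _ _ 1) => //.
    by move=> T /andP[T0 _]; rewrite esum_flags// ltW.
  apply: ratf1_esum; first exact: flags_finite.
    move=> U T T0; apply: mule_ge0; last by rewrite zetaw_ge0// ltW.
    by rewrite lee_fin mulr_ge0 ?ler0n ?exprn_ge0 ?ltW.
  move=> U FU; apply: ratf1_mul; last exact: VP.
  have := ratf1_poly ((q ^ (vol U * D))%:R%:P * 'X^(vol U + C (vol U)) : {poly
    R}).
  rewrite [X in ratf1 _ X]hornerM hornerC hornerXn expr1n mulr1.
  apply: (@ratf1_ext _ _ _ _ 1) => // T _.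
  by rewrite hornerM hornerC hornerXn.
have [P [Q [[_ [e e0 SE]] _ _]]] := S1.
apply: (@ratf1_ext _ (fun T =>
   (\esum_(k in [set: nat]) (((q ^ (n.+1 * D))%:R * T ^+ (n.+1 + C n.+1)) ^+
     k)%:E) *
   \esum_(M in [set M : set 'rV[o]_n.+1 | primitive M]) (zeta_term D C T
     M)%:E)%E
   _ _ e e0) => [T /andP[T0 Te]|].
  rewrite zetaw_primitive// ?ltW//.
  by have [|_ ->] := SE T; rewrite ?T0.
apply: ratf1_mul => //.
exists 1, (1 - (q ^ (n.+1 * D))%:R *: 'X^(n.+1 + C n.+1)); split.
- by apply: ratf_geometric; rewrite ?ler0n.
- rewrite !hornerE expr1n mulr1 subr_eq0 eq_sym pnatr_eq1.
  by rewrite gtn_eqF// -{1}(expn0 q) ltn_exp2l ?muln_gt0// (residue_gt1 Hp).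
- by rewrite !hornerE expr1n mulr1.
Qed.

End Recursion.

Section ZetaFree.
Context (o : idomainType) (p : o) (q : nat) (Hp : finite_dvr p q) (R :
  realType).
Local Notation pdvd := (pdvd p).
Local Notation pdvdv := (pdvdv p).
Local Notation diag_lattice := (diag_lattice p).
Local Notation lattice := (lattice p).
Local Notation vol := (vol q).
Local Notation zetaw := (@zetaw o p q R).
Local Notation zeta0 := (@zeta0 o p q R).
Local Notation zeta_term := (zeta_term p q).

(** The lattices of [o] are the [p ^ k o]. *)
Lemma zetaw1 D T : 0 <= T ->
  (zetaw 1 D (fun=> 0%N) T = \esum_(k in [set: nat]) (((q ^ D)%:R * T ^+ 1) ^+
    k)%:E)%E.
Proof.
move=> T0.
have S1 : (\esum_(M in [set M : set 'rV[o]_1 | primitive p M])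
    (zeta_term D (fun=> 0%N) T M)%:E = 1)%E.
  rewrite (_ : [set M | _] = [set setT]).
    rewrite esum_set1 ?lee_fin ?zeta_term_ge0// /zeta_term weight0 addn0.
    suff -> : vol [set: 'rV[o]_1] = 0%N by rewrite mul0n mulr1.
    apply: (vol_has_index Hp); first by apply/submoduleP.
    by exists (fun=> 0); split=> [x|[|i] [|j]]//; exists 0%N.
  apply/seteqP; split=> [M [LM [x Mx xN]]|_ ->].
    have [l [g [gU ME _]]] := smith Hp LM.
    case l0 : (l ord0) => [|k].
      rewrite ME; apply/seteqP; split=> // y _ j.
      by rewrite (ord1 j) l0; exact: pdvd_0.
    exfalso; apply: xN; suff : pdvdv 1 (x *m g).
      by move=> /(pdvdv_mul (invmx g)); rewrite mulmxK.
    move: Mx; rewrite ME => dx j; apply: pdvd_leq (dx j).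
    by rewrite (ord1 j) l0.
  split; first by split; [apply/submoduleP|exists 0%N].
  exists (const_mx 1) => // /(_ ord0); rewrite mxE =>
    /(pdvd_unitF Hp (unitr1 _)).
  by [].
by rewrite (zetaw_primitive Hp)// S1// mule1 mul1n addn0.
Qed.

(** The classical product formula, by splitting off one coordinate at a time. *)
Lemma zeta0_ratf d :
  ratf (zeta0 d) 1 (\prod_(i < d) (1 - (q ^ i)%:R *: 'X)).
Proof.
elim: d => [|d IH].
  rewrite big_ord0; apply: (@ratf_ext _ (fun T =>
    (1 : {poly R}).[T]%:E) _ _ _ 1) => //.
    by move=> T _; rewrite hornerC /zeta0 (zetaw0 Hp).
  exact: ratf_poly.
rewrite big_ord_recr/= -[X in ratf _ X _]mulr1 -addn1.
have [_ [e e0 zE]] := IH.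
apply: (@ratf_ext _ (fun T => zeta0 d T *
    \esum_(k in [set: nat]) (((q ^ d)%:R * T ^+ 1) ^+ k)%:E)%E _ _ _ e e0).
  move=> T /andP[T0 Te]; rewrite (zeta0_add Hp) ?ltW// ?zetaw1 ?ltW//.
  by have [|_ ->] := zE T; rewrite ?T0.
by apply: ratf_mul => //; apply: ratf_geometric; rewrite ?ler0n.
Qed.

(** For the zero weight the function is [1 / \prod_(i < n) (1 - q ^ (D + i) * T)],
    whose numerator does not vanish at [1]. *)
Lemma zetaw_value_neq0 n D v :
  (forall C, C 0%N = 0%N -> ratf1 (zetaw n D C) v) -> v != 0.
Proof.
move=> /(_ (fun=> 0%N) erefl)[P [Q [zPQ Q1 <-]]].
have qD0 : 0 < (q ^ D)%:R :> R by rewrite ltr0n expn_gt0 ltnW// (residue_gt1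
  Hp).
have zE T : 0 < T < 1 -> zeta0 n ((q ^ D)%:R * T) = zetaw n D (fun=> 0%N) T.
  move=> /andP[T0 _]; rewrite zeta0E; apply: eq_esum => M _.
  by rewrite /zeta_term weight0 addn0 exprMn -natrX -expnM mulnC.
have /(ratf_uniq zPQ)/(congr1 (horner^~ 1)) :=
  ratf_ext ltr01 zE (ratf_scale qD0 (zeta0_ratf n)).
rewrite /= hornerM [in RHS]hornerM [X in _ = X * _]horner_comp hornerC mul1r =>
  E.
rewrite mulf_neq0 ?invr_eq0//; apply/eqP => P0.
by move: Q1; rewrite -E P0 mul0r eqxx.
Qed.

End ZetaFree.

(** * From real to complex generating functions *)

Section Transfer.
Context (R : realType).
Local Notation C := (Cplx R).
Local Notation rc := (real_complex R : R -> C).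
Implicit Types (H P Q W : {poly R}).

Definition cpoly H : {poly C} := map_poly (real_complex R) H.

Definition abs_poly H : {poly R} := \poly_(i < size H) `|H`_i|.

Lemma coef_abs_poly H i : (abs_poly H)`_i = `|H`_i|.
Proof.
rewrite coef_poly; case: ltnP => // h.
by rewrite nth_default// normr0.
Qed.

Lemma poly_split0 H : exists G c, H = G * 'X + c%:P.
Proof. by elim/poly_ind: H => [|G c _]; [exists 0, 0;
  rewrite mul0r addr0|exists G, c]. Qed.

Lemma horner_abs_le H (T T1 : R) : 0 <= T <= T1 -> `|H.[T]| <= (abs_poly
  H).[T1].
Proof.
move=> /andP[T0 TT1]; rewrite (horner_coef_wide T (leqnn _)).
rewrite (horner_coef_wide T1 (size_poly _ _ : (size (abs_poly H) <= size H)%N)).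
rewrite (le_trans (ler_norm_sum _ _ _))// ler_sum// => i _.
rewrite coef_abs_poly normrM normrX (ger0_norm T0) ler_wpM2l//.
by rewrite lerXn2r ?nnegrE// (le_trans T0).
Qed.

(** A polynomial which is [O(T ^ N)] at [0] is divisible by ['X ^ N]. *)
Lemma coef_eq0_small H (K e : R) N : 0 < e ->
  (forall T, 0 < T < e -> `|H.[T]| <= K * T ^+ N) ->
  forall m, (m < N)%N -> H`_m = 0.
Proof.
move=> e0; elim: N H => [//|N IH] H HK.
have [G [c HE]] := poly_split0 H.
have K0 : 0 <= K.
  have /(le_trans (normr_ge0 _)) : `|H.[e / 2]| <= K * (e / 2) ^+ N.+1.
    by apply: HK; lra.
  by rewrite pmulr_lge0// exprn_gt0//; lra.
have HT T : H.[T] = G.[T] * T + c by rewrite HE !hornerE.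
have c0 : c = 0.
  pose B := K + (abs_poly G).[1].
  have cB T : 0 < T < Num.min e 1 -> `|c| <= T * B.
    rewrite lt_min => /andP[T0 /andP[Te T1]].
    have -> : c = H.[T] - G.[T] * T by rewrite HT addrC addKr.
    rewrite (le_trans (ler_normB _ _))// normrM (ger0_norm (ltW T0)) mulrDr
      lerD//.
      rewrite (le_trans (HK _ _)) ?T0// mulrC ler_wpM2r//.
      by rewrite exprS ler_piMr ?exprn_ile1// ltW.
    by rewrite mulrC ler_wpM2l ?(ltW T0)// horner_abs_le// !ltW.
  have B0 : 0 <= B.
    rewrite addr_ge0// (le_trans _ (@horner_abs_le G 0 1 _))// lexx ler01//.
  apply/eqP; rewrite -normr_eq0 eq_le normr_ge0 andbT leNgt; apply/negP => cp.
  pose T := Num.min (Num.min e 1 / 2) (`|c| / (2 * (B + 1))).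
  have m0 : 0 < Num.min e 1 by rewrite lt_min e0 ltr01.
  have T0 : 0 < T by rewrite lt_min !divr_gt0//; lra.
  have T1 : T < Num.min e 1 by rewrite gt_min; apply/orP; left; lra.
  have := cB T; rewrite T0 T1 => /(_ isT); apply/negP; rewrite -ltNge.
  have : T <= `|c| / (2 * (B + 1)) by rewrite ge_min lexx orbT.
  rewrite ler_pdivlMr; last lra.
  nra.
case=> [_|m mN]; first by rewrite HE coefD coefMX coefC c0 addr0.
rewrite HE coefD coefMX coefC addr0/=; apply: IH => // T /andP[T0 Te].
have := HK T; rewrite T0 Te => /(_ isT).
rewrite HT c0 addr0 normrM (gtr0_norm T0) exprSr mulrA ler_pM2r//.
Qed.

(** The terms of degree at least [N] shrink by the factor [(x / T0) ^ N] when
    passing from [T0] to a complex number [t] of absolute value [x]. *)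
Lemma cpoly_bound H W N (x T0 : R) (t : C) :
  0 <= x <= T0 -> 0 < T0 -> `|t| = rc x ->
  (forall m, (m < N)%N -> H`_m = 0) -> (forall m, `|H`_m| <= W`_m) ->
  `|(cpoly H).[t]| <= rc ((x / T0) ^+ N * W.[T0]).
Proof.
move=> /andP[x0 xT] T0p tx H0 HW.
pose n := maxn (size H) (size W).
rewrite (horner_coef_wide t (_ : size (cpoly H) <= n)%N); last first.
  by rewrite size_map_poly leq_maxl.
rewrite (horner_coef_wide T0 (leq_maxr (size H) _)) -/n.
rewrite (le_trans (ler_norm_sum _ _ _))// mulr_sumr rmorph_sum ler_sum// => i _.
rewrite coef_map normrM normrX tx.
have -> : `|rc H`_i| = rc `|H`_i|.
  by rewrite normc_def/= expr0n addr0 sqrtr_sqr.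
rewrite -rmorphXn -rmorphM lecR.
have [iN|Ni] := ltnP i N.
  have W0 : 0 <= W`_i := le_trans (normr_ge0 _) (HW i).
  have T00 := ltW T0p; rewrite H0// normr0 mul0r.
  apply: mulr_ge0; first by rewrite exprn_ge0// divr_ge0.
  by rewrite mulr_ge0// exprn_ge0.
rewrite mulrCA ler_pM ?exprn_ge0//.
have -> : (x / T0) ^+ N * T0 ^+ i = x ^+ N * T0 ^+ (i - N).
  by rewrite -{1}(subnKC Ni) exprD mulrA -exprMn divfK ?gt_eqF.
rewrite -{1}(subnKC Ni) exprD ler_wpM2l ?exprn_ge0//.
by rewrite lerXn2r ?nnegrE// ltW.
Qed.

Lemma big_mem_swap (V : nmodType) (I : eqType) (r r' : seq I) (F : I -> V) :
  uniq r -> uniq r' ->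
  \sum_(i <- r | i \in r') F i = \sum_(i <- r' | i \in r) F i.
Proof.
move=> ur ur'; rewrite -big_filter -[RHS]big_filter; apply: perm_big.
apply: uniq_perm; rewrite ?filter_uniq// => i.
by rewrite !mem_filter andbC.
Qed.

Section Family.
Context (I : choiceType) (X : set I) (a : I -> nat) (P Q : {poly R}).
Local Notation f := (fun T : R => \esum_(i in X) (T ^+ a i)%:E)%E.
Hypothesis fPQ : ratf f P Q.

Variables (e T0 s : R).
Hypotheses (Te : 0 < T0 < e) (fE : forall T, 0 < T < e ->
    Q.[T] != 0 /\ f T = (P.[T] / Q.[T])%:E) (sE : f T0 = s%:E).

Let T0p : 0 < T0. Proof. by case/andP: Te. Qed.

Lemma fsum_le_esum (J : seq I) (T : R) : 0 <= T -> uniq J -> {in J, forall i, X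
  i} ->
  ((\sum_(i <- J) T ^+ a i)%:E <= f T)%E.
Proof.
move=> T_ge0 uJ JX; apply: esum_ge; exists [set` J].
  by split; [exact: finite_seq|move=> i /JX].
by rewrite -sumEFin fsbig_seq.
Qed.

(** Each element of the level set contributes at least [min(T0, 1) ^ N] to the
    finite sum [s]. *)
Lemma level_finite N : finite_set (X `&` [set i | (a i < N)%N]).
Proof.
apply: contrapT => /infinite_set_fset - /(_ (Num.bound (s / (Num.min T0 1) ^+
  N)).+1).
move=> [B BX Bn].
pose t := Num.min T0 1; have t0 : 0 < t by rewrite lt_min T0p ltr01.
have : ((\sum_(i <- B) T0 ^+ a i)%:E <= f T0)%E.
  apply: fsum_le_esum; [exact: ltW|exact: fset_uniq|].
  by move=> i iB; have [] := BX i iB.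
rewrite sE lee_fin => H.
have t0' := ltW t0; have t1 : t <= 1 by rewrite ge_min lexx orbT.
have tT : t <= T0 by rewrite ge_min lexx.
have : #|`B|%:R * t ^+ N <= s.
  apply: le_trans H; rewrite mulr_natl.
  have -> : t ^+ N *+ #|`B| = \sum_(i <- B) t ^+ N
    by rewrite big_const_seq count_predT iter_addr_0.
  rewrite big_seq [leRHS]big_seq; apply: ler_sum => i iB.
  have [_ /= aiN] := BX _ iB.
  apply: (@le_trans _ _ (t ^+ a i)).
    by rewrite -(subnKC (ltnW aiN)) exprD ler_piMr ?exprn_ge0// exprn_ile1.
  by rewrite lerXn2r ?nnegrE// ltW.
rewrite -ler_pdivlMr ?exprn_gt0// => sB.
have s0 : 0 <= s / t ^+ N by rewrite (le_trans _ sB).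
have := archi_boundP s0; apply/negP; rewrite -leNgt (le_trans _ sB)//.
by rewrite ler_nat ltnW.
Qed.

(* The terms of degree less than [N]; [S N] is their generating polynomial. *)
Let J N := fset_set (X `&` [set i | (a i < N)%N]).

Let JP N i : (i \in J N) = (i \in X) && (a i < N)%N.
Proof.
rewrite in_fset_set; last exact: level_finite.
by apply/idP/andP; rewrite !inE => -[].
Qed.

Let S N : {poly R} := \sum_(i <- J N) 'X^(a i).

Let SE N T : (S N).[T] = \sum_(i <- J N) T ^+ a i.
Proof. by rewrite horner_sum; apply: eq_bigr => i _; rewrite hornerXn. Qed.

Let S_ge0 N m : 0 <= (S N)`_m.
Proof. by rewrite coef_sum sumr_ge0// => i _; rewrite coefXn ler0n. Qed.

Let S_le N : (S N).[T0] <= s.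
Proof.
rewrite SE -lee_fin -sE; apply: fsum_le_esum; [exact: ltW|exact: fset_uniq|].
by move=> i; rewrite JP => /andP[/set_mem].
Qed.

(** Terms of degree at least [N] shrink by [(x / T0) ^+ N] from [T0] to [x]. *)
Let tail_le (K : seq I) N (x : R) : 0 <= x <= T0 -> uniq K -> {in K, forall i,
  X i} ->
  \sum_(i <- K | i \notin J N) x ^+ a i <= (x / T0) ^+ N * s.
Proof.
move=> /andP[x0 xT] uK KX.
apply: (@le_trans _ _ (\sum_(i <- K) (x / T0) ^+ N * T0 ^+ a i)); last first.
  rewrite -mulr_sumr ler_wpM2l ?exprn_ge0 ?divr_ge0 ?(ltW T0p)//.
  by rewrite -lee_fin -sE; apply: fsum_le_esum => //; exact: ltW.
rewrite big_mkcond big_seq [leRHS]big_seq; apply: ler_sum => i iK.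
case: ifP => [|_]; last by rewrite mulr_ge0 ?exprn_ge0 ?divr_ge0 ?(ltW T0p).
rewrite JP (mem_set (KX _ iK))/= -leqNgt => Na.
have -> : (x / T0) ^+ N * T0 ^+ a i = x ^+ N * T0 ^+ (a i - N).
  by rewrite -{1}(subnKC Na) exprD mulrA -exprMn divfK ?gt_eqF.
rewrite -{1}(subnKC Na) exprD ler_wpM2l ?exprn_ge0//.
by rewrite lerXn2r ?nnegrE// ltW.
Qed.

Let f_approx N (x : R) : 0 < x <= T0 ->
  exists2 y, f x = y%:E & `|y - (S N).[x]| <= (x / T0) ^+ N * s.
Proof.
move=> /andP[x0 xT]; have xe : 0 < x < e.
  by rewrite x0 (le_lt_trans xT)//; case/andP: Te.
exists (P.[x] / Q.[x]); first by case: (fE xe).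
set y := _ / _; have yE : f x = y%:E by case: (fE xe).
have lo : (S N).[x] <= y.
  rewrite SE -lee_fin -yE; apply: fsum_le_esum; [exact: ltW|exact: fset_uniq|].
  by move=> i; rewrite JP => /andP[/set_mem].
have hi : y <= (S N).[x] + (x / T0) ^+ N * s.
  rewrite -lee_fin -yE; apply: ge_ereal_sup => _ [B [finB BX] <-].
  rewrite fsbig_finite//= sumEFin lee_fin (bigID (mem (J N)))/= lerD//.
    rewrite SE big_mem_swap ?fset_uniq// big_mkcond/= ler_sum// => i _.
    by case: ifP => // _; rewrite exprn_ge0// ltW.
  apply: tail_le; [by rewrite ltW|exact: fset_uniq|].
  by move=> i; rewrite in_fset_set// inE => /BX.
by rewrite ger0_norm ?subr_ge0// lerBlDl.
Qed.

Let K : R := (abs_poly P).[T0] + (abs_poly Q).[T0] * s.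

(* [P - Q * S N] is [Q] times the tail of the series, hence [O(T ^ N)] for real
   [T], hence divisible by ['X ^ N]; so it is small at complex points as well. *)
Let approx_bound N (x : R) (t : C) : 0 <= x <= T0 -> `|t| = rc x ->
  `|(cpoly (P - Q * S N)).[t]| <= rc ((x / T0) ^+ N * K).
Proof.
move=> xT tx; pose W := abs_poly P + abs_poly Q * S N.
have W_ge0 H : (forall m, 0 <= H`_m) -> 0 <= H.[T0].
  by move=> H0; rewrite horner_coef sumr_ge0// => m _;
    rewrite mulr_ge0// exprn_ge0// ltW.
have QT : 0 <= (abs_poly Q).[T0] by apply: W_ge0 => m; rewrite coef_abs_poly.
apply: le_trans (cpoly_bound (N := N) (W := W) xT T0p tx _ _) _.
- apply: (@coef_eq0_small _ ((abs_poly Q).[T0] * (s / T0 ^+ N)) T0) =>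
  // T /andP[Tp TT].
  have [|y fy yS] := @f_approx N T; first by rewrite Tp ltW.
  have Te' : 0 < T < e by rewrite Tp (lt_trans TT)//; case/andP: Te.
  have [QT0 fT] := fE Te'.
  move: fy; rewrite fT => -[yE].
  have -> : (P - Q * S N).[T] = Q.[T] * (y - (S N).[T]).
    by rewrite hornerD hornerN hornerM mulrBr -yE [Q.[T] * (_ / _)]mulrC divfK.
  rewrite normrM -mulrA ler_pM//.
    by rewrite horner_abs_le// !ltW.
  apply: le_trans yS _.
  by rewrite expr_div_n [leLHS]mulrC [leLHS]mulrA [leLHS]mulrAC.
- move=> m; rewrite coefB coefD coef_abs_poly (le_trans (ler_normB _ _))//
  lerD//.
  rewrite !coefM (le_trans (ler_norm_sum _ _ _))// ler_sum// => j _.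
  by rewrite normrM coef_abs_poly (ger0_norm (S_ge0 _ _)).
rewrite lecR /K hornerD hornerM.
have /andP[x0 _] := xT.
by rewrite ler_wpM2l ?exprn_ge0 ?divr_ge0 ?(ltW T0p)// lerD2l ler_wpM2l// S_le.
Qed.

(** [Q] stays close to [Q.[0]]. *)
Lemma Q_neq0 (x : R) (t : C) : 0 <= x <= T0 -> `|t| = rc x ->
  x / T0 * (abs_poly Q).[T0] < `|Q.[0]| -> (cpoly Q).[t] != 0.
Proof.
move=> xT tx xQ; apply/eqP => Qt0.
have : `|(cpoly (Q - (Q.[0])%:P)).[t]| <= rc ((x / T0) ^+ 1 * (abs_poly
  Q).[T0]).
  apply: cpoly_bound => // [[|//] _|m].
    by rewrite coefB coefC/= -horner_coef0 subrr.
  rewrite coefB coefC coef_abs_poly; case: m => [|m] /=; last by rewrite subr0.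
  by rewrite -horner_coef0 subrr normr0.
rewrite /cpoly rmorphB/= map_polyC hornerD hornerN hornerC Qt0 sub0r normrN
  expr1.
have -> : `|rc Q.[0]| = rc `|Q.[0]| by rewrite normc_def/= expr0n addr0
  sqrtr_sqr.
by rewrite lecR leNgt xQ.
Qed.

Lemma partial_sum_cvg (x : R) (t : C) : 0 <= x <= T0 / 2 -> `|t| = rc x ->
  (cpoly Q).[t] != 0 ->
  partial_sum ((fun i => t ^+ a i) \_ X) @ totally --> (cpoly P).[t] / (cpoly
    Q).[t].
Proof.
move=> /andP[x0 xT2] tx Qt0; have xT : 0 <= x <= T0 by rewrite x0/=; lra.
have [y yE] : exists y, `|(cpoly Q).[t]| = rc y by rewrite normc_def; eexists.
have y0 : 0 < y by rewrite -ltcR -yE normr_gt0.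
pose B := K / y + s.
have N_ex (eps : R) : 0 < eps -> exists N, (x / T0) ^+ N * B < eps.
  move=> eps0; exists (Num.bound (`|B| / eps)); set N := Num.bound _.
  have BN : `|B| < eps * N%:R.
    by rewrite mulrC -ltr_pdivrMr// archi_boundP// divr_ge0// ltW.
  have N2 : N%:R <= (2 ^+ N) :> R by rewrite -natrX ler_nat ltnW// ltn_expl.
  have r0 : 0 <= (x / T0) ^+ N by rewrite exprn_ge0// divr_ge0// ltW.
  have r2 : (x / T0) ^+ N <= (2 ^+ N)^-1.
    rewrite -exprVn lerXn2r ?nnegrE ?divr_ge0 ?(ltW T0p) ?invr_ge0//.
    by rewrite ler_pdivrMr// mulrC.
  apply: (@le_lt_trans _ _ ((2 ^+ N)^-1 * `|B|)).
    by rewrite (le_trans (ler_wpM2l r0 (ler_norm B)))// ler_wpM2r.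
  rewrite mulrC ltr_pdivrMr ?exprn_gt0// (lt_le_trans BN)//.
  by rewrite ler_pM2l.
have FF : ProperFilter (@totally I) by exact: totally_filter.
apply/cvgrPdist_lt => eps eps0.
have epsE : eps = rc (complex.Re eps).
  by case: (eps) eps0 => u v; rewrite ltcE/= => /andP[/eqP-> _].
have [N HN] : exists N, (x / T0) ^+ N * B < complex.Re eps.
  by apply: N_ex; rewrite -ltcR -epsE.
exists (J N) => // A /fsubsetP JA.
set z := _ / _; pose St := (cpoly (S N)).[t].
have StE : St = \sum_(i <- J N) t ^+ a i.
  rewrite /St /cpoly rmorph_sum horner_sum; apply: eq_bigr => i _.
  by rewrite /= map_polyXn hornerXn.
have zS : `|z - St| <= rc ((x / T0) ^+ N * (K / y)).
  have -> : z - St = (cpoly (P - Q * S N)).[t] / (cpoly Q).[t].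
    rewrite /cpoly rmorphB rmorphM/= hornerD hornerN hornerM mulrBl.
    by rewrite [X in _ - X / _]mulrC mulfK.
  rewrite normrM normfV yE mulrA rmorphM/= fmorphV ler_wpM2r//.
    by rewrite invr_ge0 ler0c ltW.
  exact: approx_bound.
have SA : `|St - partial_sum ((fun i => t ^+ a i) \_ X) A| <= rc ((x / T0) ^+ N
  * s).
  have -> : partial_sum ((fun i => t ^+ a i) \_ X) A =
      St + \sum_(i <- A | (i \notin J N)) ((fun i => t ^+ a i) \_ X) i.
    rewrite /partial_sum -(big_seq_fsetE _ _ predT) /= (bigID (mem (J N)))/=.
    congr (_ + _); rewrite StE big_mem_swap ?fset_uniq//.
    rewrite big_seq_cond [RHS]big_seq; apply: congr_big => // i.
      by rewrite andb_idr// => /JA.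
    by move=> /andP[]; rewrite JP /patch => /andP[->].
  rewrite opprD addNKr normrN (le_trans (ler_norm_sum _ _ _))//.
  pose A' := [seq i <- A | i \in X].
  apply: (@le_trans _ _ (rc (\sum_(i <- A' | i \notin J N) x ^+ a i))).
    rewrite rmorph_sum big_filter_cond/= [leRHS]big_mkcond [leLHS]big_mkcond/=.
    apply: ler_sum => i _; rewrite /patch; case: (i \in X) => /=.
      by case: ifP => // _; rewrite normrX tx rmorphXn.
    by case: ifP => // _; rewrite (_ : point = 0)// normr0.
  rewrite lecR; apply: tail_le => //; first exact/filter_uniq/fset_uniq.
  by move=> i; rewrite mem_filter => /andP[/set_mem].
rewrite epsE; apply: (le_lt_trans (ler_distD St _ _)).
apply: (le_lt_trans (lerD zS SA)).
by rewrite -rmorphD/= ltcR -mulrDr.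
Qed.

End Family.

(** If [\sum_i T ^ (a i)] equals [P / Q] for small [T > 0], then the power series
    with these coefficients times [Q] is [P], so the complex series is [P / Q] as
    well; it converges unconditionally, its absolute values being bounded by the
    real series. *)
Theorem esum_partial_sum_cvg (I : choiceType) (X : set I) (a : I -> nat) P Q :
  ratf (fun T : R => \esum_(i in X) (T ^+ a i)%:E)%E P Q ->
  exists2 d : R, 0 < d & forall (x : R) (t : C), 0 <= x < d -> `|t| = rc x ->
    (cpoly Q).[t] != 0 /\
    partial_sum ((fun i => t ^+ a i) \_ X) @ totally --> (cpoly P).[t] / (cpoly
      Q).[t].
Proof.
move=> fPQ; have [Q0 [e e0 fE]] := fPQ.
pose T0 := e / 2; have Te : 0 < T0 < e by rewrite /T0; lra.
have sE : (\esum_(i in X) (T0 ^+ a i)%:E = (P.[T0] / Q.[T0])%:E)%E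
  by case: (fE _ Te).
have [T0p _] := andP Te.
pose A := (abs_poly Q).[T0].
have A0 : 0 <= A by rewrite (le_trans _ (@horner_abs_le Q 0 T0 _))// lexx ltW.
pose d := Num.min (T0 / 2) (T0 * `|Q.[0]| / (A + 1)).
have Qp : 0 < `|Q.[0]| by rewrite normr_gt0.
exists d; first by rewrite lt_min !divr_gt0 ?mulr_gt0//; lra.
move=> x t /andP[x0]; rewrite lt_min => /andP[xT xQ] tx.
have Qt0 : (cpoly Q).[t] != 0.
  apply: (Q_neq0 Te _ tx); first by rewrite x0/=; lra.
  rewrite mulrAC ltr_pdivrMr//.
  move: xQ; rewrite ltr_pdivlMr; last lra.
  by rewrite -/A; lra.
by split=> //; apply: (partial_sum_cvg Te fE sE _ tx) => //; rewrite x0 ltW.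
Qed.

End Transfer.

(** * The zeta functions near [s = 0] *)

Section ComplexPowers.
Context (R : realType).
Local Notation C := (Cplx R).
Local Notation rc := (real_complex R : R -> C).
Implicit Types (z w s : C).

Lemma CexpD z w : Cexp (z + w) = Cexp z * Cexp w.
Proof.
case: z => a b; case: w => c d; rewrite /Cexp /= expRD cosD sinD.
by apply/eqP; rewrite eq_complex/=; apply/andP; split; apply/eqP; ring.
Qed.

Lemma Cexp0 : Cexp (0 : C) = 1.
Proof. by rewrite /Cexp/= expR0 cos0 sin0 mulr1 mulr0. Qed.

Lemma normCexp z : `|Cexp z| = rc (expR (complex.Re z)).
Proof.
rewrite normc_def/=; congr rc.
rewrite !exprMn -mulrDr cos2Dsin2 mulr1 sqrtr_sqr ger0_norm//; exact: expR_ge0.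
Qed.

Lemma natCpowE (k : nat) s :
  natCpow k s = Cexp (Complex (complex.Re s * ln k%:R) (complex.Im s * ln
    k%:R)).
Proof. by case: s => a b; rewrite /natCpow; congr Cexp; simpc. Qed.

Lemma natCpow_exp (q k : nat) s : (0 < q)%N -> natCpow (q ^ k) s = natCpow q s
  ^+ k.
Proof.
move=> q0; rewrite /natCpow natrX lnXn ?ltr0n//.
have -> : Complex (ln q%:R *+ k) 0 = (Complex (ln q%:R) 0 : C) *+ k.
  by elim: k => [//|k IH]; rewrite !mulrS -IH; apply/eqP;
    rewrite eq_complex/= addr0 !eqxx.
rewrite mulrnAr; elim: k => [|k IH]; first by rewrite mulr0n Cexp0.
by rewrite mulrS CexpD IH exprS.
Qed.

Lemma norm_natCpow (q : nat) s :
  `|natCpow q s| = rc (expR (complex.Re s * ln q%:R)).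
Proof. by rewrite natCpowE normCexp. Qed.

Lemma natCpow_real (q : nat) (y : R) : natCpow q (rc y) = rc (expR (y * ln
  q%:R)).
Proof. by rewrite natCpowE /Cexp/= mul0r cos0 sin0 mulr1 mulr0. Qed.

Lemma cvg_Complex (T : Type) (F : set_system T) (FF : Filter F) (u v : T -> R)
  (a b : R) :
  u @ F --> a -> v @ F --> b ->
  (fun x => Complex (u x) (v x) : C) @ F --> (Complex a b : C).
Proof.
move=> ua vb; apply/cvgrPdist_lt => eps eps0.
have epsE : eps = rc (complex.Re eps).
  by case: (eps) eps0 => e1 e2; rewrite ltcE/= => /andP[/eqP-> _].
have e0 : 0 < complex.Re eps / 2 by rewrite divr_gt0// -ltcR -epsE.
near=> x.
have -> : (Complex a b : C) - Complex (u x) (v x) = rc (a - u x) + rc (b - v x)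
  * 'i%C.
  by simpc.
rewrite (le_lt_trans (ler_normD _ _))// normrM.
have -> : `|'i%C : C| = 1 by rewrite normc_def/= expr0n expr1n add0r sqrtr1.
rewrite mulr1 !normc_def/= expr0n !addr0 !sqrtr_sqr epsE -rmorphD/= ltcR.
rewrite [ltRHS]splitr ltrD//; near: x.
- by move/cvgrPdist_lt : ua; apply.
- by move/cvgrPdist_lt : vb; apply.
Unshelve. all: by end_near. Qed.

Lemma cvg_Re (a : C) : complex.Re s @[s --> a] --> complex.Re a.
Proof.
have FF : Filter (nbhs a) by exact: nbhs_filter.
apply/(cvgrPdist_lt (F := nbhs a)) => e e0.
have /(cvgrPdist_lt (F := nbhs a))/(_ (rc e)) : (id : C -> C) @ nbhs a --> a.
  exact: cvg_id.
rewrite ltcR => /(_ e0); apply: filterS => s; rewrite -ltcR; apply: le_lt_trans.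
by have := normc_ge_Re (a - s); rewrite raddfB.
Qed.

Lemma cvg_Im (a : C) : complex.Im s @[s --> a] --> complex.Im a.
Proof.
have FF : Filter (nbhs a) by exact: nbhs_filter.
apply/(cvgrPdist_lt (F := nbhs a)) => e e0.
have /(cvgrPdist_lt (F := nbhs a))/(_ (rc e)) : (id : C -> C) @ nbhs a --> a.
  exact: cvg_id.
rewrite ltcR => /(_ e0); apply: filterS => s; rewrite -ltcR; apply: le_lt_trans.
have := normc_ge_Re ((a - s) * 'i%C); rewrite ReiNIm normrN normrM.
have -> : `|'i%C : R[i]| = 1 by rewrite normc_def/= expr0n expr1n add0r sqrtr1.
by rewrite mulr1 raddfB.
Qed.

Variables (q : nat) (q1 : (1 < q)%N).

Let t s : C := natCpow q (- s).

Let lnq : 0 < ln q%:R :> R. Proof. by rewrite ln_gt0// ltr1n. Qed.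

Lemma natCpow_cvg1 : t s @[s --> (0 : C)] --> (1 : C).
Proof.
have -> : (1 : C) = Complex (expR (- 0 * ln q%:R) * cos (- 0 * ln q%:R))
    (expR (- 0 * ln q%:R) * sin (- 0 * ln q%:R)).
  by rewrite oppr0 mul0r expR0 cos0 sin0 mulr1 mulr0.
have -> : t = fun s => Complex
    (expR (- complex.Re s * ln q%:R) * cos (- complex.Im s * ln q%:R))
    (expR (- complex.Re s * ln q%:R) * sin (- complex.Im s * ln q%:R)).
  by apply/funext => s; rewrite /t natCpowE /Cexp/= !raddfN.
have cRe : - complex.Re s * ln q%:R @[s --> (0 : C)] --> - 0 * ln q%:R.
  exact: (cvgM (cvgN (@cvg_Re 0)) (cvg_cst _)).
have cIm : - complex.Im s * ln q%:R @[s --> (0 : C)] --> - 0 * ln q%:R.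
  exact: (cvgM (cvgN (@cvg_Im 0)) (cvg_cst _)).
have cE : expR (- complex.Re s * ln q%:R) @[s --> (0 : C)] --> expR (- 0 * ln
  q%:R).
  exact: (cvg_comp _ _ cRe (@continuous_expR R _)).
have cC : cos (- complex.Im s * ln q%:R) @[s --> (0 : C)] --> cos (- 0 * ln
  q%:R).
  exact: (cvg_comp _ _ cIm (@continuous_cos R _)).
have cS : sin (- complex.Im s * ln q%:R) @[s --> (0 : C)] --> sin (- 0 * ln
  q%:R).
  exact: (cvg_comp _ _ cIm (@continuous_sin R _)).
exact: (cvg_Complex _ (cvgM cE cC) (cvgM cE cS)).
Qed.

Lemma expR_polar_eq1 (x y : R) : `|y| < pi ->
  expR x * cos y = 1 -> expR x * sin y = 0 -> x = 0 /\ y = 0.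
Proof.
move=> y_pi E1 E2.
have sy : sin y = 0.
  by move/eqP: E2; rewrite mulf_eq0 gt_eqF ?expR_gt0//= => /eqP.
have y0 : y = 0.
  apply/eqP/negPn/negP => yN.
  have : 0 < sin `|y| by rewrite sin_gt0_pi// normr_gt0 yN.
  have [h|h] := leP 0 y; first by rewrite ger0_norm// sy ltxx.
  by rewrite ltr0_norm// sinN sy oppr0 ltxx.
by split=> //; move: E1; rewrite y0 cos0 mulr1 -expR0 => /expR_inj.
Qed.

(** [s = 0] is isolated among the solutions of [q ^ (- s) = 1], which are the
    multiples of [2 i pi / ln q]. *)
Lemma natCpow_neq1 : \forall s \near (0 : C)^', t s != 1.
Proof.
have cIm : - complex.Im s * ln q%:R @[s --> (0 : C)] --> - 0 * ln q%:R.
  exact: (cvgM (cvgN (@cvg_Im 0)) (cvg_cst _)).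
move/cvgrPdist_lt : cIm => /(_ pi (pi_gt0 R)).
rewrite /dnbhs /within/=; apply: filterS => s; rewrite oppr0 mul0r sub0r normrN.
move=> Im_small s0; apply/eqP => ts1; move/eqP: s0; apply.
move: ts1; rewrite /t natCpowE /Cexp/= !raddfN.
move=> [E1 E2]; have [re0 im0] := expR_polar_eq1 Im_small E1 E2.
have nz (a : R) : - a * ln q%:R = 0 -> a = 0.
  by move/eqP; rewrite mulf_eq0 oppr_eq0 (gt_eqF lnq) orbF => /eqP.
by case: s {Im_small E1 E2} re0 im0 => a b /= /nz-> /nz->.
Qed.

Lemma cvg_horner (G : {poly C}) (T : Type) (F : set_system T) (FF : Filter F)
    (u : T -> C) (z : C) : u @ F --> z -> G.[u x] @[x --> F] --> G.[z].
Proof.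
move=> uz; elim/poly_ind: G => [|G c IH].
  have -> : (fun x => (0 : {poly C}).[u x]) = cst (0 : C) by apply/funext =>
    x; rewrite horner0.
  by rewrite horner0; exact: cvg_cst.
have -> : (fun x => (G * 'X + c%:P).[u x]) = fun x => G.[u x] * u x + c.
  by apply/funext => x; rewrite hornerMXaddC.
rewrite hornerMXaddC; exact: (cvgD (cvgM IH uz) (cvg_cst _)).
Qed.

Lemma horner_natCpow_cvg (G : {poly C}) : G.[t s] @[s --> (0 : C)^'] --> G.[1].
Proof. by apply: cvg_horner; apply: cvg_within_filter; exact: natCpow_cvg1. Qed.

(** Zeros of [G] other than [1] are avoided because [q ^ (- s)] tends to [1], and
    [1] itself because [s <> 0]. *)
Lemma horner_natCpow_neq0 (G : {poly C}) : G != 0 ->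
  \forall s \near (0 : C)^', G.[t s] != 0.
Proof.
move=> G0; have [k [H H1 GE]] := multiplicity_XsubC G 1.
have {}H1 : H.[1] != 0 by move: H1; rewrite G0.
have tH := @horner_natCpow_cvg H.
near=> s.
rewrite GE hornerM mulf_neq0//.
  near: s; move/cvgrPdist_lt : tH => /(_ `|H.[1]|).
  rewrite normr_gt0 => /(_ H1); apply: filterS => s.
  by apply: contraTneq => ->; rewrite subr0 ltxx.
rewrite horner_exp hornerXsubC expf_neq0// subr_eq0.
near: s; exact: natCpow_neq1.
Unshelve. all: by end_near. Qed.


Section ZetaOfRatf.
Context (M : zmodType) (X : set (set M)) (a : set M -> nat) (P Q : {poly R}).
Hypothesis Xa : forall N, X N -> coset_index N = (q ^ a N)%N.
Hypothesis fPQ : ratf (fun T : R => \esum_(N in X) (T ^+ a N)%:E)%E P Q.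

Let Z s : C := (cpoly P).[t s] / (cpoly Q).[t s].

Let cQ0 : cpoly Q != 0.
Proof.
rewrite map_poly_eq0; case: fPQ => Q0 _.
by apply: contraNneq Q0 => ->; rewrite horner0.
Qed.

Let zeta_sumE s :
  (fun N => natCpow (coset_index N) (- s)) \_ X = (fun N => t s ^+ a N) \_ X.
Proof.
apply/funext => N; rewrite /patch; case: ifP => // /set_mem XN.
by rewrite (Xa XN) natCpow_exp// ltnW.
Qed.

Let zeta_half_plane : exists2 sigma : R, 0 < sigma & forall s, sigma <
  complex.Re s ->
  zeta_sum X s (Z s).
Proof.
have [d d0 dP] := esum_partial_sum_cvg fPQ.
exists (Num.max 1 (- ln d / ln q%:R)); first by rewrite lt_max ltr01.
move=> s; rewrite gt_max => /andP[_].
rewrite ltr_pdivrMr// => ds.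
have tx : `|t s| = rc (expR (- complex.Re s * ln q%:R)).
  by rewrite /t norm_natCpow raddfN.
have xd : 0 <= expR (- complex.Re s * ln q%:R) < d.
  by rewrite expR_ge0/= mulNr -[ltRHS]lnK ?posrE// ltr_expR ltrNl.
by have [_] := dP _ _ xd tx; rewrite /zeta_sum zeta_sumE.
Qed.

(** For large [Re s] the point [q ^ (- s)] is in the disc of convergence. *)
Lemma is_zeta_ratf : is_zeta q X Z.
Proof.
split; first by exists (cpoly P), (cpoly Q); split.
by have [sigma _ H] := zeta_half_plane; exists sigma.
Qed.

(** Two rational functions of [q ^ (- s)] which agree on a half-plane are
    equal, so the meromorphic continuation is determined. *)
Lemma is_zeta_unique (Y : C -> C) : is_zeta q X Y -> \forall s \near (0 : C)^',
  Y s = Z s.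
Proof.
move=> [[P' [Q' [Q'0 YE]]] [sigma' Ysum]].
have [sigma s0 Zsum] := zeta_half_plane.
pose m := Num.max sigma sigma'.
have PQ : P' * cpoly Q = cpoly P * Q'.
  pose G := (P' * cpoly Q - cpoly P * Q') * (Q' * cpoly Q).
  suff : G = 0.
    move=> /eqP; rewrite mulf_eq0 [X in _ || X]mulf_eq0 (negPf Q'0) (negPf cQ0)
      !orbF.
    by rewrite subr_eq0 => /eqP.
  apply: (@poly_eq0_small R _ (real_complex R) _ (expR (- m * ln q%:R))).
    exact: expR_gt0.
  move=> x /andP[x0 xe]; pose s : C := rc (- ln x / ln q%:R).
  have ts : t s = rc x.
    by rewrite /t -rmorphN/= natCpow_real !mulNr opprK divfK ?gt_eqF// lnK.
  have : m < complex.Re s.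
    by rewrite /= ltr_pdivlMr// ltrNr -ltr_expR lnK ?posrE// -mulNr.
  rewrite gt_max => /andP[sm1 sm2].
  rewrite /G 2!hornerM; have [->|Qx] := eqVneq (cpoly Q).[rc x] 0.
    by rewrite !mulr0.
  have [->|Q'x] := eqVneq Q'.[rc x] 0; first by rewrite mul0r mulr0.
  have FF : ProperFilter (@totally (set M)) by exact: totally_filter.
  have : Y s = Z s by exact: (cvg_unique _ (Ysum s sm2) (Zsum s sm1)).
  rewrite YE -/(t s) ts// /Z ts => /eqP; rewrite eqr_div// => /eqP YZ.
  by rewrite hornerD hornerN !hornerM YZ subrr mul0r.
have QQ0 : Q' * cpoly Q != 0 by rewrite mulf_neq0.
apply: filterS (horner_natCpow_neq0 QQ0) => s.
rewrite hornerM mulf_eq0 negb_or => /andP[Q's Qs].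
rewrite YE// /Z; apply/eqP; rewrite eqr_div// -!hornerM PQ.
by [].
Qed.

End ZetaOfRatf.

End ComplexPowers.

(** * Symmetric tensors *)

Section Tensors.
Context (o : comNzRingType) (m n : nat).
Local Notation word := {ffun 'I_m -> 'I_n}.
Implicit Types (B : word -> o) (w : word) (G H : 'I_m -> 'M[o]_n).

(** [B] is a tensor with coordinates indexed by words, acted upon by the matrix
    [G k] at position [k]. *)
Definition tensor_act G B w' : o := \sum_w B w * \prod_k G k (w k) (w' k).

Lemma tensor_actM G H B : tensor_act H (tensor_act G B) =1
  tensor_act (fun k => G k *m H k) B.
Proof.
move=> w''; rewrite /tensor_act.
under eq_bigr do rewrite mulr_suml.
rewrite exchange_big/=; apply: eq_bigr => w _.
under eq_bigr do rewrite -mulrA -big_split/=.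
rewrite -mulr_sumr; congr (_ * _).
rewrite -(bigA_distr_bigA (fun k j => G k (w k) j * H k j (w'' k))).
by apply: eq_bigr => k _; rewrite mxE.
Qed.

Lemma tensor_act1 B : tensor_act (fun=> 1%:M) B =1 B.
Proof.
move=> w'; rewrite /tensor_act (bigD1 w')//= [X in _ + X]big1 ?addr0.
  by rewrite big1 ?mulr1// => k _; rewrite mxE eqxx.
move=> w ww'; have [k kP] : exists k, w k != w' k.
  by apply/existsP; apply: contraR ww' => /existsPn H; apply/eqP/ffunP => k;
     apply/eqP/negPn/H.
by rewrite (bigD1 k)//= mxE (negPf kP) mul0r mulr0.
Qed.

Lemma tensor_act_perm g B (s : 'S_m) :
  (forall w, B [ffun k => w (s k)] = B w) ->
  forall w', tensor_act (fun=> g) B [ffun k => w' (s k)] = tensor_act (fun=>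
    g) B w'.
Proof.
move=> Bs w'; rewrite /tensor_act.
have sI : injective (fun w : word => [ffun k => w (s k)] : word).
  move=> w1 w2 /ffunP E; apply/ffunP => k.
  by have := E ((s^-1)%g k); rewrite !ffunE permKV.
rewrite (reindex_inj sI)/=; apply: eq_bigr => w _; rewrite Bs; congr (_ * _).
rewrite [RHS](reindex_inj (@perm_inj _ s))/=.
by apply: eq_bigr => k _; rewrite !ffunE.
Qed.

Definition upd w k i : word := [ffun k' => if k' == k then i else w k'].

(** Acting by [g] at a single position contracts that position. *)
Lemma tensor_act_at k0 g B w' :
  tensor_act (fun k => if k == k0 then g else 1%:M) B w' =
  \sum_i B (upd w' k0 i) * g i (w' k0).
Proof.
rewrite /tensor_act (bigID (fun w => upd w' k0 (w k0) == w))/= [X in _ + X]big1.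
  rewrite addr0 (reindex_onto (upd w' k0) (fun w => w k0)) => [|w /eqP//].
  apply: eq_big => [i|i _]; first by rewrite !ffunE eqxx !eqxx.
  congr (_ * _); rewrite (bigD1 k0)//= big1 ?mulr1;
    first by rewrite !ffunE !eqxx.
  by move=> k kk0; rewrite (negPf kk0) ffunE (negPf kk0) mxE eqxx.
move=> w wN; have [k] : exists k, upd w' k0 (w k0) k != w k.
  by apply/existsP; apply: contraR wN => /existsPn H; apply/eqP/ffunP => k;
     apply/eqP/negPn/H.
rewrite ffunE; have [->|kk0 kP] := eqVneq k k0; first by rewrite eqxx.
by rewrite (bigD1 k)//= (negPf kk0) mxE eq_sym (negPf kP) mul0r mulr0.
Qed.

End Tensors.

Section TensorDivisibility.
Context (o : idomainType) (p : o) (m n : nat) (l : 'I_n -> nat).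
Local Notation word := {ffun 'I_m -> 'I_n}.

Lemma pdvd_tensor_act (k0 : 'I_m) (G : 'I_m -> 'M[o]_n) (A : word -> o) :
  G k0 = 1%:M -> (forall w : word, pdvd p (l (w k0)) (A w)) ->
  forall w' : word, pdvd p (l (w' k0)) (tensor_act G A w').
Proof.
move=> G1 Al w'; apply: pdvd_sum => w _; rewrite (bigD1 k0)//= G1 mxE.
have [<-|_] := eqVneq (w k0) (w' k0); first exact: pdvdMr.
by rewrite mul0r mulr0; exact: pdvd0.
Qed.

(** Contracting position [k0] with the columns of [g] is acting by [g] at [k0]
    only. The action of [g], or of its inverse, at the other positions goes between
    this and the action of [g] at all positions, and it combines only coordinates
    with the same letter at [k0]. *)
Lemma tensor_act_cond (k0 : 'I_m) (g : 'M[o]_n) (B : word -> o) : g \in unitmx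
  ->
  (forall w : word, pdvd p (l (w k0)) (\sum_i B (upd w k0 i) * g i (w k0))) <->
  (forall w : word, pdvd p (l (w k0)) (tensor_act (fun=> g) B w)).
Proof.
move=> gU; split=> H w.
  have -> : tensor_act (fun=> g) B w =
      tensor_act (fun k => if k == k0 then 1%:M else g)
        (tensor_act (fun k => if k == k0 then g else 1%:M) B) w.
    rewrite tensor_actM /tensor_act; apply: eq_bigr => w1 _; congr (_ * _).
    by apply: eq_bigr => k _; case: ifP; rewrite ?mulmx1 ?mul1mx.
  apply: pdvd_tensor_act => [|w1]; first by rewrite eqxx.
  by rewrite tensor_act_at.
rewrite -tensor_act_at.
have -> : tensor_act (fun k => if k == k0 then g else 1%:M) B w =
    tensor_act (fun k => if k == k0 then 1%:M else invmx g)
      (tensor_act (fun=> g) B) w.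
  rewrite tensor_actM /tensor_act; apply: eq_bigr => w1 _; congr (_ * _).
  by apply: eq_bigr => k _; case: ifP; rewrite ?mulmx1 ?mulmxV.
by apply: pdvd_tensor_act => //; rewrite eqxx.
Qed.

End TensorDivisibility.

(** * Multi-indices as contents of words *)

Section Contents.
Context (m n : nat).
Local Notation word := {ffun 'I_m -> 'I_n}.

(** The content of the word [w]: the multiplicities of its letters. *)
Definition cnt (w : word) i : nat := \sum_k (w k == i)%N.

Lemma sum_cnt w : (\sum_i cnt w i = m)%N.
Proof.
rewrite /cnt exchange_big/= (eq_bigr (fun=> 1%N)) ?sum1_card ?card_ord// => k _.
rewrite (bigD1 (w k))//= eqxx big1 ?addn0// => i.
by rewrite eq_sym => /negPf ->.
Qed.

Lemma cnt_count w i : cnt w i = count_mem i [tuple w k | k < m].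
Proof.
rewrite /cnt /= count_map enumT -sumn_count sumnE big_map.
by apply: eq_bigr.
Qed.

Lemma cnt_perm w w' : cnt w =1 cnt w' -> exists s : 'S_m, w = [ffun k =>
  w' (s k)].
Proof.
move=> E; have /tuple_permP[s sE] :
    perm_eq [tuple w k | k < m] [tuple w' k | k < m].
  by apply/allP => i _ /=; rewrite -!cnt_count E.
exists s; apply/ffunP => k; rewrite ffunE.
have /(congr1 (fun t : m.-tuple 'I_n => tnth t k)) : [tuple w k | k < m] =
    [tuple tnth [tuple w' k | k < m] (s i) | i < m] by apply/val_inj.
by rewrite !tnth_mktuple.
Qed.

Lemma cnt_surj (c : 'I_n -> nat) : (\sum_i c i = m)%N -> exists w, cnt w =1 c.
Proof.
move=> cm; pose s := flatten [seq nseq (c i) i | i <- enum 'I_n].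
have sm : size s == m.
  rewrite size_flatten /shape -map_comp sumnE big_map big_enum -cm /=.
  by apply/eqP; apply: eq_bigr => i _; rewrite size_nseq.
exists [ffun k => tnth (Tuple sm) k] => i.
rewrite cnt_count; have -> : [tuple [ffun k => tnth (Tuple sm) k] k | k < m] =
  Tuple sm.
  by apply: eq_from_tnth => k; rewrite tnth_mktuple ffunE.
rewrite /= count_flatten -map_comp sumnE big_map big_enum/= (bigD1 i)//=.
rewrite count_nseq /= eqxx mul1n big1 ?addn0// => j ji.
by rewrite count_nseq/= (negPf ji).
Qed.

End Contents.

(** * The centralizer condition in [L_{m,n}] *)

Section Indices.
Context (m n : nat).
Local Notation multiE := (multiE m.+1 n).
Local Notation multiF := (multiF m.+1 n).
Implicit Types (e : multiE) (f : multiF) (i : 'I_n).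

Lemma multiF_ex (c : 'I_n -> nat) : (\sum_i c i = m.+1)%N ->
  exists f, forall i, val f i = c i :> nat.
Proof.
move=> cm; have cP i : (c i < m.+2)%N by rewrite ltnS -cm (bigD1 i)//= leq_addr.
pose f0 : {ffun 'I_n -> 'I_m.+2} := [ffun i => Ordinal (cP i)].
have f0P : (\sum_i f0 i == m.+1)%N.
  apply/eqP; transitivity (\sum_i c i)%N; last exact: cm.
  by apply: eq_bigr => i _; rewrite ffunE.
by exists (exist _ f0 f0P) => i; rewrite /= ffunE.
Qed.

Lemma multiE_ex (c : 'I_n -> nat) : (\sum_i c i = m)%N ->
  exists e, forall i, val e i = c i :> nat.
Proof.
move=> cm; have cP i : (c i < m.+1)%N by rewrite ltnS -cm (bigD1 i)//= leq_addr.
pose f0 : {ffun 'I_n -> 'I_m.+1} := [ffun i => Ordinal (cP i)].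
have f0P : (\sum_i f0 i == m.+1.-1)%N.
  apply/eqP; transitivity (\sum_i c i)%N; last exact: cm.
  by apply: eq_bigr => i _; rewrite ffunE.
by exists (exist _ f0 f0P) => i; rewrite /= ffunE.
Qed.

Lemma multiF_inj f f' : (forall i, val f i = val f' i :> nat) -> f = f'.
Proof. by move=> H; apply/val_inj/ffunP => i; apply/val_inj/H. Qed.

Lemma multiE_inj e e' : (forall i, val e i = val e' i :> nat) -> e = e'.
Proof. by move=> H; apply/val_inj/ffunP => i; apply/val_inj/H. Qed.

Lemma sum_multiF f : (\sum_i val f i = m.+1)%N.
Proof. by case: f => f /= /eqP. Qed.

Lemma sum_multiE e : (\sum_i val e i = m)%N.
Proof. by case: e => e /= /eqP. Qed.

Lemma unit_stepP e f i :
  reflect (forall j, val f j = (val e j + (j == i))%N :> nat) (unit_step e f i).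
Proof. by apply: (iffP forallP) => H j; have /eqP := H j. Qed.

Lemma sum_delta_nat (c : 'I_n -> nat) i :
  (\sum_j (c j + (j == i)) = (\sum_j c j).+1)%N.
Proof.
rewrite big_split/= -[RHS]addn1; congr (_ + _)%N.
by rewrite (bigD1 i)//= eqxx big1// => j /negPf ->.
Qed.

Lemma unit_step_ex e i : exists f, unit_step e f i.
Proof.
have [|f fE] := @multiF_ex (fun j => val e j + (j == i))%N.
  by rewrite sum_delta_nat sum_multiE.
by exists f; apply/unit_stepP.
Qed.

Lemma unit_step_injF e f f' i : unit_step e f i -> unit_step e f' i -> f = f'.
Proof.
by move=> /unit_stepP E /unit_stepP E'; apply: multiF_inj => j; rewrite E E'.
Qed.

Lemma unit_step_injE e e' f i : unit_step e f i -> unit_step e' f i -> e = e'.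
Proof.
move=> /unit_stepP E /unit_stepP E'; apply: multiE_inj => j.
by apply/eqP; rewrite -(eqn_add2r (j == i)) -E E'.
Qed.

Definition content (w : {ffun 'I_m.+1 -> 'I_n}) : multiF :=
  sval (cid (multiF_ex (sum_cnt w))).

Lemma contentE w i : val (content w) i = cnt w i :> nat.
Proof. by rewrite /content; case: cid. Qed.

Lemma content_surj f : exists w, content w = f.
Proof.
have [w wE] := cnt_surj (sum_multiF f); exists w.
by apply: multiF_inj => i; rewrite contentE wE.
Qed.

(** Take for [e] the content of [w] without its letter at [k0]. *)
Lemma unit_step_content_ex (w : {ffun 'I_m.+1 -> 'I_n}) k0 :
  exists e, forall i, unit_step e (content (upd w k0 i)) i.
Proof.
pose c i := (\sum_(k | k != k0) (w k == i))%N.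
have cm : (\sum_i c i = m)%N.
  apply/eqP; rewrite -eqSS -[X in _ == X](sum_cnt w) -(sum_delta_nat c (w k0)).
  apply/eqP/eq_bigr => i _; rewrite /cnt (bigD1 k0)//= addnC eq_sym.
  by [].
have [e eE] := multiE_ex cm; exists e => i; apply/unit_stepP => j.
rewrite contentE eE /cnt (bigD1 k0)//= ffunE eqxx addnC eq_sym; congr (_ + _)%N.
by apply: eq_bigr => k kk0; rewrite ffunE (negPf kk0).
Qed.

Lemma unit_step_content_surj e : (0 < n)%N -> exists w : {ffun 'I_m.+1 -> 'I_n},
  forall i, unit_step e (content (upd w ord0 i)) i.
Proof.
move=> n0; have [v vE] := cnt_surj (sum_multiE e).
pose w : {ffun 'I_m.+1 -> 'I_n} :=
  [ffun k => if unlift ord0 k is Some k' then v k' else Ordinal n0].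
exists w => i; apply/unit_stepP => j.
rewrite contentE -vE /cnt big_ord_recl ffunE eqxx addnC eq_sym; congr (_ + _)%N.
by apply: eq_bigr => k _; rewrite !ffunE/= liftK.
Qed.

Lemma content_gt0 w k : (0 < val (content w) (w k))%N.
Proof. by rewrite contentE /cnt (bigD1 k)//= eqxx. Qed.

Lemma content_gt0P w i : (0 < val (content w) i)%N -> exists k, w k = i.
Proof.
rewrite contentE /cnt; case: (pickP (fun k => w k == i)) => [k /eqP|no];
  first by exists k.
by rewrite big1// => k _; rewrite no.
Qed.

End Indices.

Section Contractions.
Context (o : idomainType) (p : o) (q : nat) (Hp : finite_dvr p q) (m n : nat).
Hypothesis n0 : (0 < n)%N.
Local Notation multiE := (multiE m.+1 n).
Local Notation multiF := (multiF m.+1 n).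
Local Notation pdvd := (pdvd p).

(** [contractE a f] and [- contractF b e] are the components along [z_1, ..., z_n]
    of the brackets of [\sum_e a e *: x_e] with [y_f] and of [\sum_f b f *: y_f]
    with [x_e]. *)
Definition contractE (a : multiE -> o) (f : multiF) : 'rV[o]_n :=
  \row_i \sum_(e | unit_step e f i) a e.

Definition contractF (b : multiF -> o) (e : multiE) : 'rV[o]_n :=
  \row_i \sum_(f | unit_step e f i) b f.

Lemma contractF_step (b : multiF -> o) e f i : unit_step e f i ->
  contractF b e 0 i = b f.
Proof.
move=> ef; rewrite mxE (bigD1 f)//= big1 ?addr0// => f' /andP[ef' /eqP].
by rewrite (unit_step_injF ef' ef).
Qed.

Lemma contractE_step (a : multiE -> o) e f i : unit_step e f i ->
  contractE a f 0 i = a e.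
Proof.
move=> ef; rewrite mxE (bigD1 e)//= big1 ?addr0// => e' /andP[ef' /eqP].
by rewrite (unit_step_injE ef' ef).
Qed.

Lemma unit_column (g : 'M[o]_n) j : g \in unitmx -> exists i, g i j \is a
  GRing.unit.
Proof.
move=> gU; apply: contrapT => H.
have : pdvd 1 ((invmx g *m g) j j).
  rewrite mxE; apply: pdvd_sum => i _; apply/pdvdMl/(nonunitP Hp)/negP => gi.
  by apply: H; exists i.
by rewrite mulVmx// mxE eqxx => /(pdvd_unitF Hp (unitr1 _)).
Qed.

(** View [a] as the polynomial [\sum_e a e X ^ e]. The hypothesis says that its
    product with the linear form given by the [j]-th column of [g] is divisible by
    [p ^ l j]. This form is primitive, so as in Gauss' lemma the polynomial itself
    is divisible: if the coefficient [i0] of the form is a unit, one argues on the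
    coefficients [a e] by decreasing degree in [X_i0]. *)
Lemma contractE_cond (l : 'I_n -> nat) (g : 'M[o]_n) (a : multiE -> o) :
  g \in unitmx ->
  (forall f j, pdvd (l j) ((contractE a f *m g) 0 j)) <->
  (forall e, pdvd (\max_j l j)%N (a e)).
Proof.
move=> gU; split=> H; last first.
  move=> f j; apply: (pdvd_leq (leq_bigmax j)).
  rewrite mxE; apply: pdvd_sum => i _; apply: pdvdMr.
  by rewrite mxE; apply: pdvd_sum.
have [|j0 jE] := bigop.eq_bigmax l; first by rewrite card_ord.
rewrite jE; have [i0 gi0] := unit_column j0 gU.
suff main N (e : multiE) : (m.+1 <= val e i0 + N)%N -> pdvd (l j0) (a e).
  by move=> e; apply: (main m.+1); rewrite leq_addl.
elim: N e => [|N IH] e.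
  by rewrite addn0 leqNgt ltn_ord.
move=> eN; have [f ef] := unit_step_ex e i0.
have := H f j0; rewrite mxE (bigD1 i0)//= (contractE_step a ef).
move=> h; have : pdvd (l j0) (\sum_(i < n | i != i0) contractE a f 0 i * g i
  j0).
  apply: pdvd_sum => i ii0; apply: pdvdMr; rewrite mxE;
    apply: pdvd_sum => e' e'f.
  apply: IH; have /unit_stepP/(_ i0) := e'f; have /unit_stepP/(_ i0) -> := ef.
  by rewrite eqxx eq_sym (negPf ii0); lia.
by move=> /(pdvdB h); rewrite addrK mulrC; exact: pdvd_unitl gi0.
Qed.

Lemma pdvd_bigmax (I : finType) (P : pred I) (l : I -> nat) (x : o) :
  (forall i, P i -> pdvd (l i) x) -> pdvd (\max_(i | P i) l i)%N x.
Proof.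
move=> H; elim/big_ind: _ => //; first exact: pdvd_0.
by move=> i j di dj; rewrite /maxn; case: ifP.
Qed.

(** The function [b] on multi-indices is a symmetric tensor [b \o content], and [g]
    acts on symmetric tensors; this gives the coordinates of [b] in the basis dual
    to the monomials in the linear forms given by the columns of [g]. *)
Definition act_symm (g : 'M[o]_n) (b : multiF -> o) (f : multiF) : o :=
  tensor_act (fun=> g) (b \o @content m n) (sval (cid (content_surj f))).

Lemma act_symm_content g b w :
  act_symm g b (content w) = tensor_act (fun=> g) (b \o @content m n) w.
Proof.
rewrite /act_symm; case: cid => w' /= ww'.
have [|s ->] := @cnt_perm _ _ w' w; first by move=> i; rewrite -!contentE ww'.
apply: tensor_act_perm => w1 /=; congr b; apply: multiF_inj => i.
rewrite !contentE /cnt [RHS](reindex_inj (@perm_inj _ s))/=.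
by apply: eq_bigr => k _; rewrite ffunE.
Qed.

Lemma act_symmK g h : g *m h = 1%:M -> cancel (act_symm g) (act_symm h).
Proof.
move=> gh b; apply/funext => f; have [w <-] := content_surj f.
rewrite act_symm_content.
transitivity (tensor_act (fun=> h) (tensor_act (fun=>
  g) (b \o @content m n)) w).
  by apply: eq_bigr => w' _ /=; rewrite act_symm_content.
rewrite tensor_actM -[RHS]/((b \o @content m n) w) -[RHS]tensor_act1.
by rewrite gh.
Qed.

Lemma act_symmB g b b' : act_symm g (fun f => b f - b' f) =
  fun f => act_symm g b f - act_symm g b' f.
Proof.
apply/funext => f; rewrite /act_symm /tensor_act -sumrB.
by apply: eq_bigr => w _; rewrite /= mulrBl.
Qed.

(** In the coordinates adapted to [g] the conditions become independent: the [f]-th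
    coordinate is divisible by [p ^ l j] for each [j] involved in [f]. *)
Lemma contractF_cond (l : 'I_n -> nat) (g : 'M[o]_n) (b : multiF -> o) :
  g \in unitmx ->
  (forall e j, pdvd (l j) ((contractF b e *m g) 0 j)) <->
  (forall f : multiF, pdvd (\max_(j | (0 < val f j)%N) l j)%N (act_symm g b f)).
Proof.
move=> gU.
have contractE' e (w : {ffun 'I_m.+1 -> 'I_n}) k0 :
    (forall i, unit_step e (content (upd w k0 i)) i) -> forall j,
    (contractF b e *m g) 0 j = \sum_i (b \o @content m n) (upd w k0 i) * g i j.
  move=> ew j; rewrite mxE; apply: eq_bigr => i _; congr (_ * _).
  exact: contractF_step.
split=> [H f|H e j].
  have [w <-] := content_surj f; rewrite act_symm_content.
  have wk k : pdvd (l (w k)) (tensor_act (fun=> g) (b \o @content m n) w).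
    apply: (@tensor_act_cond o p m.+1 n l k g (b \o @content m n) gU).1 => w'.
    have [e ew] := unit_step_content_ex w' k.
    by rewrite -(contractE' e w' k ew).
  by apply: pdvd_bigmax => j /content_gt0P[k <-].
have [w ew] := unit_step_content_surj e n0.
pose w' := upd w ord0 j.
have ew' i : unit_step e (content (upd w' ord0 i)) i.
  suff -> : upd w' ord0 i = upd w ord0 i by [].
  by apply/ffunP => k; rewrite !ffunE; case: eqP.
rewrite (contractE' _ _ _ ew').
have w'0 : w' ord0 = j by rewrite ffunE eqxx.
have := (@tensor_act_cond o p m.+1 n l ord0 g (b \o @content m n) gU).2 _ w'.
rewrite w'0; apply => w1.
rewrite -act_symm_content; apply: pdvd_leq (H _).
exact: (@bigop.leq_bigmax_cond _ (fun j => (0 < val (content w1) j)%N) l _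
  (content_gt0 w1 ord0)).
Qed.

End Contractions.

Lemma card_compositions n k :
  #|[pred f : {ffun 'I_n.+1 -> 'I_k.+1} | (\sum_i f i == k)%N]| = 'C(n + k, n).
Proof.
rewrite -card_ord_partitions.
pose t (f : {ffun 'I_n.+1 -> 'I_k.+1}) := [tuple f i | i < n.+1].
have tI : injective t.
  move=> f f' E; apply/ffunP => i.
  by have := congr1 (fun s => tnth s i) E; rewrite !tnth_mktuple.
rewrite -(card_imset _ tI); apply: eq_card => s; rewrite inE.
apply/imsetP/idP => [[f /eqP fk ->]|/eqP sk].
  by rewrite big_tuple; apply/eqP; rewrite -[RHS]fk; apply: eq_bigr => i _;
    rewrite tnth_mktuple.
exists [ffun i => tnth s i]; last by apply: eq_from_tnth => i;
  rewrite tnth_mktuple ffunE.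
rewrite inE; apply/eqP; rewrite -[RHS]sk big_tuple; apply: eq_bigr => i _.
by rewrite ffunE.
Qed.

Lemma card_multiE m n : (0 < m)%N -> (0 < n)%N -> #|multiE m n| = emn m n.
Proof.
case: m n => [//|m] [//|n] _ _; rewrite card_sig.
rewrite (eq_card (B := [pred f : {ffun 'I_n.+1 -> 'I_m.+1} | (\sum_i f i ==
  m)%N])).
  by rewrite card_compositions /emn; congr 'C(_, _); lia.
by move=> f.
Qed.

Lemma card_multiF m n : (0 < n)%N -> #|multiF m n| = fmn m n.
Proof.
case: n => [//|n] _; rewrite card_sig.
rewrite (eq_card (B := [pred f : {ffun 'I_n.+1 -> 'I_m.+1} | (\sum_i f i ==
  m)%N])).
  by rewrite card_compositions /fmn; congr 'C(_, _); lia.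
by move=> f.
Qed.

Lemma sum_ltn_nat K x : (x <= K)%N -> (\sum_(k < K) (k < x) = x)%N.
Proof.
elim: K x => [|K IH] x; first by rewrite leqn0 big_ord0 => /eqP.
rewrite big_ord_recr/= leq_eqVlt => /orP[/eqP ->|xK].
  rewrite ltnSn (eq_bigr (fun=> 1%N)) => [|i _].
    by rewrite sum1_card card_ord addn1.
  by rewrite ltnS ltnW.
by rewrite IH// ltnNge -ltnS xK addn0.
Qed.

(** An up-closed set of indices is determined by its cardinality. *)
Lemma card_upset n (A : pred 'I_n) :
  (forall i j : 'I_n, (i <= j)%N -> A i -> A j) ->
  forall i, A i = (n - #|[pred j | A j]| <= i)%N.
Proof.
move=> AU i.
have card_ge (x : nat) : (x <= n)%N -> #|[pred j : 'I_n | (x <= j)%N]| = (n -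
  x)%N.
  move=> xn; rewrite card_pred_sum.
  have := sum_ltn_nat xn; have : (\sum_(k < n) ((k < x) + (x <= k)) = n)%N.
    rewrite (eq_bigr (fun=> 1%N)) ?sum1_card ?card_ord// => k _.
    by case: ltnP.
  by rewrite big_split/=; lia.
have cn : (#|[pred j | A j]| <= n)%N by rewrite -[X in (_ <= X)%N]card_ord
  max_card.
have inn := ltn_ord i.
apply/idP/idP => [Ai|].
  have : (#|[pred j : 'I_n | (i <= j)%N]| <= #|[pred j | A j]|)%N.
    by apply/fintype.subset_leq_card/fintype.subsetP => j; rewrite !inE => ij;
      exact: AU Ai.
  by rewrite (card_ge i (ltnW inn)); lia.
apply: contraTT => Ai; rewrite -ltnNge.
have : (#|[pred j | A j]| <= #|[pred j : 'I_n | (i.+1 <= j)%N]|)%N.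
  apply/fintype.subset_leq_card/fintype.subsetP => j; rewrite !inE => Aj;
    rewrite ltnNge.
  by apply: contra Ai => ji; exact: AU Aj.
by rewrite card_ge//; lia.
Qed.

Section Centralizer.
Context (o : idomainType) (p : o) (q : nat) (Hp : finite_dvr p q) (m n : nat).
Hypothesis n0 : (0 < n)%N.
Local Notation multiE := (multiE m.+1 n).
Local Notation multiF := (multiF m.+1 n).
Local Notation pdvd := (pdvd p).
Local Notation lattice := (lattice p).
Local Notation diag_lattice := (diag_lattice p).
Local Notation vol := (vol q).
Local Notation D := (multiE + multiF)%type.

Definition rankD : nat := #|{: D}|.

Lemma rankD_dmn : rankD = dmn m.+1 n.
Proof. by rewrite /rankD card_sum card_multiE// card_multiF. Qed.

Definition coordE (x : 'rV[o]_rankD) (e : multiE) : o := x 0 (enum_rank (inl e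
  : D)).
Definition coordF (x : 'rV[o]_rankD) (f : multiF) : o := x 0 (enum_rank (inr f
  : D)).

(** The elements of [o ^ d] whose brackets all lie in [M]. *)
Definition centralizer (M : set 'rV[o]_n) : set 'rV[o]_rankD :=
  [set x | (forall f, M (contractE (coordE x) f)) /\
           (forall e, M (contractF (coordF x) e))].

(** [k] is the number of elementary divisors of [M] divisible by a given power
    of [p]: the coordinate [x_e] of an element of the centralizer is divisible
    by that power as soon as [0 < k], and the [f]-th adapted coordinate as soon
    as [f] involves one of the last [k] indices. *)
Definition cent_weight (k : nat) : nat :=
  (#|multiE| * (0 < k) +
   #|[pred f : multiF | [exists i : 'I_n, (n - k <= i)%N && (0 < val f
     i)%N]]|)%N.

Lemma cent_weight0 : cent_weight 0 = 0%N.
Proof.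
rewrite /cent_weight ltnn muln0 add0n; apply: eq_card0 => f; rewrite inE.
by apply/existsP => H; case: H => i; rewrite subn0 leqNgt ltn_ord.
Qed.

Lemma contractE_linear (c : o) (x y : 'rV[o]_rankD) f :
  contractE (coordE (c *: x + y)) f =
  c *: contractE (coordE x) f + contractE (coordE y) f.
Proof.
apply/rowP => i; rewrite !mxE mulr_sumr -big_split/=; apply: eq_bigr => e _.
by rewrite /coordE !mxE.
Qed.

Lemma contractF_linear (c : o) (x y : 'rV[o]_rankD) e :
  contractF (coordF (c *: x + y)) e =
  c *: contractF (coordF x) e + contractF (coordF y) e.
Proof.
apply/rowP => i; rewrite !mxE mulr_sumr -big_split/=; apply: eq_bigr => f _.
by rewrite /coordF !mxE.
Qed.

Lemma contractE0 f : contractE (coordE 0) f = 0.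
Proof.
by have := contractE_linear (-1) 0 0 f; rewrite scaler0 addr0 scaleN1r addNr.
Qed.

Lemma contractF0 e : contractF (coordF 0) e = 0.
Proof.
by have := contractF_linear (-1) 0 0 e; rewrite scaler0 addr0 scaleN1r addNr.
Qed.

Lemma centralizer_lattice M : lattice M -> lattice (centralizer M).
Proof.
move=> [sM [K MK]]; split.
  apply/submoduleP; split=> [|a x y [xE xF] [yE yF]]; split=> i.
  - by rewrite contractE0; exact: submod0.
  - by rewrite contractF0; exact: submod0.
  - by rewrite contractE_linear; apply: submodD => //; exact: submodZ.
  - by rewrite contractF_linear; apply: submodD => //; exact: submodZ.
exists K => x; rewrite -[_ *: x]addr0; split=> i.
  by rewrite contractE_linear contractE0 addr0.
by rewrite contractF_linear contractF0 addr0.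
Qed.

(* Coordinates adapted to a basis of [M]: only the coordinates along the [y_f]
   change. *)
Let adapt (g : 'M[o]_n) (x : 'rV[o]_rankD) : 'rV[o]_rankD :=
  \row_j match (enum_val j : D) with
         | inl e => coordE x e
         | inr f => act_symm g (coordF x) f
         end.

Let adaptE g x e : coordE (adapt g x) e = coordE x e.
Proof. by rewrite /coordE mxE enum_rankK. Qed.

Let adaptF g x f : coordF (adapt g x) f = act_symm g (coordF x) f.
Proof. by rewrite {1}/coordF mxE enum_rankK. Qed.

Let coord_inj x y : (forall e, coordE x e = coordE y e) ->
  (forall f, coordF x f = coordF y f) -> x = y.
Proof.
move=> E F; apply/rowP => j; rewrite -(enum_valK j).
by case: (enum_val j : D) => [e|f]; [exact: E|exact: F].
Qed.

Let adaptB g x y : adapt g (x - y) = adapt g x - adapt g y.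
Proof.
apply: coord_inj => [e|f].
  by rewrite adaptE /coordE !mxE !enum_rankK.
rewrite adaptF; transitivity (act_symm g (fun f => coordF x f - coordF y f) f).
  by congr act_symm; apply/funext => f'; rewrite /coordF !mxE.
by rewrite act_symmB -!adaptF /coordF !mxE.
Qed.

Let adaptK g h : g *m h = 1%:M -> cancel (adapt g) (adapt h).
Proof.
move=> gh x; apply: coord_inj => [e|f]; first by rewrite !adaptE.
rewrite adaptF -[RHS](congr1 (fun b => b f) (act_symmK gh (coordF x))).
by congr act_symm; apply/funext => f'; rewrite adaptF.
Qed.

Let exps (l : 'I_n -> nat) (j : 'I_rankD) : nat :=
  match (enum_val j : D) with
  | inl e => \max_i l i
  | inr f => \max_(i | (0 < val f i)%N) l i
  end.

Let centralizer_diag l (g : 'M[o]_n) : g \in unitmx ->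
  centralizer (diag_lattice l g) = [set x | diag_lattice (exps l) 1%:M (adapt g
    x)].
Proof.
move=> gU; apply/seteqP; split=> [x [xE xF] j|x dx].
  have HE := (contractE_cond Hp n0 l (coordE x) gU).1 xE.
  have HF := (@contractF_cond o p m n n0 l g (coordF x) gU).1 xF.
  rewrite mulmx1 mxE /exps; case: (enum_val j : D) => [e|f];
    [exact: HE|exact: HF].
split.
  apply: (contractE_cond Hp n0 l (coordE x) gU).2 => e.
  have := dx (enum_rank (inl e : D)).
  by rewrite mulmx1 -/(coordE (adapt g x) e) adaptE /exps enum_rankK.
apply: (@contractF_cond o p m n n0 l g (coordF x) gU).2 => f.
have := dx (enum_rank (inr f : D)).
by rewrite mulmx1 -/(coordF (adapt g x) f) adaptF /exps enum_rankK.
Qed.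

(* Count, for each [k], the coordinates divisible by [p ^ (k + 1)]. *)
Let sum_exps (l : 'I_n -> nat) : (forall i j : 'I_n, (i <= j)%N -> (l i <= l
  j)%N) ->
  (\sum_j exps l j = \sum_(k < \max_i l i) cent_weight #|[pred j | (k < l
    j)%N]|)%N.
Proof.
move=> lM; set K := (\max_i l i)%N.
transitivity (\sum_(c : D) match c with
    | inl e => K | inr f => \max_(i | (0 < val f i)%N) l i end)%N.
  by rewrite [RHS](reindex _ (onW_bij _ (@enum_val_bij D))).

rewrite big_sumType/= sum_nat_const /cent_weight big_split/=; congr (_ + _)%N.
  rewrite -big_distrr/=; congr (_ * _)%N.
  rewrite (eq_bigr (fun=> 1%N)) ?sum1_card ?card_ord// => k _.
  have [|j0 jE] := bigop.eq_bigmax l; first by rewrite card_ord.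
  suff -> : (0 < #|[pred j | (k < l j)%N]|)%N by [].
  by apply/card_gt0P; exists j0; rewrite inE -jE.
transitivity (\sum_(f : multiF) \sum_(k < K) (k < \max_(i | (0 < val f i)%N) l
  i))%N.
  apply: eq_bigr => f _; rewrite sum_ltn_nat//.
  by apply/bigop.bigmax_leqP => i _; exact: bigop.leq_bigmax.
rewrite exchange_big/=; apply: eq_bigr => k _.
rewrite [RHS]card_pred_sum; apply: eq_bigr => f _.
have up i := @card_upset n (fun j => (k < l j)%N) _ i.
have -> : (k < \max_(i | (0 < val f i)%N) l i)%N =
    [exists i : 'I_n, (n - #|[pred j | (k < l j)%N]| <= i)%N && (0 < val f
      i)%N].
  apply/idP/existsP => [|[i /andP[ki fi]]].
    apply: contraTP => H; rewrite -leqNgt; apply/bigop.bigmax_leqP => i fi.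
    rewrite leqNgt; apply/negP => ki; apply: H; exists i.
    rewrite fi andbT -up// => i1 i2 i12; move/leq_trans; apply; exact: lM.
  apply: (@leq_trans (l i)); last exact: (@bigop.leq_bigmax_cond _ _ l i fi).
  by rewrite up// => i1 i2 i12; move/leq_trans; apply; exact: lM.
by case: existsP.
Qed.

(** In adapted coordinates the centralizer is given by the exponents [exps l]. *)
Lemma vol_centralizer M : lattice M ->
  vol (centralizer M) = weight p q cent_weight M.
Proof.
move=> LM; have [l [g [gU ME lM]]] := smith Hp LM.
rewrite ME (weight_diag Hp cent_weight0 gU (K := \max_i l i)) => [|j];
  last first.
  exact: bigop.leq_bigmax.
rewrite -sum_exps//; apply: (vol_has_index Hp).
  by apply: lattice_sub; apply: centralizer_lattice; rewrite -ME.
rewrite centralizer_diag//.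
apply: (@has_index_preim _ _ (adapt (invmx g)) (adapt g)).
- exact: adaptB.
- by apply: adaptK; rewrite mulmxV.
- by apply: adaptK; rewrite mulVmx.
exact: has_index_diag (unitmx1 _ _).
Qed.

End Centralizer.

(** * Ideals of [L_{m,n}] *)

Section Ideals.
Context (o : idomainType) (p : o) (q : nat) (Hp : finite_dvr p q) (m n : nat).
Hypothesis n0 : (0 < n)%N.
Local Notation multiE := (multiE m.+1 n).
Local Notation multiF := (multiF m.+1 n).
Local Notation lattice := (lattice p).
Local Notation vol := (vol q).
Local Notation D := (multiE + multiF)%type.
Local Notation d := (rankD m n).
Local Notation L := (Lmn m.+1 n o).

(** Coordinates on [L_{m,n}], those along the center coming last. *)
Definition to_row (u : L) : 'rV[o]_(d + n) :=
  row_mx (\row_j u (inl (enum_val j : D))) (\row_i u (inr i)).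

Definition of_row (z : 'rV[o]_(d + n)) : L :=
  [ffun c => match c : lie_basis m.+1 n with
             | inl c' => lsubmx z 0 (enum_rank (c' : D))
             | inr i => rsubmx z 0 i
             end : o^o].

Lemma to_rowK : cancel to_row of_row.
Proof.
move=> u; apply/ffunP => -[c|i]; rewrite ffunE.
  by rewrite row_mxKl mxE enum_rankK.
by rewrite row_mxKr mxE.
Qed.

Lemma of_rowK : cancel of_row to_row.
Proof.
move=> z; rewrite -[RHS]hsubmxK; congr row_mx; apply/rowP => j;
  rewrite mxE ffunE//.
by rewrite enum_valK.
Qed.

Lemma of_row_linear a x y : of_row (a *: x + y) = a *: of_row x + of_row y.
Proof. by apply/ffunP => -[c|i]; rewrite !ffunE !mxE. Qed.

Lemma of_rowB : zmod_morphism of_row.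
Proof. by move=> x y; apply/ffunP => -[c|i]; rewrite !ffunE !mxE. Qed.

Lemma to_rowB : zmod_morphism to_row.
Proof.
move=> x y; rewrite /to_row opp_row_mx add_row_mx; congr row_mx;
by apply/rowP => j; rewrite !mxE !ffunE.
Qed.

Lemma bracketE (u w : L) : lie_bracket u w =
  of_row (row_mx 0 (\sum_f w (inl (inr f)) *: contractE (fun e =>
    u (inl (inl e))) f -
                    \sum_e w (inl (inl e)) *: contractF (fun f =>
                      u (inl (inr f))) e)).
Proof.
apply/ffunP => -[c|i]; rewrite !ffunE.
  rewrite row_mxKl mxE big1// => a _; rewrite big1// => b _.
  by case: a b => [[a|a]|a] [[b|b]|b]; rewrite /= mul0r.
have SE e : \sum_b (lie_coef (inl (inl e)) b (inr i))%:~R * (u (inl (inl e)) *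
  w b) =
    \sum_(f | unit_step e f i) w (inl (inr f)) * u (inl (inl e)) :> o.
  rewrite !big_sumType/= [X in X + _ + _]big1 ?add0r => [|e' _];
    last by rewrite mul0r.
  rewrite [X in _ + X]big1 ?addr0 => [|j _]; last by rewrite mul0r.
  rewrite [RHS]big_mkcond/=; apply: eq_bigr => f _.
  by case: unit_step; rewrite ?mul0r// mul1r mulrC.
have SF f : \sum_b (lie_coef (inl (inr f)) b (inr i))%:~R * (u (inl (inr f)) *
  w b) =
    - \sum_(e | unit_step e f i) w (inl (inl e)) * u (inl (inr f)) :> o.
  rewrite !big_sumType/= [X in _ + X + _]big1 ?addr0 => [|e' _];
    last by rewrite mul0r.
  rewrite [X in _ + X]big1 ?addr0 => [|j _]; last by rewrite mul0r.
  rewrite -sumrN [RHS]big_mkcond/=; apply: eq_bigr => e _.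
  case: unit_step; last by rewrite oppr0 mul0r.
  by rewrite rmorphN mulNr mul1r mulrC.
rewrite row_mxKr !big_sumType/= (eq_bigr _ (fun e _ =>
  SE e)) (eq_bigr _ (fun f _ => SF f)).
rewrite [X in _ + X]big1 ?addr0 => [|j _]; last first.
  by rewrite big1// => -[[b|b]|b] _; rewrite /= mul0r.
rewrite sumrN !mxE !summxE; congr (_ - _).
  rewrite (exchange_big_dep predT)//=; apply: eq_bigr => f _.
  by rewrite !mxE mulr_sumr.
rewrite (exchange_big_dep predT)//=; apply: eq_bigr => e _.
by rewrite !mxE mulr_sumr.
Qed.

Lemma bracket_antisym (u w : L) : lie_bracket w u = - lie_bracket u w.
Proof.
apply/ffunP => c; rewrite !ffunE exchange_big/= -sumrN; apply: eq_bigr => a _.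
rewrite -sumrN; apply: eq_bigr => b _.
have -> : lie_coef b a c = - lie_coef a b c.
  by case: a b c => [[a|a]|a] [[b|b]|b] [c|c] //=; rewrite ?oppr0 ?opprK.
by rewrite rmorphN mulNr [u a * _]mulrC.
Qed.

Definition row_set (N : set L) : set 'rV[o]_(d + n) := [set z | N (of_row z)].

Lemma row_setE N u : N u = row_set N (to_row u).
Proof. by rewrite /row_set/= to_rowK. Qed.

Lemma row_set_submodule N : is_submodule N <-> is_submodule (row_set N).
Proof.
split=> /submoduleP[N0 Nl]; apply/submoduleP; split=> [|a x y].
- by have := N0; rewrite (_ : 0 = of_row 0)//; apply/ffunP => -[c|i];
  rewrite !ffunE !mxE.
- by rewrite /row_set/= of_row_linear; exact: Nl.
- by rewrite row_setE (_ : to_row 0 = 0)//; have := to_rowB 0 0; rewrite !subrr.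
- rewrite !row_setE => Nx Ny; have := Nl a _ _ Nx Ny; rewrite /row_set/=.
  by rewrite of_row_linear !to_rowK.
Qed.

(** Brackets only depend on the image of [u] modulo the center and take values in
    the center, so the ideal condition relates the projection to the
    intersection. *)
Lemma ideal_row_set N :
  lie_ideals m.+1 n o N <->
  lattice (row_set N) /\ projL (row_set N) `<=` centralizer (capR (row_set N)).
Proof.
have partE (u : L) : coordE (lsubmx (to_row u)) = fun e => u (inl (inl e)).
  by apply/funext => e; rewrite /coordE row_mxKl mxE enum_rankK.
have partF (u : L) : coordF (lsubmx (to_row u)) = fun f => u (inl (inr f)).
  by apply/funext => e; rewrite /coordF row_mxKl mxE enum_rankK.
split=> [[sN Nb' fN]|[LI HI]].
  have Nb u w : N u -> N (lie_bracket u w).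
    by move=> /(Nb' w); rewrite bracket_antisym => /(submodN sN); rewrite opprK.
  have LI : lattice (row_set N).
    apply: (finite_index_lattice Hp); first exact/row_set_submodule.
    have sI := submod_subgroup ((row_set_submodule N).1 sN).
    have := finite_index_has_index (submod_subgroup sN) fN.
    move=> /(has_index_preim of_rowB of_rowK to_rowK).
    by move=> /(has_index_coset sI)[].
  split=> // x [y Ixy]; pose u := of_row (row_mx x y).
  have ux : lsubmx (to_row u) = x by rewrite of_rowK row_mxKl.
  rewrite -ux; split=> [f|e]; rewrite ?partE ?partF.
    pose w : L := [ffun c => (c == inl (inr f))%:R : o^o].
    have := Nb u w Ixy; rewrite bracketE [X in _ - X]big1 ?subr0 => [|e _].
      rewrite (bigD1 f)//= ffunE eqxx scale1r big1 ?addr0// => f' ff'.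
      by rewrite ffunE (inj_eq inl_inj) (inj_eq inr_inj) (negPf ff') scale0r.
    by rewrite ffunE (inj_eq inl_inj) scale0r.
  pose w : L := [ffun c => (c == inl (inl e))%:R : o^o].
  have := Nb u w Ixy; rewrite bracketE [X in X - _]big1 ?sub0r => [|f _].
    rewrite (bigD1 e)//= ffunE eqxx scale1r big1 ?addr0 => [|e' ee'].
      move=> H; rewrite -[contractF _ _]opprK.
      by apply: (submodN (lattice_sub (capR_lattice LI))).
    by rewrite ffunE (inj_eq inl_inj) (inj_eq inl_inj) (negPf ee') scale0r.
  by rewrite ffunE (inj_eq inl_inj) scale0r.
have sI := lattice_sub LI; have sN := (row_set_submodule N).2 sI.
split=> //.
  move=> w u Nu; rewrite bracket_antisym; apply: (submodN sN); rewrite bracketE.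
  have [|HE HF] := HI (lsubmx (to_row u)).
    by exists (rsubmx (to_row u)); rewrite hsubmxK -row_setE.
  rewrite partE in HE; rewrite partF in HF.
  have sC := lattice_sub (capR_lattice LI).
  suff : capR (row_set N) (\sum_f w (inl (inr f)) *: contractE (fun e =>
    u (inl (inl e))) f -
    \sum_e w (inl (inl e)) *: contractF (fun f => u (inl (inr f))) e) by [].
  by apply: (submodB sC); apply: (submod_sum sC) => i _; apply: (submodZ sC);
    [exact: HE|exact: HF].
have := has_index_preim to_rowB to_rowK of_rowK (has_index_vol Hp LI).
have -> : [set y | row_set N (to_row y)] = N.
  by apply/seteqP; split=> u; rewrite /= -row_setE.
by move=> /(has_index_coset (submod_subgroup sN))[].
Qed.

Lemma coset_index_ideal N : lie_ideals m.+1 n o N ->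
  coset_index N = (q ^ vol (row_set N))%N.
Proof.
move=> /[dup] -[sN _ _] /ideal_row_set[LI _].
have := has_index_preim to_rowB to_rowK of_rowK (has_index_vol Hp LI).
have -> : [set y | row_set N (to_row y)] = N.
  by apply/seteqP; split=> u; rewrite /= -row_setE.
by move=> /(has_index_coset (submod_subgroup sN))[].
Qed.

Variable R : realType.

Lemma esum_ideals (T : R) : 0 <= T -> zeta0 p q d T \is a fin_num ->
  (\esum_(N in lie_ideals m.+1 n o) (T ^+ vol (row_set N))%:E =
   zeta0 p q d T * zetaw p q n d (cent_weight m n) T)%E.
Proof.
move=> T0 zF; rewrite -(esum_constrained Hp (X := @centralizer o m n))//;
  last first.
  move=> M LM; have LC : lattice (@centralizer o m n M)
    by exact: centralizer_lattice.
  have [E [EE EI]] := lattice_basis Hp LC.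
  by exists E; split=> //; exact: vol_centralizer.
rewrite [RHS](@reindex_esum _ _ _ (lie_ideals m.+1 n o) _ row_set)//.
split=> [N /ideal_row_set//|N N' _ _ E|I [LI HI]].
  by apply/seteqP; split=> u; rewrite !row_setE E.
have E : row_set [set u | I (to_row u)] = I.
  by apply/seteqP; split=> z; rewrite /row_set/= of_rowK.
by exists [set u | I (to_row u)] => //; apply/ideal_row_set; rewrite E.
Qed.

End Ideals.

Section FreeModules.
Context (o : idomainType) (p : o) (q : nat) (Hp : finite_dvr p q).

Lemma free_submodulesE h : free_submodules h o = [set N | lattice p N].
Proof.
apply/seteqP; split=> [N [sN fN]|N LN]; first exact: (finite_index_lattice Hp
  sN fN).
by split; [exact: lattice_sub LN|exact: (lattice_finite_index Hp LN)].
Qed.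

End FreeModules.

(** * The quotient at [s = 0] *)

Theorem corollary3p4 (R : realType) (m n : nat) (o : idomainType)
    (hm : (0 < m)%N) (hn : (0 < n)%N) (ho : compact_dvr o) :
  let q := residue_card o in
  [/\ exists Z : Cplx R -> Cplx R, is_zeta q (lie_ideals m n o) Z,
      exists Z : Cplx R -> Cplx R, is_zeta q (free_submodules (hmn m n) o) Z
    & forall ZL Zo : Cplx R -> Cplx R,
        is_zeta q (lie_ideals m n o) ZL ->
        is_zeta q (free_submodules (hmn m n) o) Zo ->
        ZL s / Zo s @[s --> 0^'] --> (1 : Cplx R)].
Proof.
move=> q; have [p Hp] := compact_dvrP ho; rewrite -/q in Hp.
case: m hm => [//|m] _.
have q1 := residue_gt1 Hp.
pose d := rankD m n.
have -> : hmn m.+1 n = (d + n)%N by rewrite /hmn -rankD_dmn.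
have d0 : (0 < d)%N.
  by rewrite /d rankD_dmn// /dmn addn_gt0 /fmn bin_gt0; apply/orP; right; lia.
have [v vP] := zetaw_ratf1 Hp R n d0.
have v0 := zetaw_value_neq0 Hp vP.
have [PL [QL [zL QL1 vL]]] := vP _ (cent_weight0 m n).
have [PO [QO [zO QO1 vO]]] := vP (fun=> 0%N) erefl.
have zd := zeta0_ratf Hp R d.
set B := \prod_(i < d) _ in zd.
have [_ [e e0 zdE]] := zd.
have zdF T : 0 < T < e -> zeta0 p q d T \is a fin_num.
  by move=> /zdE[_ ->].
have fL : ratf (fun T : R => \esum_(N in lie_ideals m.+1 n o)
    (T ^+ vol q (row_set N))%:E)%E (1 * PL) (B * QL).
  apply: (ratf_ext e0 _ (ratf_mul zd zL)) => T Te.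
  by rewrite (esum_ideals Hp)// ?zdF//; case/andP: Te => /ltW.
have fO : ratf (fun T : R => \esum_(N in free_submodules (d + n) o)
    (T ^+ vol q N)%:E)%E (1 * PO) (B * QO).
  apply: (ratf_ext e0 _ (ratf_mul zd zO)) => T Te.
  rewrite (free_submodulesE Hp) -zeta0E (zeta0_add Hp)// ?zdF//.
  by case/andP: Te => /ltW.
have iL N : lie_ideals m.+1 n o N -> coset_index N = (q ^ vol q (row_set N))%N.
  exact: (coset_index_ideal Hp).
have iO N : free_submodules (d + n) o N -> coset_index N = (q ^ vol q N)%N.
  by rewrite (free_submodulesE Hp); exact: coset_index_vol.
split.
- by eexists; exact: (is_zeta_ratf q1 iL fL).
- by eexists; exact: (is_zeta_ratf q1 iO fO).
move=> ZL Zo hL hO.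
have nL := is_zeta_unique q1 iL fL hL.
have nO := is_zeta_unique q1 iO fO hO.
pose t s : Cplx R := natCpow q (- s).
(* Where [G] does not vanish, the common factor [1 / B] cancels. *)
pose G := B * PO * QL.
have PO1 : PO.[1] != 0.
  by apply: contra_neq v0 => h; rewrite -vO h mul0r.
have B0 : B != 0.
  by case: zd => h _; apply: contraNneq h => ->; rewrite horner0.
have PO0 : PO != 0 by apply: contraNneq PO1 => ->; rewrite horner0.
have QL0 : QL != 0 by apply: contraNneq QL1 => ->; rewrite horner0.
have G0 : cpoly G != 0 by rewrite map_poly_eq0 !mulf_neq0.
have nG := horner_natCpow_neq0 q1 G0.
have horner_rc (P : {poly R}) : (cpoly P).[1] = real_complex R P.[1].
  by rewrite -[X in _.[X]](rmorph1 (real_complex R)) horner_map.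
have lim : (cpoly (PL * QO)).[t s] / (cpoly (QL * PO)).[t s] @[s --> (0 : Cplx
  R)^']
    --> (1 : Cplx R).
  have -> : (1 : Cplx R) = (cpoly (PL * QO)).[1] / (cpoly (QL * PO)).[1].
    rewrite !horner_rc -fmorphV -rmorphM/= !hornerM -mulf_div vL.
    by rewrite -[X in v * X]invf_div vO divff// rmorph1.
  apply: cvgM; first exact: horner_natCpow_cvg.
  apply: cvgV; last exact: horner_natCpow_cvg.
  by rewrite horner_rc hornerM fmorph_eq0 mulf_neq0.
apply: cvg_trans lim; apply: near_eq_cvg.
apply: filterS3 nL nO nG => s -> ->.
rewrite /cpoly !rmorphM !rmorph1 !hornerM !hornerC !mul1r !mulf_eq0 !negb_or.
move=> /andP[/andP[Bt _] _].
by rewrite invf_div [RHS]mulf_div [X in _ = X / _]mulrCA -[X in _ = _ / X]mulrA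
  -[RHS]mulf_div divff// mul1r.
Qed.
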